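(* Let $\mathfrak b\in[\mathbb H^\infty_d]_1$ be NC rational with $\mathfrak b(0)=0$, let $\zeta\in\partial\mathbb D$, and let $A(\zeta)^*:=T(\zeta)^*|_{\mathcal K_\zeta}$ be a column-isometric restriction of $T(\zeta)^*$ to an invariant subspace $\mathcal K_\zeta\subseteq\mathscr M(\mathfrak b)$. Suppose that $\dim\mathcal K_\zeta=n$, identify $\mathcal K_\zeta$ with $\mathbb C^n$, and let $v$ be a unit eigenvector of $\mathfrak b(A(\zeta)^{\mathrm t})^{\mathrm t}$ corresponding to the eigenvalue $\zeta$. Then for any $y\in\mathbb C^n$ the limit $K^{\mathfrak b}\{A(\zeta),y,v\}:=\lim_{r\uparrow1}K^{\mathfrak b}\{rA(\zeta),y,v\}$ exists, and for any $h\in\mathscr H^{\mathrm t}(\mathfrak b)$ the limit $$y^*h(A(\zeta))v:=\lim_{r\uparrow1}y^*h(rA(\zeta))v=\langle K^{\mathfrak b}\{A(\zeta),y,v\},h\rangle_{\mathscr H^{\mathrm t}(\mathfrak b)}$$ exists.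
   Context: Fix $d\in\mathbb N$. $\mathbb F^d$ is the free monoid of words in $1,\dots,d$ with unit $\emptyset$; for $\omega=i_1\cdots i_m$, $\omega^{\mathrm t}:=i_m\cdots i_1$, and $A^\omega:=A_{i_1}\cdots A_{i_m}$, $A^{*\omega}:=(A^\omega)^*$ for a $d$-tuple $A$ of operators. $\bigvee$ denotes closed linear span; inner products are linear in the second variable. $\mathbb H^2_d$ is the Hilbert space of power series $\sum_\omega\hat h_\omega\mathfrak z^\omega$ in non-commuting variables $\mathfrak z_1,\dots,\mathfrak z_d$ with square-summable coefficients, viewed as functions on $\mathbb B^d_{\mathbb N}=\bigsqcup_m\mathbb B^d_m$, $\mathbb B^d_m$ the set of $d$-tuples $Z$ of $m\times m$ matrices with $\sum_jZ_jZ_j^*<I_m$; $L_k$ is left multiplication by $\mathfrak z_k$; $U_{\mathrm t}\mathfrak z^\omega=\mathfrak z^{\omega^{\mathrm t}}$ is unitary and $h^{\mathrm t}:=U_{\mathrm t}h$. $\mathbb H^\infty_d$ is the algebra of NC functions uniformly bounded on $\mathbb B^d_{\mathbb N}$, identified isometrically with the left multipliers $F(L):h\mapsto F\cdot h$ of $\mathbb H^2_d$; $F(R):=U_{\mathrm t}F(L)U_{\mathrm t}$ is right multiplication by $F^{\mathrm t}$; $[\mathbb H^\infty_d]_1$ is the closed unit ball. An NC rational function is an equivalence class of expressions built from the variables, scalars, $+,\cdot,{}^{-1}$ (equivalent if equal on common domains of matrix tuples of all sizes), with domain $\mathrm{Dom}$ the union of the domains of its representatives; $\mathfrak b\in\mathbb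 H^\infty_d$ is NC rational if given by such a function. The right free de Branges--Rovnyak space $\mathscr H^{\mathrm t}(\mathfrak b)$ is $\mathrm{Ran}\sqrt{I-\mathfrak b(R)\mathfrak b(R)^*}\subseteq\mathbb H^2_d$ with the norm making $\sqrt{I-\mathfrak b(R)\mathfrak b(R)^*}$ a co-isometry onto its range. For $Z\in\mathbb B^d_m$, $y,v\in\mathbb C^m$, $K^{\mathfrak b}\{Z,y,v\}\in\mathscr H^{\mathrm t}(\mathfrak b)$ denotes the unique vector with $\langle K^{\mathfrak b}\{Z,y,v\},h\rangle_{\mathscr H^{\mathrm t}(\mathfrak b)}=y^*h(Z)v$ for all $h\in\mathscr H^{\mathrm t}(\mathfrak b)$. The space is $L_k^*$-invariant and contains $L_k^*\mathfrak b^{\mathrm t}$; since $\mathfrak b(0)=0$ it contains $1$. Put $\mathscr M(\mathfrak b):=\mathbb C1+\bigvee_{\omega\ne\emptyset}L^{*\omega}\mathfrak b^{\mathrm t}$, a finite-dimensional space. For $\zeta\in\mathbb C$, $T(\zeta)=(T(\zeta)_1,\dots,T(\zeta)_d)$ is the $d$-tuple on $\mathscr M(\mathfrak b)$ with $T(\zeta)_k^*h=L_k^*h+\overline\zeta\langle1,h\rangle_{\mathscr H^{\mathrm t}(\mathfrak b)}L_k^*\mathfrak b^{\mathrm t}$; it is a row contraction for $\zeta\in\partial\mathbb D$. $T(\zeta)^*|_{\mathcal K}$ is column-isometric if $\sum_k\|T(\zeta)_k^*h\|^2=\|h\|^2$ for $h\in\mathcal K$; $A(\zeta)_k^*=T(\zeta)_k^*|_{\mathcal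 K_\zeta}$. The identification of $\mathcal K_\zeta$ with $\mathbb C^n$ is by an orthonormal basis, $\mathrm t$ denotes matrix transpose (componentwise on tuples), and $A(\zeta)^{\mathrm t}$ lies in $\mathrm{Dom}\,\mathfrak b$. *)

(* Defs.v *)
From mathcomp Require Import all_boot all_order all_algebra.
From mathcomp Require Import all_classical all_reals all_analysis.
From mathcomp Require Import spectral complex.

Set Implicit Arguments.
Unset Strict Implicit.
Unset Printing Implicit Defensive.

Import Order.TTheory GRing.Theory Num.Theory.
Import numFieldNormedType.Exports.

Local Open Scope classical_set_scope.
Local Open Scope ring_scope.
Local Open Scope complex_scope.
Local Open Scope sesquilinear_scope.

(* [R[i]] with its usual topology; the regular module [_^o] is what carries the
   normed module structure. *)
Notation Cplx R := (R[i]^o).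

Section FreeDeBrangesRovnyak.
Variables (R : realType) (d : nat).
Local Notation C := (Cplx R).

Definition word := seq 'I_d.

Definition fps := word -> C.

(* Summation over all words, by homogeneous degree; every family to which it is
   applied below is absolutely summable. *)
Definition wsum (F : word -> C) : C :=
  limn (series (fun k => \sum_(w : k.-tuple 'I_d) F w)).

Definition H2 (h : fps) : Prop :=
  (\esum_(w in [set: word]) (Normc.normc (h w) ^+ 2)%:E < +oo)%E.

Definition dot (g h : fps) : C := wsum (fun w => (g w)^* * h w).

Definition fps_one : fps := fun w => (w == [::])%:R.

Definition fps_var (k : 'I_d) : fps := fun w => (w == [:: k])%:R.

Definition fps_mul (f g : fps) : fps :=
  fun w => \sum_(i < (size w).+1) f (take i w) * g (drop i w).

(* Operators on the free Hardy space are maps on [fps] of which only the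
   values on [H2] matter. *)

Definition is_adjoint (T T' : fps -> fps) : Prop :=
  (forall h, H2 h -> H2 (T' h)) /\
  (forall g h, H2 g -> H2 h -> dot (T' g) h = dot g (T h)).

Definition adjoint (T : fps -> fps) : fps -> fps :=
  xget (fun=> 0) [set T' | is_adjoint T T'].

(* Positive square roots; boundedness of [S] is automatic, as [S] is symmetric
   and defined on the whole of [H2]. *)
Definition is_psqrt (P S : fps -> fps) : Prop :=
  [/\ forall h, H2 h -> H2 (S h),
      forall (c : C) g h, H2 g -> H2 h -> S (c *: g + h) = c *: S g + S h,
      forall h, H2 h -> 0 <= dot h (S h)
    & forall h, H2 h -> S (S h) = P h].

Definition psqrt (P : fps -> fps) : fps -> fps :=
  xget (fun=> 0) [set S | is_psqrt P S].

Definition Ut (h : fps) : fps := fun w => h (rev w).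

Definition multL (F : fps) : fps -> fps := fps_mul F.

Definition multR (F : fps) : fps -> fps := Ut \o multL F \o Ut.

Definition L (k : 'I_d) : fps -> fps := multL (fps_var k).

Definition Lword (w : word) : fps -> fps :=
  foldr (fun k T => L k \o T) id w.

Definition cdot m (x y : 'cV[C]_m) : C := (x ^t* *m y) 0 0.

Definition wordmx m (Z : 'I_d -> 'M[C]_m) (w : word) : 'M[C]_m :=
  \big[mulmx/1%:M]_(k <- w) Z k.

Definition row_ball m (Z : 'I_d -> 'M[C]_m) : Prop :=
  forall x : 'cV[C]_m, x != 0 ->
    0 < cdot x ((1%:M - \sum_k Z k *m (Z k) ^t*) *m x).

Definition fps_eval m (h : fps) (Z : 'I_d -> 'M[C]_m) : 'M[C]_m :=
  \matrix_(i, j) wsum (fun w => h w * wordmx Z w i j).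

(* The closed unit ball of the algebra of uniformly bounded NC functions on the
   row ball; such a function [F] is the sum of its power series, which lies in
   [H2] because [F = F(L) 1]. *)
Definition Hinf_ball (F : fps) : Prop :=
  H2 F /\
  forall m (Z : 'I_d -> 'M[C]_m), row_ball Z ->
    forall x : 'cV[C]_m,
      cdot (fps_eval F Z *m x) (fps_eval F Z *m x) <= cdot x x.

Inductive ncexpr : Type :=
| NCvar of 'I_d
| NCcst of C
| NCadd of ncexpr & ncexpr
| NCmul of ncexpr & ncexpr
| NCinv of ncexpr.

Fixpoint ncexpr_eval m (Z : 'I_d -> 'M[C]_m) (r : ncexpr) : option 'M[C]_m :=
  match r with
  | NCvar k => Some (Z k)
  | NCcst c => Some c%:M
  | NCadd r1 r2 =>
      if (ncexpr_eval Z r1, ncexpr_eval Z r2) is (Some M1, Some M2)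
      then Some (M1 + M2) else None
  | NCmul r1 r2 =>
      if (ncexpr_eval Z r1, ncexpr_eval Z r2) is (Some M1, Some M2)
      then Some (M1 *m M2) else None
  | NCinv r1 =>
      if ncexpr_eval Z r1 is Some M
      then (if M \in unitmx then Some (invmx M) else None) else None
  end.

Definition ncequiv (r s : ncexpr) : Prop :=
  forall m (Z : 'I_d -> 'M[C]_m) (M N : 'M[C]_m),
    ncexpr_eval Z r = Some M -> ncexpr_eval Z s = Some N -> M = N.

(* The graph at level m of the NC rational function represented by [r]: all
   representatives contribute. *)
Definition ncrat_graph (r : ncexpr) m (Z : 'I_d -> 'M[C]_m) : set 'M[C]_m :=
  [set M | exists2 s, ncequiv r s & ncexpr_eval Z s = Some M].

Definition ncrat_dom (r : ncexpr) m (Z : 'I_d -> 'M[C]_m) : Prop :=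
  ncrat_graph r Z !=set0.

(* The value is 0 off the domain. *)
Definition ncrat_eval (r : ncexpr) m (Z : 'I_d -> 'M[C]_m) : 'M[C]_m :=
  xget 0 (ncrat_graph r Z).

(* [h] is given on the row ball by the NC rational function represented by [r].
   Single-valuedness of the graph excludes expressions that are defined nowhere,
   which would be equivalent to every expression. *)
Definition ncrat_represents (r : ncexpr) (h : fps) : Prop :=
  forall m (Z : 'I_d -> 'M[C]_m), row_ball Z ->
    ncrat_dom r Z /\ (forall M, ncrat_graph r Z M -> M = fps_eval h Z).

Section Space.
Variable b : fps.

Definition defect : fps -> fps :=
  psqrt (fun h => h - multR b (adjoint (multR b) h)).

Definition Hb (h : fps) : Prop := exists2 x, H2 x & h = defect x.

Definition defect_kerperp (x : fps) : Prop :=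
  H2 x /\ forall u, H2 u -> defect u = 0 -> dot u x = 0.

Definition defect_lift (h : fps) : fps :=
  xget 0 [set x | defect_kerperp x /\ defect x = h].

(* The inner product for which [defect] is isometric on the orthogonal
   complement of its kernel, i.e. a co-isometry onto its range. *)
Definition dotb (g h : fps) : C := dot (defect_lift g) (defect_lift h).

Definition normb (h : fps) : R := Num.sqrt (complex.Re (dotb h h)).

Definition kerb m (Z : 'I_d -> 'M[C]_m) (y v : 'cV[C]_m) : fps :=
  xget 0 [set K | Hb K /\
    forall h, Hb h -> dotb K h = cdot y (fps_eval h Z *m v)].

Definition lspan (S : set fps) : set fps :=
  [set h | exists n (c : 'I_n -> C) (s : 'I_n -> fps),
     (forall i, S (s i)) /\ h = \sum_i c i *: s i].

Definition clspan (S : set fps) : set fps :=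
  [set h | Hb h /\
     forall eps : R, 0 < eps -> exists2 g, lspan S g & normb (h - g) < eps].

Definition Mb : set fps :=
  [set h | exists (c : C) (g : fps),
     clspan [set adjoint (Lword w) (Ut b) | w in [set w | w != [::]]] g /\
     h = c *: fps_one + g].

(* The operator T(zeta)_k^*. *)
Definition Tstar (zeta : C) (k : 'I_d) (h : fps) : fps :=
  adjoint (L k) h
    + (zeta^* * dotb fps_one h : C) *: adjoint (L k) (Ut b).

Definition orthonormal_basis n (K : set fps) (e : 'I_n -> fps) : Prop :=
  [/\ forall i, Hb (e i),
      forall i j, dotb (e i) (e j) = (i == j)%:R
    & K = lspan (range e)].

Definition column_isometric_on (K : set fps) (T : 'I_d -> fps -> fps) : Prop :=
  forall h, K h -> \sum_k normb (T k h) ^+ 2 = normb h ^+ 2.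

(* A(zeta) as a tuple of matrices in the orthonormal basis [e]: the adjoints of
   the matrices of the restrictions of the T(zeta)_k^*. *)
Definition Amx (zeta : C) n (e : 'I_n -> fps) (k : 'I_d) : 'M[C]_n :=
  (\matrix_(i, j) dotb (e i) (Tstar zeta k (e j))) ^t*.

End Space.

End FreeDeBrangesRovnyak.

(* Main.v *)
(** Put b(z) = b^t(zA) and let B be the multiplier b(R). Since B^* K{zA,y,p} =
    K{zA,y,b(z)p}, the de Branges-Rovnyak kernels have Gram function
      D(z,w) = G(z,v;w,v) - G(z,b(z)v;w,b(w)v),
    where G(z,p;w,q) = <K{zA,y,p}, K{wA,y,q}> is the power series
    sum_k (z conj w)^k q^* Psi^k[y y^*] p and Psi(Y) = sum_j A_j^* Y A_j. As
    sum_j A_j A_j^* = I, the iterates of Psi are bounded, so 1 is a semisimple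
    eigenvalue of Psi and (1 - z conj w) G(z,p;w,q) has an Abel limit at 1.
    Rationality gives b(z)v = zeta v + (1 - z) u(z) with u continuous at 1, hence
      (1 - z conj w) D(z,w) = - (1 - z) a(z,w) - conj((1 - w) a(w,z)) + o(.)
    with a(z,w) tending to some alpha. Positivity of D(z,z) when z tends to 1 along
    rays of arbitrary slope forces alpha to be real, as in the Julia-Caratheodory
    theorem. Then D(s,t) tends to -alpha as (s,t) tends to (1,1) in the real
    direction, which says that the kernels K^b{tA,y,v} form a Cauchy family. *)

From HB Require Import structures.
Require Import Defs.
From mathcomp Require Import all_boot all_order all_algebra.
From mathcomp Require Import all_classical all_reals all_analysis.
From mathcomp Require Import spectral complex.
From mathcomp Require Import zify ring lra.

Set Implicit Arguments.
Unset Strict Implicit.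
Unset Printing Implicit Defensive.

Import Order.TTheory GRing.Theory Num.Theory.
Import numFieldNormedType.Exports.

Local Open Scope classical_set_scope.
Local Open Scope ring_scope.
Local Open Scope complex_scope.
Local Open Scope sesquilinear_scope.
Local Open Scope ring_scope.

(** * Complex limits *)

(** The limit statements only concern pairs with [z * w^*] real in the open unit interval. These
    include the diagonal, where positivity is available, and the pairs of real points needed for the
    Cauchy property; they also turn the Abel limit into one in a real variable. The number alpha
    must be the same in both uses, so each limit is asserted at once for all filters along which
    such pairs tend to (1,1). Realness of alpha matters because the weights (1 - s)/(1 - st) and (1
    - t)/(1 - st) have no limit separately; only their sum tends to 1. The eigenvalue enters through
    [zeta * zeta^* = 1], which cancels G(z,v;w,v), the only term without a factor 1 - z or conj(1 -
    w). The adjoint, the square root S of 1 - B B^*, the minimal preimages under S and the kernels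
    are defined by choice, so each has to be shown to exist. The kernel of the space at zA is S S
    K{zA,y,v}, and S is isometric from the complement of its kernel onto the space, so D(z,w) is the
    inner product of S K{zA,y,v} and S K{wA,y,v} in the free Hardy space. *)

Lemma eq_cvgr (T : Type) (U : topologicalType) (F : set_system T) {FF : Filter F}
    (f g : T -> U) (l : U) :
  (forall x, f x = g x) -> f x @[x --> F] --> l -> g x @[x --> F] --> l.
Proof. by move=> /funext ->. Qed.

Lemma cvg_sum (K : numFieldType) (V : normedModType K) (T I : Type) (F : set_system T)
    {FF : Filter F} (r : seq I) (P : pred I) (f : I -> T -> V) (l : I -> V) :
  (forall i, P i -> f i x @[x --> F] --> l i) ->
  \sum_(i <- r | P i) f i x @[x --> F] --> \sum_(i <- r | P i) l i.
Proof. by move=> h; apply: cvg_big => //; exact: add_continuous. Qed.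

Section Complex.
Variable R : realType.
Local Notation C := (Cplx R).
Local Notation nc := (@Normc.normc R).

Lemma normcE_def (z : R[i]) : `|z| = (nc z)%:C.
Proof. by []. Qed.

Lemma nc_ge0 (z : R[i]) : 0 <= nc z.
Proof. by rewrite -lecR -normcE_def normr_ge0. Qed.

Lemma nc_real (x : R) : nc x%:C = `|x|.
Proof. by rewrite /= expr0n addr0 sqrtr_sqr. Qed.

Lemma nc_conj (z : R[i]) : nc z^* = nc z.
Proof. by apply: complexI; rewrite -!normcE_def norm_conjC. Qed.

Lemma ncB (x y : R[i]) : nc (x - y) = nc (y - x).
Proof. by rewrite -normcN opprB. Qed.

Lemma conjCD (x y : R[i]) : (x + y)^* = x^* + y^*.
Proof. exact: rmorphD. Qed.

Lemma conjCM (x y : R[i]) : (x * y)^* = x^* * y^*.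
Proof. exact: rmorphM. Qed.

Lemma conjCN (x : R[i]) : (- x)^* = - x^*.
Proof. exact: rmorphN. Qed.

Lemma conjC_sum I (s : seq I) (P : pred I) (F : I -> R[i]) :
  (\sum_(i <- s | P i) F i)^* = \sum_(i <- s | P i) (F i)^*.
Proof. exact: rmorph_sum. Qed.

Lemma conjCX (x : R[i]) n : (x ^+ n)^* = x^* ^+ n.
Proof. exact: rmorphXn. Qed.

Lemma conjC_r (x : R) : (x%:C)^* = x%:C :> R[i].
Proof. exact: conjc_real. Qed.

Lemma realCD (x y : R) : (x + y)%:C = x%:C + y%:C :> R[i].
Proof. exact: rmorphD. Qed.

Lemma realCB (x y : R) : (x - y)%:C = x%:C - y%:C :> R[i].
Proof. exact: rmorphB. Qed.

Lemma realCM (x y : R) : (x * y)%:C = x%:C * y%:C :> R[i].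
Proof. exact: rmorphM. Qed.

Lemma realCX (x : R) n : (x ^+ n)%:C = x%:C ^+ n :> R[i].
Proof. exact: rmorphXn. Qed.

Lemma nc_sqr (z : R[i]) : (nc z ^+ 2)%:C = z^* * z.
Proof. by rewrite rmorphXn /= -normcE_def normCKC. Qed.

Lemma ncX (z : R[i]) n : nc (z ^+ n) = nc z ^+ n.
Proof.
elim: n => [|n IH]; last by rewrite !exprS Normc.normcM IH.
by rewrite !expr0 Normc.normc1.
Qed.

Lemma nc_sum I (s : seq I) (P : pred I) (F : I -> R[i]) :
  nc (\sum_(i <- s | P i) F i) <= \sum_(i <- s | P i) nc (F i).
Proof.
elim/big_ind2: _ => [|x a y b' ha hb|//]; first by rewrite Normc.normc0.
by apply: le_trans (le_normcD _ _) _; exact: lerD.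
Qed.

Lemma Re_le_nc (z : R[i]) : `|complex.Re z| <= nc z.
Proof. by rewrite -lecR; exact: normc_ge_Re. Qed.

Lemma Im_le_nc (z : R[i]) : `|complex.Im z| <= nc z.
Proof.
have := Re_le_nc (z * 'i); rewrite ReiNIm normrN => /le_trans; apply.
by rewrite Normc.normcM /= expr0n add0r expr1n sqrtr1 mulr1.
Qed.

Lemma nc_le_ReIm (z : R[i]) : nc z <= `|complex.Re z| + `|complex.Im z|.
Proof.
rewrite [X in nc X]complexE; apply: le_trans (le_normcD _ _) _.
by rewrite Normc.normcM !nc_real /= expr0n add0r expr1n sqrtr1 mul1r.
Qed.

(** The norm of [C] takes values in [R[i]], so radii of neighbourhoods are positive complex numbers,
    hence real. Passing to [nc] gives a real-valued distance, to which squeezing and order arguments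
    apply. *)
Lemma cvgC T (F : set_system T) {FF : Filter F} (f : T -> C) (l : C) :
  f x @[x --> F] --> l <-> nc (f x - l) @[x --> F] --> (0 : R).
Proof.
split=> [/cvgrPdist_lt h|/cvgrPdist_lt h]; apply/cvgrPdist_lt.
- move=> e e0; have e0' : (0 : R[i]) < e%:C by rewrite ltcR.
  have := h _ e0'; apply: filterS => x; rewrite normcE_def ltcR => hx.
  by rewrite sub0r normrN ger0_norm ?nc_ge0 // ncB.
- move=> e e0.
  have er : e = (complex.Re e)%:C by rewrite RRe_real // ger0_real // ltW.
  have e0' : (0 : R) < complex.Re e by rewrite -ltcR -er.
  have := h _ e0'; apply: filterS => x.
  by rewrite sub0r normrN ger0_norm ?nc_ge0 // ncB [in X in _ -> X]er normcE_def ltcR.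
Qed.

Lemma cvgC_ReIm T (F : set_system T) {FF : Filter F} (f : T -> C) (a c : R) :
  complex.Re (f x) @[x --> F] --> a -> complex.Im (f x) @[x --> F] --> c ->
  f x @[x --> F] --> (a +i* c : C).
Proof.
move=> ha hc; apply/cvgC.
have norm0 (g : T -> R) (m : R) : g x @[x --> F] --> m -> `|g x - m| @[x --> F] --> (0 : R).
  move=> hg; rewrite -(normr0 R) -(subrr m); apply: cvg_norm.
  by apply: cvgB => //; exact: cvg_cst.
have h : (fun x => `|complex.Re (f x) - a| + `|complex.Im (f x) - c|) @ F --> (0 : R).
  by rewrite -[X in _ --> X]addr0; apply: cvgD; exact: norm0.
apply: (squeeze_cvgr _ (cvg_cst (0 : R)) h).
apply: nearW => x; rewrite nc_ge0 /=; apply: le_trans (nc_le_ReIm _) _.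
by case: (f x).
Qed.

Lemma cvgC_Re T (F : set_system T) {FF : Filter F} (f : T -> C) (l : C) :
  f x @[x --> F] --> l -> complex.Re (f x) @[x --> F] --> complex.Re l.
Proof.
move=> /cvgC h; apply/cvgrPdist_lt => e e0; move/cvgrPdist_lt: h => /(_ e e0).
apply: filterS => x; rewrite sub0r normrN ger0_norm ?nc_ge0 // => /(le_lt_trans _); apply.
by rewrite ncB; apply: le_trans (Re_le_nc _); case: (f x) l => [? ?] [? ?].
Qed.

Lemma cvg_nc T (F : set_system T) {FF : Filter F} (f : T -> C) (l : C) :
  f x @[x --> F] --> l -> nc (f x) @[x --> F] --> nc l.
Proof.
move=> /cvgC h; apply/cvgrPdist_lt => e e0; move/cvgrPdist_lt: h => /(_ e e0).
apply: filterS => x; rewrite sub0r normrN ger0_norm ?nc_ge0 // => /(le_lt_trans _); apply.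
have h1 := le_normcD (f x) (l - f x); have h2 := le_normcD l (f x - l).
by rewrite addrC subrK -ncB in h1; rewrite addrC subrK in h2; rewrite ler_norml; apply/andP;
  split; lra.
Qed.

Lemma cvgC_eq T (F : set_system T) {FF : Filter F} (f g : T -> C) (l m : C) :
  f x @[x --> F] --> l -> l = m -> (forall x, f x = g x) -> g x @[x --> F] --> m.
Proof. by move=> h <- /funext <-. Qed.

Lemma cvgCD T (F : set_system T) {FF : Filter F} (f g : T -> C) (l m : C) :
  f x @[x --> F] --> l -> g x @[x --> F] --> m -> f x + g x @[x --> F] --> (l + m : C).
Proof. by move=> hf hg; exact: (cvgD hf hg). Qed.

Lemma cvgCM T (F : set_system T) {FF : Filter F} (f g : T -> C) (l m : C) :
  f x @[x --> F] --> l -> g x @[x --> F] --> m -> f x * g x @[x --> F] --> (l * m : C).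
Proof. by move=> hf hg; exact: (cvgM hf hg). Qed.

Lemma cvgCZ T (F : set_system T) {FF : Filter F} (c : C) (f : T -> C) (l : C) :
  f x @[x --> F] --> l -> c * f x @[x --> F] --> (c * l : C).
Proof. by move=> hf; apply: (cvgCM (f := fun=> c)) hf; exact: cvg_cst. Qed.

Lemma cvg_conj T (F : set_system T) {FF : Filter F} (f : T -> C) (l : C) :
  f x @[x --> F] --> l -> (f x)^* @[x --> F] --> (l^* : C).
Proof.
move=> /cvgC h; apply/cvgC; apply: cvg_trans h; apply: near_eq_cvg.
by apply: nearW => x /=; rewrite -rmorphB nc_conj.
Qed.

Lemma cvg_realC T (F : set_system T) {FF : Filter F} (f : T -> R) (l : R) :
  f x @[x --> F] --> l -> ((f x)%:C : C) @[x --> F] --> (l%:C : C).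
Proof.
by move=> h; apply: cvgC_ReIm => //=; exact: cvg_cst.
Qed.

End Complex.

(** * Sums over words *)

Section WordSums.
Variable d : nat.

Definition hsum (V : nmodType) k (F : word d -> V) : V :=
  \sum_(w : k.-tuple 'I_d) F w.

Definition psum (V : nmodType) N (F : word d -> V) : V :=
  \sum_(k < N) hsum k F.

Lemma hsum0 (V : nmodType) (F : word d -> V) : hsum 0 F = F [::].
Proof.
rewrite /hsum (bigD1 [tuple]) //= big1 ?addr0 // => w.
by case/eqP; exact: tuple0.
Qed.

Lemma hsumS (V : nmodType) k (F : word d -> V) :
  hsum k.+1 F = \sum_i hsum k (fun w => F (i :: w)).
Proof.
rewrite /hsum pair_big /=.
rewrite (reindex (fun p : 'I_d * k.-tuple 'I_d => [tuple of p.1 :: p.2])) //=.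
exists (fun t => (thead t, [tuple of behead t])) => [[i t] _|t _] /=.
  by rewrite theadE; congr pair; apply: val_inj.
by rewrite [RHS]tuple_eta.
Qed.

Lemma hsum_rev (V : nmodType) k (F : word d -> V) :
  hsum k (fun w => F (rev w)) = hsum k F.
Proof.
rewrite /hsum [RHS](reindex (fun t : k.-tuple 'I_d => [tuple of rev t])) //=.
by exists (fun t : k.-tuple 'I_d => [tuple of rev t]) => t _; apply: val_inj; rewrite /= revK.
Qed.

Lemma hsumSr (V : nmodType) k (F : word d -> V) :
  hsum k.+1 F = \sum_i hsum k (fun w => F (rcons w i)).
Proof.
rewrite -hsum_rev hsumS; apply: eq_bigr => i _.
by rewrite -[RHS]hsum_rev; apply: eq_bigr => w _; rewrite rev_cons.
Qed.

Lemma eq_hsum (V : nmodType) k (F G : word d -> V) :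
  (forall w, size w = k -> F w = G w) -> hsum k F = hsum k G.
Proof. by move=> h; apply: eq_bigr => w _; rewrite h ?size_tuple. Qed.

Lemma eq_psum (V : nmodType) N (F G : word d -> V) :
  (forall w, (size w < N)%N -> F w = G w) -> psum N F = psum N G.
Proof. by move=> h; apply: eq_bigr => k _; apply: eq_hsum => w hw; rewrite h ?hw. Qed.

Lemma hsumD (V : nmodType) k (F G : word d -> V) :
  hsum k (fun w => F w + G w) = hsum k F + hsum k G.
Proof. by rewrite /hsum big_split. Qed.

Lemma hsum_sum (V : nmodType) k I (s : seq I) (P : pred I) (F : I -> word d -> V) :
  hsum k (fun w => \sum_(i <- s | P i) F i w) = \sum_(i <- s | P i) hsum k (F i).
Proof. by rewrite /hsum exchange_big. Qed.

Lemma hsum_mull (V : pzSemiRingType) k (c : V) (F : word d -> V) :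
  hsum k (fun w => c * F w) = c * hsum k F.
Proof. by rewrite /hsum mulr_sumr. Qed.

Lemma hsum_mulr (V : pzSemiRingType) k (c : V) (F : word d -> V) :
  hsum k (fun w => F w * c) = hsum k F * c.
Proof. by rewrite /hsum mulr_suml. Qed.

Lemma psumS (V : nmodType) N (F : word d -> V) :
  psum N.+1 F = psum N F + hsum N F.
Proof. by rewrite /psum big_ord_recr. Qed.

Lemma psumSl (V : nmodType) N (F : word d -> V) :
  psum N.+1 F = F [::] + \sum_i psum N (fun w => F (i :: w)).
Proof.
rewrite /psum big_ord_recl hsum0; congr (_ + _).
by rewrite exchange_big; apply: eq_bigr => k _; rewrite /= hsumS.
Qed.

Lemma psum_rev (V : nmodType) N (F : word d -> V) :
  psum N (fun w => F (rev w)) = psum N F.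
Proof. by apply: eq_bigr => k _; rewrite hsum_rev. Qed.

Lemma psumD (V : nmodType) N (F G : word d -> V) :
  psum N (fun w => F w + G w) = psum N F + psum N G.
Proof. by rewrite /psum -big_split; apply: eq_bigr => k _; rewrite hsumD. Qed.

Lemma psum_mull (V : pzSemiRingType) N (c : V) (F : word d -> V) :
  psum N (fun w => c * F w) = c * psum N F.
Proof. by rewrite /psum mulr_sumr; apply: eq_bigr => k _; rewrite hsum_mull. Qed.

Lemma psum_mulr (V : pzSemiRingType) N (c : V) (F : word d -> V) :
  psum N (fun w => F w * c) = psum N F * c.
Proof. by rewrite /psum mulr_suml; apply: eq_bigr => k _; rewrite hsum_mulr. Qed.

Lemma psum_sum (V : nmodType) N I (s : seq I) (P : pred I) (F : I -> word d -> V) :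
  psum N (fun w => \sum_(i <- s | P i) F i w) = \sum_(i <- s | P i) psum N (F i).
Proof. by rewrite /psum exchange_big; apply: eq_bigr => k _; rewrite hsum_sum. Qed.

Lemma hsum_ge0 (R : numDomainType) k (F : word d -> R) :
  (forall w, 0 <= F w) -> 0 <= hsum k F.
Proof. by move=> h; apply: sumr_ge0. Qed.

Lemma le_hsum (R : numDomainType) k (F G : word d -> R) :
  (forall w, size w = k -> F w <= G w) -> hsum k F <= hsum k G.
Proof. by move=> h; apply: ler_sum => w _; rewrite h // size_tuple. Qed.

Lemma psum_ge0 (R : numDomainType) N (F : word d -> R) :
  (forall w, 0 <= F w) -> 0 <= psum N F.
Proof. by move=> h; apply: sumr_ge0 => k _; exact: hsum_ge0. Qed.

Lemma le_psum (R : numDomainType) N (F G : word d -> R) :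
  (forall w, (size w < N)%N -> F w <= G w) -> psum N F <= psum N G.
Proof. by move=> h; apply: ler_sum => k _; apply: le_hsum => w hw; rewrite h ?hw. Qed.

Lemma psum_homo (R : numDomainType) M N (F : word d -> R) :
  (forall w, 0 <= F w) -> (M <= N)%N -> psum M F <= psum N F.
Proof.
move=> h /subnK <-; elim: (N - M)%N => [|j IH]; first by rewrite add0n.
by rewrite addSn psumS; apply: le_trans IH _; rewrite lerDl hsum_ge0.
Qed.

Lemma psum_ge_term (R : numDomainType) N (F : word d -> R) (w : word d) :
  (forall w, 0 <= F w) -> (size w < N)%N -> F w <= psum N F.
Proof.
move=> h hw; apply: le_trans (psum_homo h hw); rewrite psumS.
apply: le_trans (_ : hsum (size w) F <= _); last by rewrite lerDr psum_ge0.
rewrite /hsum (bigD1 (in_tuple w)) //= lerDl; exact: sumr_ge0.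
Qed.

(** Partial sums over words become sums over one finite type. This supplies the finite sets that
    exhaust [esum] in [H2P] and the index set of the compressed shifts. *)
Lemma bseq_psum (V : nmodType) N (F : word d -> V) :
  \sum_(w : N.-bseq 'I_d) F w = psum N.+1 F.
Proof.
rewrite /psum /hsum sig_big_dep /=.
rewrite (reindex (@bseq_tagged_tuple N _)) /=;
  last exact: (onW_bij _ (@bseq_tagged_tuple_bij N _)).
by apply: eq_bigr.
Qed.

End WordSums.

Section WordSeries.
Variables (R : realType) (d : nat).
Local Notation C := (Cplx R).
Local Notation nc := (@Normc.normc R).
Implicit Types F G : word d -> C.

Definition wsummable F := exists c : R, forall N, psum N (fun w => nc (F w)) <= c.

Lemma wsumE F : wsum F = limn (fun N => psum N F : C).
Proof.
rewrite /wsum; congr (limn _); apply/funext => N.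
by rewrite /series /= big_mkord.
Qed.

Lemma bounded_series_cvg (u : nat -> R) (c : R) :
  (forall N, \sum_(k < N) `|u k| <= c) -> cvgn (fun N => \sum_(k < N) u k).
Proof.
move=> hc; have -> : (fun N => \sum_(k < N) u k) = series u.
  by apply/funext => N; rewrite /series /= big_mkord.
have E N : [normed series u] N = \sum_(k < N) `|u k|.
  by rewrite /= /series /= big_mkord.
apply: normed_cvg; apply: nondecreasing_is_cvgn.
  by apply/nondecreasing_seqP => N; rewrite !E big_ord_recr /= lerDl normr_ge0.
by exists c => _ [N _ <-]; rewrite E; exact: hc.
Qed.

(** Grouping by degree can only decrease absolute sums, so the real and the imaginary parts are
    absolutely convergent real series. *)
Lemma wsum_cvg F : wsummable F -> psum N F @[N --> \oo] --> wsum F.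
Proof.
move=> [c hc].
have hre : cvgn (fun N => \sum_(k < N) complex.Re (hsum k F)).
  apply: (@bounded_series_cvg (fun k => complex.Re (hsum k F)) c) => N.
  apply: le_trans (hc N).
  by apply: ler_sum => k _; apply: le_trans (Re_le_nc _) _; exact: nc_sum.
have him : cvgn (fun N => \sum_(k < N) complex.Im (hsum k F)).
  apply: (@bounded_series_cvg (fun k => complex.Im (hsum k F)) c) => N.
  apply: le_trans (hc N).
  by apply: ler_sum => k _; apply: le_trans (Im_le_nc _) _; exact: nc_sum.
have : cvgn (fun N => psum N F : C).
  apply/cvg_ex; exists (limn (fun N => \sum_(k < N) complex.Re (hsum k F)) +i*
    limn (fun N => \sum_(k < N) complex.Im (hsum k F))).
  apply: cvgC_ReIm.
    apply: cvg_trans hre; apply: near_eq_cvg; apply: nearW => N.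
    by rewrite (raddf_sum (@complex.Re R : Rcomplex R -> R)).
  apply: cvg_trans him; apply: near_eq_cvg; apply: nearW => N.
  by rewrite (raddf_sum (@complex.Im R : Rcomplex R -> R)).
by rewrite wsumE.
Qed.

Lemma wsum_unique F (l : C) : psum N F @[N --> \oo] --> l -> wsum F = l.
Proof. by move=> h; rewrite wsumE; apply: cvg_lim => //; exact: norm_hausdorff. Qed.

End WordSeries.

(** * The free Hardy space *)

Section Hardy.
Variables (R : realType) (d : nat).
Local Notation C := (Cplx R).
Local Notation nc := (@Normc.normc R).
Implicit Types f g h : fps R d.

(** A finite set of words lies among the words of length at most its maximal length [M], so a bound
    on the partial sums by degree bounds all finite subsums. *)
Lemma H2P h : H2 h <-> exists c : R, forall N, psum N (fun w => nc (h w) ^+ 2) <= c.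
Proof.
pose F w : \bar R := (nc (h w) ^+ 2)%:E.
have F0 w : (0 <= F w)%E by rewrite lee_fin sqr_ge0.
pose ws M : seq (word d) := [seq val w | w <- enum {: M.-bseq 'I_d}].
have wsu M : uniq (ws M) by rewrite map_inj_uniq ?enum_uniq //; exact: val_inj.
have wsE M : (\sum_(w \in [set` ws M]) F w)%R = (psum M.+1 (fun w => nc (h w) ^+ 2))%:E.
  rewrite -fsbig_seq // /ws big_map big_enum /= -bseq_psum sumEFin.
  by congr (_%:E); apply: eq_bigl => w; rewrite inE.
split=> [hfin|[c hc]].
- have e0 : (0 <= \esum_(w in [set: word d]) F w)%E by apply: esum_ge0.
  have efin : \esum_(w in [set: word d]) F w \is a fin_num by rewrite ge0_fin_numE.
  exists (fine (\esum_(w in [set: word d]) F w)); case=> [|M].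
    by rewrite /psum big_ord0 fine_ge0.
  rewrite -lee_fin fineK // -wsE; apply: esum_ge.
  by exists [set` ws M] => //; split => //; exact: finite_seq.
- apply: (@le_lt_trans _ _ c%:E); last exact: ltry.
  apply: ge_ereal_sup => _ [X [Xfin _] <-].
  have /finite_seqP [s sX] := Xfin.
  pose M := \max_(w <- s) size w.
  apply: (@le_trans _ _ (\sum_(w \in [set` ws M]) F w)); last by rewrite wsE lee_fin.
  apply: lee_fsum_nneg_subset => //; [exact: finite_seq | | by move=> w _; exact: F0].
  move=> w; rewrite !inE sX /= => ws_.
  have hw : (size w <= M)%N by apply: (@leq_bigmax_seq _ s xpredT (fun w : word d => size w)).
  by apply/mapP; exists (Bseq hw); rewrite ?mem_enum.
Qed.

Lemma ncsqD (x y : R[i]) : nc (x + y) ^+ 2 <= 2 * nc x ^+ 2 + 2 * nc y ^+ 2.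
Proof.
have h : nc (x + y) ^+ 2 <= (nc x + nc y) ^+ 2.
  by rewrite ler_sqr ?nnegrE ?addr_ge0 ?nc_ge0 // le_normcD.
apply: le_trans h _; rewrite -subr_ge0.
have -> : 2 * nc x ^+ 2 + 2 * nc y ^+ 2 - (nc x + nc y) ^+ 2 = (nc x - nc y) ^+ 2 by ring.
exact: sqr_ge0.
Qed.

Lemma H2_lin (c : C) g h : H2 g -> H2 h -> H2 (c *: g + h).
Proof.
move=> /H2P [a ha] /H2P [e he]; apply/H2P.
exists (2 * (nc c ^+ 2 * a) + 2 * e) => N.
apply: le_trans (_ : psum N (fun w => (2 * nc c ^+ 2) * nc (g w) ^+ 2 + 2 * nc (h w) ^+ 2) <= _).
  apply: le_psum => w _; apply: le_trans (ncsqD _ _) _.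
  by rewrite Normc.normcM exprMn mulrA.
rewrite psumD !psum_mull mulrA lerD // ler_wpM2l //.
by rewrite mulr_ge0 // sqr_ge0.
Qed.

Lemma H20 : H2 (0 : fps R d).
Proof.
apply/H2P; exists 0 => N; rewrite /psum big1 // => k _; rewrite /hsum big1 // => w _.
by rewrite Normc.normc0 expr0n.
Qed.

Lemma dot_summable g h : H2 g -> H2 h -> wsummable (fun w => (g w)^* * h w).
Proof.
move=> /H2P [a ha] /H2P [e he]; exists (a + e) => N.
apply: le_trans (lerD (ha N) (he N)); rewrite -psumD; apply: le_psum => w _.
rewrite Normc.normcM nc_conj.
have := nc_ge0 (g w); have := nc_ge0 (h w).
move: (nc (g w)) (nc (h w)) => x y; nra.
Qed.

Lemma dot_cvg g h : H2 g -> H2 h ->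
  psum N (fun w => (g w)^* * h w) @[N --> \oo] --> dot g h.
Proof. by move=> hg hh; apply: wsum_cvg; exact: dot_summable. Qed.

Lemma dot_lin (c : C) f g h : H2 f -> H2 g -> H2 h ->
  dot f (c *: g + h) = c * dot f g + dot f h.
Proof.
move=> hf hg hh; apply: wsum_unique.
apply: eq_cvgr (cvgD (cvgM (cvg_cst c) (dot_cvg hf hg)) (dot_cvg hf hh)) => N.
rewrite /= /cst -psum_mull -psumD; apply: eq_psum => w _.
by rewrite mulrDr mulrCA.
Qed.

Lemma dot_conj g h : H2 g -> H2 h -> dot h g = (dot g h)^*.
Proof.
move=> hg hh; apply: wsum_unique.
apply: (eq_cvgr (U := C) _ (cvg_conj (dot_cvg hg hh))) => N.
rewrite /psum /hsum rmorph_sum; apply: eq_bigr => k _.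
rewrite rmorph_sum; apply: eq_bigr => w _.
by rewrite rmorphM mulrC; congr (_ * _); exact: conjCK.
Qed.

Lemma psum_dot N h : psum N (fun w => (h w)^* * h w) = (psum N (fun w => nc (h w) ^+ 2))%:C.
Proof.
rewrite /psum /hsum rmorph_sum; apply: eq_bigr => k _.
by rewrite rmorph_sum; apply: eq_bigr => w _; rewrite -nc_sqr.
Qed.

Lemma dot_sq_cvg h : H2 h -> psum N (fun w => nc (h w) ^+ 2) @[N --> \oo] --> complex.Re (dot h h).
Proof.
by move=> hh; apply: eq_cvgr (cvgC_Re (dot_cvg hh hh)) => N; rewrite /= psum_dot.
Qed.

Lemma dot_real h : H2 h -> dot h h = (complex.Re (dot h h))%:C.
Proof.
move=> hh; apply: wsum_unique.
by apply: eq_cvgr (cvg_realC (dot_sq_cvg hh)) => N; rewrite /= psum_dot.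
Qed.

Lemma psum_le_dot_sq N h : H2 h -> psum N (fun w => nc (h w) ^+ 2) <= complex.Re (dot h h).
Proof.
move=> hh; apply: (cvgr_to_ge (dot_sq_cvg hh)).
by exists N => // M /= NM; apply: psum_homo => // w; exact: sqr_ge0.
Qed.

Lemma dot_sq_le h (c : R) : H2 h -> (forall N, psum N (fun w => nc (h w) ^+ 2) <= c) ->
  complex.Re (dot h h) <= c.
Proof. by move=> hh hc; apply: (cvgr_to_le (dot_sq_cvg hh)); exact: nearW. Qed.

Lemma dot_sq_ge0 h : H2 h -> 0 <= complex.Re (dot h h).
Proof. by move=> hh; apply: le_trans (psum_le_dot_sq 0 hh); rewrite /psum big_ord0. Qed.

Lemma dot_sq_coef h w : H2 h -> nc (h w) ^+ 2 <= complex.Re (dot h h).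
Proof.
move=> hh; apply: le_trans (psum_le_dot_sq (size w).+1 hh).
by apply: (psum_ge_term (F := fun w => nc (h w) ^+ 2)) => // v; exact: sqr_ge0.
Qed.

Lemma dot_sq_eq0 h : H2 h -> complex.Re (dot h h) = 0 -> h = 0.
Proof.
move=> hh h0; apply/funext => w; apply: Normc.eq0_normc.
apply/eqP; rewrite -sqrf_eq0; apply/eqP/le_anti.
by rewrite sqr_ge0 -h0 dot_sq_coef.
Qed.

Lemma H2_Ut h : H2 h -> H2 (Ut h).
Proof.
move=> /H2P [c hc]; apply/H2P; exists c => N; apply: le_trans (hc N).
by rewrite -(psum_rev N (fun w => nc (h w) ^+ 2)).
Qed.

End Hardy.

(** * The Hilbert space of square-summable families *)

Section Ell2.
Variables (R : realType) (d : nat).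
Local Notation C := (Cplx R).
Local Notation nc := (@Normc.normc R).

Definition H2_pred : {pred fps R d} := fun h => `[< H2 h >].

Lemma H2_submod_closed : submod_closed H2_pred.
Proof.
split; first by apply/asboolP; exact: H20.
by move=> c g h /asboolP hg /asboolP hh; apply/asboolP; exact: H2_lin.
Qed.

HB.instance Definition _ := GRing.isSubmodClosed.Build C (fps R d) H2_pred H2_submod_closed.

(** With square-summability bundled into the type, operators are plain maps on a module and
    identities between them carry no [H2] side conditions. *)
Record ell2 := Ell2 {ell2val :> fps R d; _ : ell2val \in H2_pred}.

HB.instance Definition _ := [isSub for ell2val].
HB.instance Definition _ := [Choice of ell2 by <:].
HB.instance Definition _ := [SubChoice_isSubLmodule of ell2 by <:].

End Ell2.

Lemma cauchy_seqC (R : realType) (u : nat -> Cplx R) :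
  (forall e : R, 0 < e -> exists N, forall m n, (N <= m)%N -> (N <= n)%N ->
     Normc.normc (u m - u n) <= e) ->
  exists l : Cplx R, u n @[n --> \oo] --> l.
Proof.
move=> hu.
have key (f : Cplx R -> R) : (forall x y, `|f x - f y| <= Normc.normc (x - y)) ->
    cvgn (fun n => f (u n)).
  move=> hf; apply/cauchy_cvgP/cauchy_exP => e e0.
  have [N hN] := hu _ (divr_gt0 e0 (ltr0n R 2)).
  exists (f (u N)); exists N => // n /= Nn; apply: le_lt_trans (hf _ _) _.
  by apply: le_lt_trans (hN _ _ _ _) _ => //; rewrite ltr_pdivrMr // ltr_pMr // ltr1n.
have hre := key (@complex.Re R : Cplx R -> R) _;
  have him := key (@complex.Im R : Cplx R -> R) _.
exists (limn (fun n => complex.Re (u n)) +i* limn (fun n => complex.Im (u n))).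
apply: cvgC_ReIm.
  by apply: hre => x y; apply: le_trans (Re_le_nc _); case: x y => [? ?] [? ?].
by apply: him => x y; apply: le_trans (Im_le_nc _); case: x y => [? ?] [? ?].
Qed.

Section Hilbert.
Variables (R : realType) (d : nat).
Local Notation C := (Cplx R).
Local Notation nc := (@Normc.normc R).
Local Notation E := (ell2 R d).
Implicit Types x y z : E.

Lemma ell2P x : H2 (ell2val x).
Proof. by case: x => f hf /=; move: (hf); rewrite unfold_in => /asboolP. Qed.

Definition mk2 (f : fps R d) (hf : H2 f) : E := Ell2 (introT (asboolP _) hf : f \in @H2_pred R d).

Definition ip x y : C := dot (ell2val x) (ell2val y).
Definition nsq x : R := complex.Re (ip x x).
Definition nrm x : R := Num.sqrt (nsq x).

Lemma val_lin (c : C) x y : ell2val (c *: x + y) = c *: ell2val x + ell2val y.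
Proof. by []. Qed.

Lemma val_scale (c : C) x : ell2val (c *: x) = c *: ell2val x.
Proof. by []. Qed.

Lemma ip_lin (c : C) z x y : ip z (c *: x + y) = c * ip z x + ip z y.
Proof. by rewrite /ip val_lin (dot_lin c (ell2P z) (ell2P x) (ell2P y)). Qed.

Lemma ipC x y : ip y x = (ip x y)^*.
Proof. by rewrite /ip (dot_conj (ell2P x) (ell2P y)). Qed.

Lemma ipDr z x y : ip z (x + y) = ip z x + ip z y.
Proof. by rewrite -{1}[x]scale1r ip_lin mul1r. Qed.

Lemma ip0r z : ip z 0 = 0.
Proof. by apply: (@addrI _ (ip z 0)); rewrite -ipDr !addr0. Qed.

Lemma ipZr (c : C) z x : ip z (c *: x) = c * ip z x.
Proof. by rewrite -{1}[c *: x]addr0 ip_lin ip0r addr0. Qed.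

Lemma ipNr z x : ip z (- x) = - ip z x.
Proof. by rewrite -scaleN1r ipZr mulN1r. Qed.

Lemma ipBr z x y : ip z (x - y) = ip z x - ip z y.
Proof. by rewrite ipDr ipNr. Qed.

Lemma ipDl z x y : ip (x + y) z = ip x z + ip y z.
Proof. by rewrite ipC ipDr conjCD -!ipC. Qed.

Lemma ip0l z : ip 0 z = 0.
Proof. by rewrite ipC ip0r conjC0. Qed.

Lemma ipZl (c : C) z x : ip (c *: x) z = c^* * ip x z.
Proof. by rewrite ipC ipZr conjCM -ipC. Qed.

Lemma ipNl z x : ip (- x) z = - ip x z.
Proof. by rewrite ipC ipNr conjCN -ipC. Qed.

Lemma ipBl z x y : ip (x - y) z = ip x z - ip y z.
Proof. by rewrite ipDl ipNl. Qed.

Lemma ipxx x : ip x x = (nsq x)%:C.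
Proof. by rewrite /ip (dot_real (ell2P x)). Qed.

Lemma nsq_ge0 x : 0 <= nsq x.
Proof. exact: (dot_sq_ge0 (ell2P x)). Qed.

Lemma nsq_eq0 x : nsq x = 0 -> x = 0.
Proof. by move=> h; apply: val_inj; exact: (dot_sq_eq0 (ell2P x) h). Qed.

Lemma nrm_ge0 x : 0 <= nrm x.
Proof. exact: sqrtr_ge0. Qed.

Lemma nrm_sqr x : nrm x ^+ 2 = nsq x.
Proof. by rewrite sqr_sqrtr // nsq_ge0. Qed.

Lemma nrm0 : nrm 0 = 0.
Proof. by rewrite /nrm /nsq ip0r /= sqrtr0. Qed.

Lemma nrm0_eq x : nrm x = 0 -> x = 0.
Proof. by move=> h; apply: nsq_eq0; rewrite -nrm_sqr h expr0n. Qed.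

Lemma nrmZ (c : C) x : nrm (c *: x) = nc c * nrm x.
Proof.
apply/eqP; rewrite -(@eqrXn2 _ 2) ?mulr_ge0 ?nrm_ge0 ?nc_ge0 //.
rewrite exprMn !nrm_sqr; apply/eqP/complexI.
by rewrite realCM -!ipxx ipZl ipZr mulrA -nc_sqr.
Qed.

Lemma nrmN x : nrm (- x) = nrm x.
Proof. by rewrite /nrm /nsq ipNr ipNl opprK. Qed.

Lemma nrmB x y : nrm (x - y) = nrm (y - x).
Proof. by rewrite -nrmN opprB. Qed.

Lemma nsqD x y : nsq (x + y) = nsq x + nsq y + 2 * complex.Re (ip x y).
Proof.
rewrite /nsq ipDr !ipDl (ipC x y).
move: (ip x x) (ip y y) (ip x y) => [? ?] [? ?] [? ?] /=; ring.
Qed.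

Lemma nsqB x y : nsq (x - y) = nsq x + nsq y - 2 * complex.Re (ip x y).
Proof.
by rewrite nsqD ipNr /nsq ipNl ipNr opprK; case: (ip x y) => ? ? /=; ring.
Qed.

(* Expand [nsq (nsq y *: x - ip y x *: y) >= 0]. *)
Lemma cauchy_schwarz x y : nc (ip x y) <= nrm x * nrm y.
Proof.
rewrite -ler_sqr ?nnegrE ?mulr_ge0 ?nrm_ge0 ?nc_ge0 // exprMn !nrm_sqr.
have [/nsq_eq0 ->|y0] := eqVneq (nsq y) 0.
  by rewrite ip0r Normc.normc0 expr0n mulr_ge0 ?nsq_ge0.
have yp : 0 < nsq y by rewrite lt0r y0 nsq_ge0.
have := nsq_ge0 ((nsq y)%:C *: x - ip y x *: y).
have -> : nsq ((nsq y)%:C *: x - ip y x *: y) = nsq y * (nsq x * nsq y - nc (ip x y) ^+ 2).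
  apply: complexI; rewrite -[(nsq (_ - _))%:C]ipxx ipBr !ipBl !ipZl !ipZr !ipxx.
  rewrite realCM realCB realCM nc_sqr.
  rewrite conjC_r -(ipC y x) (ipC x y); ring.
by rewrite pmulr_rge0 // subr_ge0.
Qed.

Lemma nrmD x y : nrm (x + y) <= nrm x + nrm y.
Proof.
have h : complex.Re (ip x y) <= nrm x * nrm y.
  apply: le_trans (cauchy_schwarz _ _); exact: (le_trans (ler_norm _) (Re_le_nc _)).
by rewrite -ler_sqr ?nnegrE ?addr_ge0 ?nrm_ge0 // nrm_sqr nsqD sqrrD !nrm_sqr -mulr_natl; lra.
Qed.

Lemma nrm_tri x y z : nrm (x - z) <= nrm (x - y) + nrm (y - z).
Proof. by apply: le_trans (nrmD _ _); rewrite addrA subrK. Qed.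

Lemma nsqW x : nsq x = nrm x ^+ 2.
Proof. by rewrite nrm_sqr. Qed.

Definition hlim (u : nat -> E) (l : E) := nrm (u n - l) @[n --> \oo] --> (0 : R).

Lemma hlim_unique u l m : hlim u l -> hlim u m -> l = m.
Proof.
move=> hl hm; apply/eqP; rewrite -subr_eq0; apply/eqP/nrm0_eq/le_anti.
rewrite nrm_ge0 andbT.
have h : (fun n => nrm (u n - l) + nrm (u n - m)) @ \oo --> (0 : R).
  by rewrite -[X in _ --> X]addr0; exact: cvgD.
apply: (cvgr_to_ge h); apply: nearW => n.
by apply: le_trans (nrm_tri l (u n) m) _; rewrite [nrm (l - _)]nrmB.
Qed.

Lemma hlim_lin (c : C) u v l m : hlim u l -> hlim v m ->
  hlim (fun n => c *: u n + v n) (c *: l + m).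
Proof.
move=> hl hm;
  apply: (squeeze_cvgr _ (cvg_cst (0 : R)) (h := fun n => nc c * nrm (u n - l) + nrm (v n - m))).
  apply: nearW => n; rewrite nrm_ge0 /= opprD addrACA -scalerBr -nrmZ; exact: nrmD.
rewrite -[X in _ --> X]addr0 -[X in _ --> X + _](mulr0 (nc c)).
by apply: cvgD => //; apply: cvgM => //; exact: cvg_cst.
Qed.

Lemma hlim_cst l : hlim (fun=> l) l.
Proof. by rewrite /hlim subrr nrm0; exact: cvg_cst. Qed.

Lemma hlim_ip u l y : hlim u l -> ip y (u n) @[n --> \oo] --> ip y l.
Proof.
move=> h; apply/cvgC.
apply: (squeeze_cvgr _ (cvg_cst (0 : R)) (h := fun n => nrm y * nrm (u n - l))).
  by apply: nearW => n; rewrite nc_ge0 /= -ipBr cauchy_schwarz.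
by rewrite -[X in _ --> X](mulr0 (nrm y)); apply: cvgM => //; exact: cvg_cst.
Qed.

Lemma hlim_nrm u l : hlim u l -> nrm (u n) @[n --> \oo] --> nrm l.
Proof.
move=> h; apply/cvgrPdist_le => e e0; move/cvgrPdist_le: h => /(_ e e0).
apply: filterS => n; rewrite sub0r normrN ger0_norm ?nrm_ge0 // => hn.
apply: le_trans hn; rewrite ler_norml lerBlDr lerBrDr addrC.
have h1 := nrm_tri l (u n) 0; have h2 := nrm_tri (u n) l 0.
by rewrite !subr0 in h1 h2; rewrite [nrm (l - _)]nrmB in h1; apply/andP; split; lra.
Qed.

(** Coefficients converge because each is bounded by the norm. The Cauchy estimate passes to the
    coefficientwise limit on every finite partial sum, and from there to the norm. *)
Lemma ell2_complete (u : nat -> E) :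
  (forall e : R, 0 < e -> exists N, forall m n, (N <= m)%N -> (N <= n)%N -> nrm (u m - u n) <= e) ->
  exists l, hlim u l.
Proof.
move=> hu.
have coef x w : nc (ell2val x w) <= nrm x.
  by rewrite -ler_sqr ?nnegrE ?nc_ge0 ?nrm_ge0 // nrm_sqr; exact: (dot_sq_coef w (ell2P x)).
have hw w : exists l : C, ell2val (u n) w @[n --> \oo] --> l.
  apply: cauchy_seqC => e e0; have [N hN] := hu e e0; exists N => m n Nm Nn.
  exact: (le_trans (coef (u m - u n) w) (hN _ _ Nm Nn)).
have [l hl] := choice hw.
have bound (e : R) n : 0 <= e -> (exists M, forall m, (M <= m)%N -> nrm (u n - u m) <= e) ->
    forall N, psum N (fun w => nc (ell2val (u n) w - l w) ^+ 2) <= e ^+ 2.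
  move=> e0 [M hM] N.
  have : psum N (fun w => nc (ell2val (u n) w - ell2val (u m) w) ^+ 2) @[m --> \oo] -->
      psum N (fun w => nc (ell2val (u n) w - l w) ^+ 2).
    apply: cvg_sum => k _; apply: cvg_sum => w _; rewrite expr2.
    have hc := cvg_nc (cvgB (cvg_cst (ell2val (u n) w : C)) (hl w)).
    by apply: cvgM; [exact: hc|exact: hc].
  move=> h; apply: (cvgr_to_le h); exists M => // m /= Mm.
  apply: le_trans (psum_le_dot_sq N (ell2P (u n - u m))) _.
  by rewrite -/(ip _ _) -/(nsq _) nsqW ler_sqr ?nnegrE ?nrm_ge0 // hM.
have hsub n : H2 (ell2val (u n) - l).
  have [N hN] := hu 1 ltr01; apply/H2P; exists ((nrm (u n - u N) + 1) ^+ 2) => M.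
  apply: bound; first by rewrite addr_ge0 ?nrm_ge0.
  by exists N => m Nm; apply: le_trans (nrm_tri _ (u N) _) _; rewrite lerD2l hN.
have H2l : H2 l.
  have -> : l = (-1 : C) *: (ell2val (u 0) - l) + ell2val (u 0).
    by rewrite scaleN1r opprB subrK.
  exact: (H2_lin _ (hsub 0) (ell2P _)).
exists (mk2 H2l); apply/cvgrPdist_le => e e0; have [N hN] := hu e e0.
exists N => // n /= Nn; rewrite sub0r normrN ger0_norm ?nrm_ge0 //.
rewrite -ler_sqr ?nnegrE ?nrm_ge0 ?(ltW e0) // nrm_sqr.
apply: (dot_sq_le (ell2P (u n - mk2 H2l))); apply: bound; first exact: ltW.
by exists N => m Nm; exact: hN.
Qed.

End Hilbert.

(** * Square roots and kernel projections *)

Section Operators.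
Variables (R : realType) (d : nat).
Local Notation C := (Cplx R).
Local Notation nc := (@Normc.normc R).
Local Notation E := (ell2 R d).
Implicit Types (x y z : E) (T Q : E -> E).

Definition linop T := forall (c : C) x y, T (c *: x + y) = c *: T x + T y.

Lemma linopD T x y : linop T -> T (x + y) = T x + T y.
Proof. by move=> h; rewrite -{1}[x]scale1r h scale1r. Qed.

Lemma linop0 T : linop T -> T 0 = 0.
Proof. by move=> h; apply: (@addrI _ (T 0)); rewrite -linopD // !addr0. Qed.

Lemma linopZ T (c : C) x : linop T -> T (c *: x) = c *: T x.
Proof. by move=> h; rewrite -{1}[c *: x]addr0 h linop0 // addr0. Qed.

Lemma linopB T x y : linop T -> T (x - y) = T x - T y.
Proof. by move=> h; rewrite linopD // -scaleN1r linopZ // scaleN1r. Qed.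

Lemma hlim_op T (c : R) u l : linop T -> (forall x, nrm (T x) <= c * nrm x) ->
  hlim u l -> hlim (fun n => T (u n)) (T l).
Proof.
move=> hT hc hl.
apply: (squeeze_cvgr _ (cvg_cst (0 : R)) (h := fun n => c * nrm (u n - l))).
  by apply: nearW => n; rewrite nrm_ge0 /= -linopB.
by rewrite -[X in _ --> X](mulr0 c); apply: cvgM => //; exact: cvg_cst.
Qed.

Lemma hlimS (u : nat -> E) l : hlim u l -> hlim (fun n => u n.+1) l.
Proof. by move=> h; rewrite /hlim (cvg_shiftS (fun n => nrm (u n - l))). Qed.

Section Sqrt.
Variable Q : E -> E.
Hypothesis Qlin : linop Q.
Hypothesis Qsym : forall x y, ip (Q x) y = ip x (Q y).
Hypothesis Qle : forall x, nrm (Q x) <= nrm x.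

(* [sqrt_op n] increases to [Y = 1 - sqrt (1 - Q)], the fixed point of
   [Y = (Q + Y^2) / 2]; the scalar iteration [sqrt_num] (the case [Q = 1])
   dominates the increments in norm. *)
Fixpoint sqrt_op n x : E :=
  if n is m.+1 then (2^-1)%:C *: (Q x + sqrt_op m (sqrt_op m x)) else 0.

Fixpoint sqrt_num n : R := if n is m.+1 then 2^-1 * (1 + sqrt_num m ^+ 2) else 0.

Lemma sqrt_num_bd n : 0 <= sqrt_num n <= 1.
Proof. elim: n => [|n /andP[h0 h1]] /=; first by rewrite lexx ler01. by apply/andP; split;
  nra. Qed.

Lemma sqrt_num_le n : sqrt_num n <= sqrt_num n.+1.
Proof.
elim: n => [|n IH]; first by have /andP[] := sqrt_num_bd 1.
have /andP[h0 _] := sqrt_num_bd n; move: h0 IH => /=; move: (sqrt_num n) => a h0 IH; nra.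
Qed.

Lemma sqrt_op_lin n : linop (sqrt_op n).
Proof.
elim: n => [|n IH] c x y /=; first by rewrite scaler0 addr0.
rewrite Qlin !IH scalerA [c * _]mulrC -scalerA -scalerDr; congr (_ *: _).
by rewrite scalerDr addrACA.
Qed.

Lemma nc_half : nc (2^-1)%:C = 2^-1.
Proof. by rewrite nc_real ger0_norm // invr_ge0. Qed.

Lemma scale_two_half x : (2 : R)%:C *: ((2^-1)%:C *: x) = x.
Proof.
rewrite scalerA; have -> : (2 : R)%:C * (2^-1)%:C = 1 :> C.
  by rewrite -realCM mulfV ?pnatr_eq0.
exact: scale1r.
Qed.

Lemma sqrt_op_le n x : nrm (sqrt_op n x) <= sqrt_num n * nrm x.
Proof.
elim: n x => [|n IH] x /=; first by rewrite nrm0 mul0r.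
rewrite nrmZ nc_half -mulrA ler_pM2l ?invr_gt0 // mulrDl mul1r.
apply: le_trans (nrmD _ _) _; apply: lerD; first exact: Qle.
apply: le_trans (IH _) _; rewrite expr2 -mulrA ler_wpM2l //.
by have /andP[] := sqrt_num_bd n.
Qed.

(** With Y_n for [sqrt_op n], the difference Y_{n+1}^2 - Y_n^2 equals Y_{n+1} (Y_{n+1} - Y_n) +
    (Y_{n+1} - Y_n) Y_n without any commutation. The same identity for [sqrt_num] is exact, so the
    induction closes. *)
Lemma sqrt_op_step n x :
  nrm (sqrt_op n.+1 x - sqrt_op n x) <= (sqrt_num n.+1 - sqrt_num n) * nrm x.
Proof.
elim: n x => [|n IH] x.
  by rewrite subr0; have := sqrt_op_le 1 x; rewrite /= subr0.
have -> : sqrt_op n.+2 x - sqrt_op n.+1 x = (2^-1)%:C *: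
    (sqrt_op n.+1 (sqrt_op n.+1 x - sqrt_op n x) +
     (sqrt_op n.+1 (sqrt_op n x) - sqrt_op n (sqrt_op n x))).
  rewrite (linopB _ _ (sqrt_op_lin n.+1)) addrA subrK [sqrt_op n.+2 x]/= [X in _ - X = _]/=.
  rewrite -scalerBr; congr (_ *: _).
  by rewrite opprD addrACA subrr add0r.
rewrite nrmZ nc_half.
have /andP[a0 _] := sqrt_num_bd n; have /andP[b0 _] := sqrt_num_bd n.+1.
have h1 := sqrt_op_le n.+1 (sqrt_op n.+1 x - sqrt_op n x).
have h3 := IH (sqrt_op n x); have h4 := sqrt_op_le n x.
have h5 := sqrt_num_le n.
have h6 : nrm (sqrt_op n.+1 (sqrt_op n.+1 x - sqrt_op n x)) <=
   sqrt_num n.+1 * ((sqrt_num n.+1 - sqrt_num n) * nrm x).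
  by apply: le_trans h1 _; rewrite ler_wpM2l.
have h7 : nrm (sqrt_op n.+1 (sqrt_op n x) - sqrt_op n (sqrt_op n x)) <=
   (sqrt_num n.+1 - sqrt_num n) * (sqrt_num n * nrm x).
  by apply: le_trans h3 _; rewrite ler_wpM2l // subr_ge0.
have -> : sqrt_num n.+2 - sqrt_num n.+1 = 2^-1 * (sqrt_num n.+1 * (sqrt_num n.+1 - sqrt_num n)
   + (sqrt_num n.+1 - sqrt_num n) * sqrt_num n).
  have E1 : sqrt_num n.+2 = 2^-1 * (1 + sqrt_num n.+1 ^+ 2) by [].
  have E2 : sqrt_num n.+1 = 2^-1 * (1 + sqrt_num n ^+ 2) by [].
  by rewrite E1; move: E2; move: (sqrt_num n.+1) (sqrt_num n) => a c E2; lra.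
rewrite -mulrA ler_pM2l ?invr_gt0 //; apply: le_trans (nrmD _ _) _.
by apply: le_trans (lerD h6 h7) _; rewrite [X in _ <= X]mulrDl !mulrA.
Qed.

Lemma sqrt_op_cauchy m n x : (n <= m)%N ->
  nrm (sqrt_op m x - sqrt_op n x) <= (sqrt_num m - sqrt_num n) * nrm x.
Proof.
move=> /subnK <-; elim: (m - n)%N => [|j IH]; first by rewrite add0n !subrr mul0r nrm0.
rewrite addSn; apply: le_trans (nrm_tri _ (sqrt_op (j + n) x) _) _.
apply: le_trans (lerD (sqrt_op_step _ _) IH) _.
by rewrite -mulrDl addrA subrK.
Qed.

Lemma sqrt_num_cvg : cvgn sqrt_num.
Proof.
apply: nondecreasing_is_cvgn; first by apply/nondecreasing_seqP; exact: sqrt_num_le.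
by exists 1 => _ [n _ <-]; have /andP[] := sqrt_num_bd n.
Qed.

Lemma sqrt_op_hlim x : exists l, hlim (sqrt_op ^~ x) l.
Proof.
apply: ell2_complete => e e0.
have e1 : 0 < e / (1 + nrm x) by rewrite divr_gt0 // ltr_pwDl // nrm_ge0.
have /cvgrPdist_le /(_ _ (divr_gt0 e1 (ltr0n R 2))) [N _ hN] := sqrt_num_cvg.
exists N => m n Nm Nn.
wlog nm : m n Nm Nn / (n <= m)%N.
  by move=> h; have [/h|/ltnW /h] := leqP n m; [apply|rewrite nrmB; apply].
apply: le_trans (sqrt_op_cauchy x nm) _.
have h : sqrt_num m - sqrt_num n <= e / (1 + nrm x).
  have h1 := hN _ Nm; have h2 := hN _ Nn; move: h1 h2.
  by rewrite !ler_norml => /andP[? ?] /andP[? ?]; lra.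
apply: le_trans (ler_wpM2r (nrm_ge0 x) h) _.
by rewrite mulrAC ler_pdivrMr ?ltr_pwDl ?nrm_ge0 // ler_wpM2l ?(ltW e0) // lerDr.
Qed.

(** Let Y be the strong limit of [sqrt_op]. From 2Y = Q + Y^2 follows (1 - Y)^2 = 1 - Q, and as Y is
    a symmetric contraction, <x, Yx> is real and at most |x|^2, so that 1 - Y is positive. *)
Lemma psqrt_op_exists : exists S : E -> E,
  [/\ linop S, forall x, 0 <= ip x (S x) & forall x, S (S x) = x - Q x].
Proof.
have [Y hY] := choice sqrt_op_hlim.
have Ylin : linop Y.
  move=> c x y; apply: hlim_unique (hY _) _.
  have := hlim_lin c (hY x) (hY y); rewrite /hlim; apply: eq_cvgr => n.
  by rewrite sqrt_op_lin.
have Yle x : nrm (Y x) <= nrm x.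
  apply: (cvgr_to_le (hlim_nrm (hY x))); apply: nearW => n.
  apply: le_trans (sqrt_op_le _ _) _; rewrite ler_piMl ?nrm_ge0 //.
  by have /andP[] := sqrt_num_bd n.
have Yfix x : (2 : R)%:C *: Y x = Q x + Y (Y x).
  (* Passing to the limit in a product of operators needs a uniform bound: every [sqrt_op n] is a
     contraction because [sqrt_num n] is at most 1. *)
  have h1 : hlim (fun n => sqrt_op n (sqrt_op n x)) (Y (Y x)).
    apply: (squeeze_cvgr _ (cvg_cst (0 : R))
      (h := fun n => nrm (sqrt_op n x - Y x) + nrm (sqrt_op n (Y x) - Y (Y x)))).
      apply: nearW => n; rewrite nrm_ge0 /=.
      apply: le_trans (nrm_tri _ (sqrt_op n (Y x)) _) _; rewrite lerD2r.
      rewrite -(linopB _ _ (sqrt_op_lin n)).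
      apply: le_trans (sqrt_op_le _ _) _; rewrite ler_piMl ?nrm_ge0 //.
      by have /andP[] := sqrt_num_bd n.
    by rewrite -[X in _ --> X]addr0; apply: cvgD; exact: hY.
  have h2 : hlim (fun n => sqrt_op n.+1 x) (Y x).
    exact: hlimS (hY x).
  have h3 := hlim_lin (2 : R)%:C h2 (hlim_cst 0).
  have h4 := hlim_lin 1 (hlim_cst (Q x)) h1.
  have hf : (fun n => (2 : R)%:C *: sqrt_op n.+1 x + 0) =
      (fun n => 1 *: Q x + sqrt_op n (sqrt_op n x)).
    apply/funext => n; rewrite addr0 scale1r; exact: scale_two_half.
  by rewrite hf in h3; have := hlim_unique h3 h4; rewrite addr0 scale1r.
have Ysym x y : ip (Y x) y = ip x (Y y).
  have h n : forall x y, ip (sqrt_op n x) y = ip x (sqrt_op n y).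
    elim: n => [|n IH] u v /=; first by rewrite ip0l ip0r.
    by rewrite ipZl ipZr conjC_r ipDl ipDr Qsym !IH.
  rewrite ipC -(cvg_lim (@norm_hausdorff _ C) (cvg_conj (hlim_ip (y := y) (hY x)))).
  rewrite -(cvg_lim (@norm_hausdorff _ C) (hlim_ip (y := x) (hY y))).
  by congr (limn _); apply/funext => n; rewrite -ipC h.
exists (fun x => x - Y x); split.
- by move=> c x y; rewrite Ylin opprD addrACA scalerBr.
- move=> x; rewrite ipBr ipxx subr_ge0.
  have hr : (ip x (Y x))^* = ip x (Y x) by rewrite -ipC Ysym.
  have -> : ip x (Y x) = (complex.Re (ip x (Y x)))%:C.
    by rewrite RRe_real //; apply/CrealP.
  rewrite lecR; apply: le_trans (ler_norm _) _; apply: le_trans (Re_le_nc _) _.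
  apply: le_trans (cauchy_schwarz _ _) _; rewrite -nrm_sqr expr2.
  by rewrite ler_wpM2l ?nrm_ge0.
- move=> x; have -> : Q x = Y x + Y x - Y (Y x).
    have <- : (2 : R)%:C *: Y x = Y x + Y x.
      by rewrite (_ : (2 : R)%:C = 1 + 1) ?scalerDl ?scale1r // -realCD.
    by rewrite Yfix addrK.
  by rewrite (linopB _ _ Ylin) !opprB addrACA [RHS]addrA opprD.
Qed.

End Sqrt.

Section KernelProjection.
Variables B B' : E -> E.
Hypothesis Blin : linop B.
Hypothesis adjB : forall x y, ip (B' x) y = ip x (B y).
Hypothesis Ble : forall x, nrm (B x) <= nrm x.

Lemma adjB_sym x y : ip x (B' y) = ip (B x) y.
Proof. by rewrite ipC adjB -ipC. Qed.

(** |B'x|^2 = <x, B B'x> is at most |x| |B'x|, and |B'x| can be cancelled. *)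
Lemma adj_le x : nrm (B' x) <= nrm x.
Proof.
have [->|h] := eqVneq (nrm (B' x)) 0; first exact: nrm_ge0.
have hp : 0 < nrm (B' x) by rewrite lt0r h nrm_ge0.
rewrite -(ler_pM2r hp) -expr2 nrm_sqr /nsq adjB.
apply: le_trans (ler_norm _) _; apply: le_trans (Re_le_nc _) _.
by apply: le_trans (cauchy_schwarz _ _) _; rewrite ler_wpM2l ?nrm_ge0.
Qed.

Lemma nondeg x y : (forall z, ip z x = ip z y) -> x = y.
Proof.
move=> h; apply/eqP; rewrite -subr_eq0; apply/eqP/nsq_eq0.
by rewrite /nsq ipBr h subrr.
Qed.

Lemma adj_lin : linop B'.
Proof.
move=> c x y; apply: nondeg => z.
by rewrite adjB_sym !ipDr !ipZr !adjB_sym.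
Qed.

Let Q x := B (B' x).

Lemma Q_lin : linop Q.
Proof. by move=> c x y; rewrite /Q adj_lin Blin. Qed.

Lemma Q_sym x y : ip (Q x) y = ip x (Q y).
Proof. by rewrite /Q -adjB_sym adjB. Qed.

Lemma Q_le x : nrm (Q x) <= nrm x.
Proof. exact: le_trans (Ble _) (adj_le _). Qed.

(* [<x, Q^k x>] is nonincreasing, so [Q^n x] is a Cauchy sequence. *)
Lemma kernel_projection x :
  exists2 p, Q p = p & forall u, Q u = u -> ip u (x - p) = 0.
Proof.
pose q n := iter n Q x.
pose a n := complex.Re (ip x (q n)).
have qS n : q n.+1 = Q (q n) by [].
have ipq m n : ip (q m) (q n) = ip x (q (m + n)%N).
  by elim: m n => [|m IH] n //; rewrite qS Q_sym -qS IH addSnnS.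
(* At even indices [a] is |q j|^2, at odd ones |B' (q j)|^2; each step from one to the next applies
   one of the contractions B' and B, which gives the monotonicity. *)
have ae j : a (j + j)%N = nsq (q j) by rewrite /a -ipq.
have ao j : a (j + j).+1 = nsq (B' (q j)).
  by rewrite /a -addnS -ipq qS /nsq adjB.
have parity k : exists j, k = (j + j)%N \/ k = (j + j).+1.
  exists k./2; rewrite addnn; have := odd_double_half k.
  by case: (odd k) => /= h; [right|left].
have a_dec k : a k.+1 <= a k.
  have [j [->|->]] := parity k.
  - rewrite ae ao -!nrm_sqr ler_sqr ?nnegrE ?nrm_ge0 //; exact: adj_le.
  - have -> : (j + j).+2 = (j.+1 + j.+1)%N by rewrite addnS addSn.
    rewrite ae ao -!nrm_sqr ler_sqr ?nnegrE ?nrm_ge0 //; exact: Ble.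
have a_ge0 k : 0 <= a k.
  have [j [->|->]] := parity k.
  - by rewrite ae nsq_ge0.
  - by rewrite ao nsq_ge0.
have [l hl] : exists l, hlim q l.
  apply: ell2_complete => e e0.
  have : cvgn a.
    by apply: nonincreasing_is_cvgn; [apply/nonincreasing_seqP | exists 0 => _ [n _ <-]].
  (* |q m - q n|^2 = a(2m) + a(2n) - 2 a(m+n), and each of the four terms is within e^2/4 of the
     limit of [a]. *)
  move=> /cvgrPdist_le /(_ _ (divr_gt0 (exprn_gt0 2 e0) (ltr0n R 4))) [N _ hN].
  exists N => m n Nm Nn.
  rewrite -ler_sqr ?nnegrE ?nrm_ge0 ?(ltW e0) // nrm_sqr nsqB -!ae ipq.
  have h1 := hN (m + m)%N (leq_trans Nm (leq_addr _ _)).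
  have h2 := hN (n + n)%N (leq_trans Nn (leq_addr _ _)).
  have h3 := hN (m + n)%N (leq_trans Nm (leq_addr _ _)).
  move: h1 h2 h3; rewrite /= !ler_norml -/(a (m + n)%N) => /andP[? ?] /andP[? ?] /andP[? ?];
    lra.
exists l => [|u hu].
  apply: hlim_unique (hlim_op (c := 1) Q_lin _ hl) _ => [y|]; first by rewrite mul1r Q_le.
  exact: hlimS hl.
(* By symmetry of Q, the pairing of a fixed vector u with [q n] does not depend on n, so it survives
   in the limit. *)
rewrite ipBr; apply/eqP; rewrite subr_eq0; apply/eqP.
have h := hlim_ip (y := u) hl; rewrite -(cvg_lim (@norm_hausdorff _ C) h).
apply/esym/cvg_lim; first exact: norm_hausdorff.
apply: eq_cvgr (cvg_cst (ip u x : C)) => n.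
by elim: n => [|n IH] //; rewrite qS -Q_sym hu.
Qed.

End KernelProjection.

End Operators.

(** * Coordinate vectors and adjoints of bounded operators *)

Section DeltaSums.
Variable d : nat.

Lemma hsum_if (V : nmodType) k (a : word d -> V) v :
  hsum k (fun w => if w == v then a w else 0) = if size v == k then a v else 0.
Proof.
case: eqP => [<-|h].
  rewrite /hsum (bigD1 (in_tuple v)) //= eqxx big1 ?addr0 // => w /negPf.
  by rewrite -val_eqE /= => ->.
rewrite /hsum big1 // => w _; case: eqP => // e.
by case: h; rewrite -e size_tuple.
Qed.

Lemma psum_if (V : nmodType) N (a : word d -> V) v :
  psum N (fun w => if w == v then a w else 0) = if (size v < N)%N then a v else 0.
Proof.
rewrite /psum; under eq_bigr do rewrite hsum_if.
case: ltnP => [h|h].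
  rewrite (bigD1 (Ordinal h)) //= eqxx big1 ?addr0 // => k.
  by rewrite -val_eqE /= eq_sym => /negPf ->.
by rewrite big1 // => k _; case: eqP => // e; have := ltn_ord k; rewrite -e ltnNge h.
Qed.

(** At most one cut point of u gives back the pair (w, v), so a condition on a concatenation becomes
    the sum over cut points that occurs in [fps_mul]. *)
Lemma cat_splits (V : pzSemiRingType) (u w v : word d) :
  (u == w ++ v)%:R =
  \sum_(k < (size u).+1) (w == take k u)%:R * (v == drop k u)%:R :> V.
Proof.
case: eqP => [->|h].
  have hk : (size w < (size (w ++ v)).+1)%N by rewrite ltnS size_cat leq_addr.
  rewrite (bigD1 (Ordinal hk)) //= take_size_cat // drop_size_cat // !eqxx mulr1.
  rewrite big1 ?addr0 // => k; rewrite -val_eqE /= => hkw.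
  case: eqP => [e|]; last by rewrite mul0r.
  by move: hkw; rewrite [in X in _ != X]e size_takel ?eqxx // -ltnS.
rewrite big1 // => k _; case: eqP => [ew|]; last by rewrite mul0r.
case: eqP => [ev|]; last by rewrite mulr0.
by case: h; rewrite ew ev cat_take_drop.
Qed.

End DeltaSums.

Section Basis.
Variables (R : realType) (d : nat).
Local Notation C := (Cplx R).
Local Notation nc := (@Normc.normc R).
Local Notation E := (ell2 R d).
Implicit Types (x y z : E) (T Q : E -> E).

Lemma fpsZ (c : C) (f : fps R d) v : (c *: f) v = c * f v.
Proof. by []. Qed.

Definition delta (w : word d) : fps R d := fun v => (v == w)%:R.

Lemma H2_delta w : H2 (delta w).
Proof.
apply/H2P; exists 1 => N.
rewrite (eq_psum (G := fun v => if v == w then 1 else 0)).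
  by rewrite psum_if; case: ifP.
by move=> v _; rewrite /delta; case: eqP; rewrite ?Normc.normc1 ?Normc.normc0 ?expr1n ?expr0n.
Qed.

Definition dl w : E := mk2 (H2_delta w).

Lemma ip_sum z I (s : seq I) (P : pred I) (F : I -> E) :
  ip z (\sum_(i <- s | P i) F i) = \sum_(i <- s | P i) ip z (F i).
Proof. by apply: (big_morph (ip z)) => [x y|]; rewrite ?ipDr ?ip0r. Qed.

Lemma linop_sum T I (s : seq I) (P : pred I) (F : I -> E) : linop T ->
  T (\sum_(i <- s | P i) F i) = \sum_(i <- s | P i) T (F i).
Proof. by move=> hT; apply: (big_morph T) => [x y|]; rewrite ?linopD ?linop0. Qed.

Lemma val_sum I (s : seq I) (P : pred I) (F : I -> E) v :
  ell2val (\sum_(i <- s | P i) F i) v = \sum_(i <- s | P i) ell2val (F i) v.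
Proof. by apply: (big_morph (fun x => ell2val x v)). Qed.

Lemma ip_psum z N (F : word d -> E) : ip z (psum N F) = psum N (fun w => ip z (F w)).
Proof. by rewrite ip_sum; apply: eq_bigr => k _; rewrite ip_sum. Qed.

Lemma linop_psum T N (F : word d -> E) : linop T ->
  T (psum N F) = psum N (fun w => T (F w)).
Proof. by move=> hT; rewrite linop_sum //; apply: eq_bigr => k _; rewrite linop_sum. Qed.

Lemma val_psum N (F : word d -> E) v :
  ell2val (psum N F) v = psum N (fun w => ell2val (F w) v).
Proof. by rewrite val_sum; apply: eq_bigr => k _; rewrite val_sum. Qed.

Definition trunc N y : E := psum N (fun w => ell2val y w *: dl w).

Lemma trunc_val N y v : ell2val (trunc N y) v = if (size v < N)%N then ell2val y v else 0.
Proof.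
rewrite val_psum (eq_psum (G := fun w => if w == v then ell2val y w else 0)).
  by rewrite psum_if.
move=> w _; rewrite val_scale fpsZ /= /delta eq_sym; case: eqP => _.
  by rewrite mulr1.
by rewrite mulr0.
Qed.

(** The truncation agrees with y on short words and vanishes on the others, so the squared error is
    at most the tail of |y|^2. *)
Lemma trunc_lim y : hlim (trunc^~ y) y.
Proof.
have h N : nsq (trunc N y - y) <= nsq y - psum N (fun w => nc (ell2val y w) ^+ 2).
  apply: (dot_sq_le (ell2P (trunc N y - y))) => M.
  rewrite lerBrDr.
  pose K := maxn M N.
  apply: le_trans (psum_le_dot_sq K (ell2P y)).
  apply: le_trans (_ : psum K (fun w => nc (ell2val (trunc N y - y) w) ^+ 2)
     + psum K (fun w => if (size w < N)%N then nc (ell2val y w) ^+ 2 else 0) <= _).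
    apply: lerD; first by apply: psum_homo; [move=> w; exact: sqr_ge0|exact: leq_maxl].
    apply: le_trans (psum_homo (M := N) (N := K) _ (leq_maxr _ _)).
      by apply: le_psum => w ->.
    by move=> w; case: ifP => // _; exact: sqr_ge0.
  rewrite -psumD; apply: le_psum => w _.
  have -> : ell2val (trunc N y - y) w = ell2val (trunc N y) w - ell2val y w by [].
  rewrite trunc_val; case: ifP => _.
    by rewrite subrr Normc.normc0 expr0n add0r.
  by rewrite sub0r normcN addr0.
apply/cvgrPdist_le => e e0.
have /cvgrPdist_le /(_ _ (exprn_gt0 2 e0)) [N _ hN] := dot_sq_cvg (ell2P y).
exists N => // n /hN /=; rewrite sub0r normrN (ger0_norm (nrm_ge0 _)) => hn.
rewrite -ler_sqr ?nnegrE ?nrm_ge0 ?(ltW e0) // nrm_sqr.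
apply: le_trans (h n) _; apply: le_trans hn; exact: ler_norm.
Qed.

Lemma ip_dl w y : ip (dl w) y = ell2val y w.
Proof.
apply: wsum_unique.
apply: (cvg_near_cst _); exists (size w).+1 => // N /= hN.
rewrite (eq_psum (G := fun v => if v == w then ell2val y v else 0)).
  by rewrite psum_if hN.
by move=> v _; rewrite /= /delta; case: eqP => _; rewrite ?conjC1 ?conjC0 ?mul1r ?mul0r.
Qed.

(** The coefficients of T'x are forced: at w it must be <T delta_w, x>. If g is a truncation of this
    family, then |g|^2 = <x, Tg> is at most c |x| |g|, which makes the family square-summable; the
    adjoint identity extends from finite sums to all y by [trunc_lim]. *)
Lemma adj_exists T (c : R) : linop T -> 0 <= c -> (forall x, nrm (T x) <= c * nrm x) ->
  exists T', forall x y, ip (T' x) y = ip x (T y).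
Proof.
move=> hT c0 hc.
pose f x : fps R d := fun w => ip (T (dl w)) x.
have f2 x : H2 (f x).
  apply/H2P; exists ((c * nrm x) ^+ 2) => N.
  set s := psum N _.
  pose g : E := psum N (fun w => f x w *: dl w).
  have s0 : 0 <= s by apply: psum_ge0 => w; exact: sqr_ge0.
  have gv v : ell2val g v = if (size v < N)%N then f x v else 0.
    rewrite val_psum (eq_psum (G := fun w => if w == v then f x w else 0)).
      by rewrite psum_if.
    move=> w _; rewrite val_scale fpsZ /= /delta eq_sym; case: eqP => _.
      by rewrite mulr1.
    by rewrite mulr0.
  have gs : nsq g = s.
    apply: complexI; rewrite -ipxx {2}/g ip_psum -psum_dot; apply: eq_psum => w hw.
    by rewrite ipZr ipC ip_dl gv hw mulrC.
  have hs : ip x (T g) = s%:C.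
    rewrite /g (linop_psum _ _ hT) ip_psum -psum_dot; apply: eq_psum => w hw.
    by rewrite (linopZ _ _ hT) ipZr mulrC -ipC.
  have h : s <= nrm x * (c * nrm g).
    have -> : s = nc (ip x (T g)) by rewrite hs nc_real ger0_norm.
    by apply: le_trans (cauchy_schwarz _ _) _; rewrite ler_wpM2l ?nrm_ge0.
  have [z0|sn0] := eqVneq s 0; first by rewrite z0 sqr_ge0.
  have gp : 0 < nrm g by rewrite lt0r nrm_ge0 andbT -sqrf_eq0 nrm_sqr gs.
  have h' : nrm g <= c * nrm x.
    by rewrite -(ler_pM2r gp) -expr2 nrm_sqr gs; apply: le_trans h _; rewrite mulrCA mulrA.
  by rewrite -gs -nrm_sqr ler_sqr ?nnegrE ?mulr_ge0 ?nrm_ge0.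
exists (fun x => mk2 (f2 x)) => x y.
apply: wsum_unique.
have h := hlim_ip (y := x) (hlim_op hT hc (trunc_lim y)).
apply: (eq_cvgr (U := C) _ h) => N.
rewrite /trunc (linop_psum _ _ hT) ip_psum; apply: eq_psum => w _.
by rewrite (linopZ _ _ hT) ipZr mulrC /= /f -ipC.
Qed.

End Basis.

Section Cdot.
Variables (R : realType).
Local Notation C := (Cplx R).
Local Notation nc := (@Normc.normc R).

Lemma cdotE m (x y : 'cV[C]_m) : cdot x y = \sum_i (x i 0)^* * y i 0.
Proof. by rewrite /cdot mxE; apply: eq_bigr => i _; rewrite !mxE. Qed.

Lemma cdot_xx m (x : 'cV[C]_m) : cdot x x = (\sum_i nc (x i 0) ^+ 2)%:C.
Proof. by rewrite cdotE rmorph_sum; apply: eq_bigr => i _; rewrite -nc_sqr. Qed.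

Lemma cdot_adj m (Z : 'M[C]_m) (x y : 'cV[C]_m) : cdot x (Z *m y) = cdot (Z ^t* *m x) y.
Proof.
rewrite !cdotE; under eq_bigr do rewrite mxE mulr_sumr.
rewrite exchange_big; apply: eq_bigr => i _ /=.
rewrite mxE conjC_sum mulr_suml; apply: eq_bigr => j _.
by rewrite !mxE conjCM conjCK mulrA [_ * Z _ _]mulrC.
Qed.

End Cdot.

(** * The multiplier b(R) *)

Section Multiplier.
Variables (R : realType) (d : nat).
Local Notation C := (Cplx R).
Local Notation nc := (@Normc.normc R).

(* The compression of [t L_k] to the span of the words of length at most [N]. *)
Section Compression.
Variables (N : nat) (t : R).
Hypothesis t01 : 0 < t < 1.
Local Notation m := #|{: N.-bseq 'I_d}|.
Let ew (i : 'I_m) : word d := val (enum_val i).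

Definition comprZ (k : 'I_d) : 'M[C]_m :=
  \matrix_(i, j) (t%:C * (ew i == k :: ew j)%:R).

Lemma ew_inj : injective ew.
Proof. by move=> i j /val_inj /enum_val_inj. Qed.

Lemma ew_size i : (size (ew i) <= N)%N.
Proof. exact: size_bseq. Qed.

Lemma ew_surj (w : word d) : (size w <= N)%N -> exists i, ew i = w.
Proof. by move=> h; exists (enum_rank (Bseq h)); rewrite /ew enum_rankK. Qed.

Lemma sum_ew (V : nmodType) (F : word d -> V) : \sum_i F (ew i) = psum N.+1 F.
Proof.
rewrite -bseq_psum (reindex (@enum_val _ {: N.-bseq 'I_d})) //.
by apply: onW_bij; exact: enum_val_bij.
Qed.

Lemma comprZ_word w i j :
  wordmx comprZ w i j = t%:C ^+ size w * (ew i == w ++ ew j)%:R.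
Proof.
elim: w i j => [|k w IH] i j.
  by rewrite /wordmx big_nil mxE expr0 mul1r /= (inj_eq ew_inj).
rewrite /wordmx big_cons mxE.
have -> : \sum_l comprZ k i l * wordmx comprZ w l j =
   \sum_l t%:C ^+ (size w).+1 * ((ew i == k :: ew l)%:R * (ew l == w ++ ew j)%:R).
  apply: eq_bigr => l _; rewrite IH mxE exprS -!mulrA; congr (_ * _).
  by rewrite mulrCA.
rewrite -mulr_sumr /=; congr (_ * _).
case ei : (ew i) => [|k' u].
  by rewrite big1 // => l _; rewrite mul0r.
have [l hl] : exists l, ew l = u by apply: ew_surj; rewrite ltnW // -ltnS; have := ew_size i;
  rewrite ei.
rewrite (bigD1 l) //= big1 ?addr0 => [|l' hl']; rewrite !eqseq_cons.
  by rewrite hl eqxx andbT; case: (k' == k); rewrite ?mul1r ?mul0r.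
by rewrite -hl (inj_eq ew_inj) [l == l']eq_sym (negPf hl') andbF mul0r.
Qed.

(** Deleting the first letter of a word of length at most N stays among such words, so the
    compressed shifts still have orthogonal ranges filling all nonempty words. *)
Lemma comprZ_row i i' :
  \sum_k (comprZ k *m (comprZ k) ^t*) i i' =
  (t%:C ^+ 2 * ((i == i') && (ew i != [::]))%:R).
Proof.
case ei : (ew i) => [|k u].
  rewrite andbF mulr0 big1 // => k _; rewrite mxE big1 // => l _.
  by rewrite mxE ei mulr0 mul0r.
rewrite andbT.
have [l hl] : exists l, ew l = u by apply: ew_surj; rewrite ltnW // -ltnS; have := ew_size i;
  rewrite ei.
rewrite (bigD1 k) //= [X in _ + X]big1 ?addr0 => [|k' hk]; last first.
  rewrite mxE big1 // => l' _; rewrite mxE ei eqseq_cons [k == k']eq_sym (negPf hk).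
  by rewrite mulr0 mul0r.
rewrite mxE (bigD1 l) //= big1 ?addr0 => [|l' hl']; last first.
  by rewrite mxE ei eqseq_cons -hl (inj_eq ew_inj) [l == l']eq_sym (negPf hl') andbF mulr0 mul0r.
rewrite !mxE hl ei eqxx mulr1 conjCM conjC_r expr2 mulrA; congr (_ * _).
by rewrite -ei (inj_eq ew_inj) [i' == i]eq_sym conjC_nat.
Qed.

(** The defect is 1 at the empty word and 1 - t^2 elsewhere; t < 1 makes it strictly positive. *)
Lemma comprZ_ball : row_ball comprZ.
Proof.
move=> x x0.
have hE i : ((1%:M - \sum_k comprZ k *m (comprZ k) ^t*) *m x) i 0 =
   (1 - t ^+ 2 * (ew i != [::])%:R)%:C * x i 0.
  rewrite mulmxBl mul1mx mxE [in X in _ + X]mxE mxE.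
  under eq_bigr do rewrite summxE comprZ_row.
  rewrite (bigD1 i) //= big1 ?addr0 => [|j hj].
    rewrite eqxx /= realCB realCM realCX mulrBl mul1r; congr (_ - _ * _ * _).
    by case: (ew i != [::]).
  by rewrite eq_sym (negPf hj) /= mulr0 mul0r.
rewrite cdotE; under eq_bigr do rewrite hE mulrCA -nc_sqr -realCM.
rewrite -rmorph_sum ltcR.
have c0 i : 0 < 1 - t ^+ 2 * (ew i != [::])%:R.
  have /andP[t0 t1] := t01; rewrite subr_gt0; case: (ew i != [::]); rewrite ?mulr1 ?mulr0 //.
  by rewrite exprn_ilt1 // ltW.
have [i xi] : exists i, x i 0 != 0.
  apply/existsP; apply: contraNT x0; rewrite negb_exists => /forallP h.
  by apply/eqP/matrixP => i j; rewrite mxE ord1; have := h i; rewrite negbK => /eqP.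
rewrite (bigD1 i) //= ltr_pwDl //.
  rewrite mulr_gt0 // exprn_gt0 // lt0r nc_ge0 andbT.
  by apply: contra xi => /eqP /Normc.eq0_normc ->.
by apply: sumr_ge0 => j _; rewrite mulr_ge0 ?sqr_ge0 // ltW.
Qed.

Lemma wsum_finite M (F : word d -> C) :
  (forall w, (M <= size w)%N -> F w = 0) -> wsum F = psum M F.
Proof.
move=> h; apply: wsum_unique; apply: (cvg_near_cst _); exists M => // K /= /subnK <-.
elim: (K - M)%N => [|j IH]; first by rewrite add0n.
rewrite addSn psumS -IH (eq_hsum (G := fun=> 0)); last first.
  by move=> w hw; rewrite h // hw leq_addl.
by rewrite /hsum big1 ?addr0.
Qed.

(** Left multiplication only lengthens words: the coefficient of the product at a word of length at
    most N involves only such words, and the compression loses nothing. The diagonal weights t^|w|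
    conjugate the scaled shifts into the unscaled ones. *)
Lemma compr_eval (b h : fps R d) i :
  (fps_eval b comprZ *m (\col_j (t%:C ^+ size (ew j) * h (ew j)))) i 0 =
  t%:C ^+ size (ew i) * fps_mul b h (ew i).
Proof.
rewrite mxE.
under eq_bigr => j _.
  rewrite !mxE (@wsum_finite N.+1); last first.
    move=> w hw; rewrite comprZ_word; case: eqP => [e|]; last by rewrite !mulr0.
    by have := ew_size i; rewrite e size_cat leqNgt (leq_trans hw) // leq_addr.
  rewrite -psum_mulr.
  under eq_psum => w _ do rewrite comprZ_word.
  over.
rewrite (sum_ew (fun v => psum N.+1 (fun w => b w * (t%:C ^+ size w * (ew i == w ++ v)%:R) *
   (t%:C ^+ size v * h v)))).
transitivity (psum N.+1 (fun v => psum N.+1 (fun w =>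
   \sum_(k < (size (ew i)).+1) if w == take k (ew i) then
     if v == drop k (ew i) then t%:C ^+ size (ew i) * (b w * h v) else 0 else 0))).
  apply: eq_psum => v _; apply: eq_psum => w _.
  have [e|ne] := eqVneq (ew i) (w ++ v).
    transitivity ((ew i == w ++ v)%:R * (t%:C ^+ size (ew i) * (b w * h v))).
      rewrite e eqxx size_cat exprD mul1r mulr1; ring.
    rewrite cat_splits mulr_suml; apply: eq_bigr => k _.
    by case: eqP => _; case: eqP => _; rewrite ?mul1r ?mul0r.
  rewrite mulr0 mulr0 mul0r big1 // => k _.
  case: eqP => // ew_; case: eqP => // ev_.
  by move: ne; rewrite ew_ ev_ cat_take_drop eqxx.
under eq_psum => v _ do rewrite psum_sum.
rewrite psum_sum /fps_mul mulr_sumr; apply: eq_bigr => k _.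
have hi := ew_size i; have hk := ltn_ord k; rewrite ltnS in hk.
under eq_psum => v _ do rewrite psum_if size_takel // ltnS (leq_trans hk hi).
by rewrite psum_if ltnS size_drop (leq_trans (leq_subr _ _) hi).
Qed.

End Compression.

(** [Hinf_ball] speaks of matrix points only. The scaled compressed shifts are such points, and
    there b acts as truncated multiplication; the scaling is removed by letting t tend to 1. *)
Lemma fps_mul_psum_le (b h : fps R d) N : Hinf_ball b ->
  psum N (fun w => nc (fps_mul b h w) ^+ 2) <= psum N (fun w => nc (h w) ^+ 2).
Proof.
move=> [_ hb]; case: N => [|N]; first by rewrite /psum !big_ord0.
set X := psum _ _; set Y := psum _ _.
(* The exponent is 2N because t^(2|w|) is at least t^(2N) for all words in question. *)
have key t : 0 < t < 1 -> t ^+ (N + N) * X <= Y.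
  move=> t01; have /andP[t0 t1] := t01.
  pose x : 'cV[C]_#|{: N.-bseq 'I_d}| :=
    \col_j (t%:C ^+ size (val (enum_val j)) * h (val (enum_val j))).
  have := hb _ _ (comprZ_ball (N := N) t01) x.
  rewrite !cdot_xx lecR => hle.
  have e1 : \sum_i nc (x i 0) ^+ 2 <= Y.
    rewrite /Y -(@sum_ew N _ (fun w => nc (h w) ^+ 2)); apply: ler_sum => i _.
    rewrite mxE Normc.normcM ncX nc_real (ger0_norm (ltW t0)) exprMn ler_piMl ?sqr_ge0 //.
    by rewrite -exprM exprn_ile1 // ltW.
  apply: le_trans e1; apply: le_trans hle.
  rewrite /X -(@sum_ew N _ (fun w => nc (fps_mul b h w) ^+ 2)) mulr_sumr; apply: ler_sum => i _.
  rewrite compr_eval Normc.normcM ncX nc_real (ger0_norm (ltW t0)) exprMn.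
  rewrite ler_wpM2r ?sqr_ge0 // exprD -expr2 ler_sqr ?nnegrE ?exprn_ge0 ?(ltW t0) //.
  by rewrite ler_wiXn2l ?(ltW t0) ?(ltW t1) // ew_size.
have hc : t ^+ (N + N) * X @[t --> (1 : R)^'-] --> X.
  suff : t ^+ (N + N) * X @[t --> (1 : R)^'-] --> 1 ^+ (N + N) * X by rewrite expr1n mul1r.
  apply: cvgM; last exact: cvg_cst.
  apply: cvg_at_left_filter; exact: exprn_continuous.
apply: (cvgr_to_le hc).
near=> t; apply: key; apply/andP; split; near: t; first exact: nbhs_left_gt.
exact: nbhs_left_lt.
Unshelve. all: by end_near. Qed.

Lemma multR_le (b : fps R d) (hb : Hinf_ball b) (h : fps R d) : H2 h ->
  H2 (multR b h) /\
  complex.Re (dot (multR b h) (multR b h)) <= complex.Re (dot h h).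
Proof.
move=> hh.
have key N : psum N (fun w => nc (multR b h w) ^+ 2) <= complex.Re (dot h h).
  apply: le_trans (psum_le_dot_sq N hh).
  rewrite -(psum_rev N (fun w => nc (h w) ^+ 2)) -(psum_rev N (fun w => nc (multR b h w) ^+ 2)).
  rewrite [leLHS](_ : _ = psum N (fun w => nc (fps_mul b (Ut h) w) ^+ 2)); last first.
    by apply: eq_psum => w _; rewrite /multR /= /Ut revK.
  exact: fps_mul_psum_le.
have h2 : H2 (multR b h) by apply/H2P; exists (complex.Re (dot h h)).
by split=> //; exact: dot_sq_le.
Qed.

End Multiplier.

(** * The de Branges-Rovnyak space *)

Section Lifting.
Variables (R : realType) (d : nat).
Local Notation C := (Cplx R).
Local Notation E := (ell2 R d).

Lemma mk2K (x : E) (h : H2 (ell2val x)) : mk2 h = x.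
Proof. exact: val_inj. Qed.

(** [adjoint] and [psqrt] choose among maps on all of [fps]; an operator on [ell2] becomes a
    candidate when extended by 0. *)
Definition ext (T : E -> E) (h : fps R d) : fps R d :=
  if pselect (H2 h) is left p then ell2val (T (mk2 p)) else 0.

Lemma extE (T : E -> E) (x : E) : ext T (ell2val x) = ell2val (T x).
Proof. by rewrite /ext; case: pselect => [p|/(_ (ell2P x))//]; rewrite mk2K. Qed.

Lemma ext_mk2 (T : E -> E) h (p : H2 h) : ext T h = ell2val (T (mk2 p)).
Proof. exact: (extE T (mk2 p)). Qed.

Lemma adjoint_lin (T : fps R d -> fps R d) (c : C) g h :
  (forall f, H2 f -> H2 (T f)) -> H2 g -> H2 h ->
  adjoint T (c *: g + h) = c *: adjoint T g + adjoint T h.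
Proof.
move=> hT hg hh.
have [[T' hT']|hno] := pselect (exists T', is_adjoint T T'); last first.
  (* If no adjoint exists, [adjoint T] is the default zero map, which is linear as well. *)
  rewrite /adjoint xgetPN ?scaler0 ?addr0 // => T' hT'.
  by apply: hno; exists T'.
have [h2 hadj] : is_adjoint T (adjoint T).
  by apply: (@xgetPex _ _ [set T' | is_adjoint T T']); exists T'.
have a (z : E) f (p : H2 f) : ip z (mk2 (h2 _ p)) = ip (mk2 (hT _ (ell2P z))) (mk2 p).
  by rewrite ipC [RHS]ipC; congr (_^*); exact: (hadj _ _ p (ell2P z)).
have hl := H2_lin c hg hh.
have e : mk2 (h2 _ hl) = c *: mk2 (h2 _ hg) + mk2 (h2 _ hh).
  apply: nondeg => z; rewrite ip_lin !a -ip_lin; congr ip; exact: val_inj.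
exact: (congr1 (@ell2val R d) e).
Qed.

Lemma H2_L (k : 'I_d) (h : fps R d) : H2 h -> H2 (L k h).
Proof.
move=> /H2P [c hc]; apply/H2P; exists c => N.
have hL i u : L k h (i :: u) = if i == k then h u else 0.
  rewrite /L /multL /fps_mul.
  have h1 : (1 < (size (i :: u)).+1)%N by [].
  rewrite (bigD1 (Ordinal h1)) //= take0 drop0 big1 ?addr0 => [|j].
    by rewrite /fps_var eqseq_cons eqxx andbT; case: eqP; rewrite ?mul1r ?mul0r.
  rewrite -val_eqE /= /fps_var => hj; case: eqP => [e|]; last by rewrite mul0r.
  have := ltn_ord j; rewrite ltnS => hj'.
  by move: hj; rewrite -(size_takel (s := i :: u) hj') e.
have hL0 : L k h [::] = 0.
  by rewrite /L /multL /fps_mul big_ord_recl big_ord0 addr0 /fps_var mul0r.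
case: N => [|N]; first by apply: le_trans (hc 0); rewrite /psum !big_ord0.
rewrite psumSl hL0 Normc.normc0 expr0n add0r (bigD1 k) //= big1 ?addr0 => [|i /negPf hi].
  by apply: le_trans (hc N); apply: le_psum => w _; rewrite hL eqxx.
by rewrite /psum big1 // => j _; rewrite /hsum big1 // => w _;
  rewrite hL hi Normc.normc0 expr0n.
Qed.

End Lifting.

Section Space.
Variables (R : realType) (d : nat) (b : fps R d).
Hypothesis hb : Hinf_ball b.
Local Notation C := (Cplx R).
Local Notation nc := (@Normc.normc R).
Local Notation E := (ell2 R d).
Implicit Types x y z u : E.

Lemma multR_lin (c : C) (g h : fps R d) : multR b (c *: g + h) = c *: multR b g + multR b h.
Proof.
apply/funext => w.
have -> : (c *: multR b g + multR b h) w = c * multR b g w + multR b h w by [].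
rewrite /multR /= /Ut /multL /fps_mul mulr_sumr -big_split; apply: eq_bigr => i _.
have -> : (c *: g + h) (rev (drop i (rev w))) =
  c * g (rev (drop i (rev w))) + h (rev (drop i (rev w))) by [].
by rewrite mulrDr mulrCA.
Qed.

Definition Bop x : E := mk2 (multR_le hb (ell2P x)).1.

Lemma Bop_lin : linop Bop.
Proof. by move=> c x y; apply: val_inj; rewrite /= multR_lin. Qed.

Lemma Bop_le x : nrm (Bop x) <= nrm x.
Proof.
rewrite -ler_sqr ?nnegrE ?nrm_ge0 // !nrm_sqr; exact: (multR_le hb (ell2P x)).2.
Qed.

Lemma Badj_ex : exists T', forall x y, ip (T' x) y = ip x (Bop y).
Proof. by apply: (adj_exists (c := 1)) => [||x]; [exact: Bop_lin| |rewrite mul1r Bop_le]. Qed.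

Definition Badj : E -> E := projT1 (cid Badj_ex).

Lemma BadjP x y : ip (Badj x) y = ip x (Bop y).
Proof. exact: (projT2 (cid Badj_ex)). Qed.

Lemma adjoint_multR : is_adjoint (multR b) (adjoint (multR b)).
Proof.
apply: (@xgetPex _ _ [set T' | is_adjoint (multR b) T']); exists (ext Badj); split.
  by move=> h hh; rewrite (ext_mk2 _ hh); exact: ell2P.
by move=> g h hg hh; rewrite (ext_mk2 _ hg); exact: (BadjP (mk2 hg) (mk2 hh)).
Qed.

Lemma adjoint_multRE x : adjoint (multR b) (ell2val x) = ell2val (Badj x).
Proof.
have [h2 hadj] := adjoint_multR.
have -> : adjoint (multR b) (ell2val x) = ell2val (mk2 (h2 _ (ell2P x))) by [].
congr ell2val; apply: nondeg => z; rewrite ipC [RHS]ipC; congr (_^*).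
by rewrite BadjP; exact: (hadj _ _ (ell2P x) (ell2P z)).
Qed.

Local Notation P := (fun h : fps R d => h - multR b (adjoint (multR b) h)).

Lemma defectE x : P (ell2val x) = ell2val (x - Bop (Badj x)).
Proof. by rewrite /= adjoint_multRE. Qed.

Lemma defect_psqrt : is_psqrt P (defect b).
Proof.
apply: (@xgetPex _ _ [set S | is_psqrt P S]).
have [S [Slin Spos SS]] := psqrt_op_exists (Q_lin Bop_lin BadjP) (Q_sym BadjP)
  (Q_le BadjP Bop_le).
exists (ext S); split.
- by move=> h hh; rewrite (ext_mk2 _ hh); exact: ell2P.
- move=> c g h hg hh; rewrite (ext_mk2 _ hg) (ext_mk2 _ hh).
  by rewrite -[c *: g + h]/(ell2val (c *: mk2 hg + mk2 hh)) extE Slin.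
- by move=> h hh; rewrite (ext_mk2 _ hh); exact: Spos.
- by move=> h hh; rewrite (ext_mk2 _ hh) extE SS -defectE.
Qed.

Definition Sop x : E := mk2 (let: And4 h _ _ _ := defect_psqrt in h _ (ell2P x)).

Lemma SopE x : defect b (ell2val x) = ell2val (Sop x).
Proof. by []. Qed.

Lemma Sop_lin : linop Sop.
Proof.
by move=> c x y; apply: val_inj; have [_ h _ _] := defect_psqrt; apply: h; exact: ell2P.
Qed.

Lemma Sop_pos x : 0 <= ip x (Sop x).
Proof. by have [_ _ h _] := defect_psqrt; apply: h; exact: ell2P. Qed.

Lemma Sop_sqr x : Sop (Sop x) = x - Bop (Badj x).
Proof.
apply: val_inj; have [_ _ _ h] := defect_psqrt.
by rewrite -[RHS]defectE -h; [|exact: ell2P].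
Qed.

(* Polarisation: a form that vanishes on the diagonal is zero. *)
Lemma Sop_sym x y : ip (Sop x) y = ip x (Sop y).
Proof.
pose D x y := ip (Sop x) y - ip x (Sop y).
have D0 z : D z z = 0.
  rewrite /D ipC; apply/eqP; rewrite subr_eq0; apply/eqP/CrealP.
  exact: ger0_real (Sop_pos z).
have h1 : D x y + D y x = 0.
  have := D0 (x + y); rewrite /D !(linopD _ _ Sop_lin) !ipDl !ipDr.
  have := D0 x; have := D0 y; rewrite /D => /eqP; rewrite subr_eq0 => /eqP -> /eqP.
  rewrite subr_eq0 => /eqP -> h; rewrite -{}h; ring.
have h2 : D x y - D y x = 0.
  have := D0 (x + 'i *: y); rewrite /D !(linopD _ _ Sop_lin) !(linopZ _ _ Sop_lin).
  rewrite !ipDl !ipDr !ipZl !ipZr conjCi.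
  have := D0 x; have := D0 y; rewrite /D => /eqP; rewrite subr_eq0 => /eqP -> /eqP.
  rewrite subr_eq0 => /eqP -> h.
  apply: (mulfI (neq0Ci _)); rewrite mulr0 -{}h; ring.
have h3 : D x y = 0.
  have : D x y + D x y = (D x y + D y x) + (D x y - D y x) by ring.
  by rewrite h1 h2 addr0 -mulr2n => /eqP; rewrite mulrn_eq0 => /eqP.
by apply/eqP; rewrite -subr_eq0; apply/eqP.
Qed.

Lemma ip_Sop x y : ip (Sop x) (Sop y) = ip x y - ip (Badj x) (Badj y).
Proof. by rewrite Sop_sym Sop_sqr ipBr -BadjP. Qed.

Definition kperp x := forall u, Sop u = 0 -> ip u x = 0.

Lemma kperp_lin (c : C) x y : kperp x -> kperp y -> kperp (c *: x + y).
Proof. by move=> hx hy u hu; rewrite ip_lin hx // hy // mulr0 addr0. Qed.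

Lemma kperpB x y : kperp x -> kperp y -> kperp (x - y).
Proof. by move=> hx hy u hu; rewrite ipBr hx // hy // subrr. Qed.

Lemma kperp_Sop x : kperp (Sop x).
Proof. by move=> u hu; rewrite -Sop_sym hu ip0l. Qed.

Lemma kperp_hlim (u : nat -> E) l : (forall n, kperp (u n)) -> hlim u l -> kperp l.
Proof.
move=> hu hl z hz; have h := hlim_ip (y := z) hl.
rewrite -(cvg_lim (@norm_hausdorff _ C) h); apply/cvg_lim; first exact: norm_hausdorff.
by apply: eq_cvgr (cvg_cst (0 : C)) => n; rewrite hu.
Qed.

Lemma Sop_inj x y : kperp x -> kperp y -> Sop x = Sop y -> x = y.
Proof.
move=> hx hy h; apply/eqP; rewrite -subr_eq0; apply/eqP/nsq_eq0.
by rewrite /nsq (kperpB hx hy) // (linopB _ _ Sop_lin) h subrr.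
Qed.

(** As S^2 = 1 - B B^*, the kernel of S is the fixed space of B B^*: the fixed vector p has |Sp|^2 =
    <p, S^2 p> = 0. Subtracting the component given by [kernel_projection] therefore leaves Sx
    unchanged. *)
Lemma Sop_lift x : exists2 z, kperp z & Sop z = Sop x.
Proof.
have [p hp hperp] := kernel_projection Bop_lin BadjP Bop_le x.
have Sker u : Sop u = 0 -> Bop (Badj u) = u.
  move=> hu; have := Sop_sqr u; rewrite hu (linop0 Sop_lin) => /esym/eqP.
  by rewrite subr_eq0 => /eqP.
have Sp : Sop p = 0.
  by apply: nsq_eq0; rewrite /nsq Sop_sym Sop_sqr hp subrr ip0r.
exists (x - p); first by move=> u /Sker; exact: hperp.
by rewrite (linopB _ _ Sop_lin) Sp subr0.
Qed.

Lemma Hb_Sop x : Hb b (ell2val (Sop x)).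
Proof. by exists (ell2val x) => //; exact: ell2P. Qed.

Lemma HbP h : Hb b h -> exists2 x, kperp x & h = ell2val (Sop x).
Proof.
by move=> [f hf ->]; have [z hz e] := Sop_lift (mk2 hf); exists z => //; rewrite e.
Qed.

Lemma defect_liftE x : kperp x -> defect_lift b (ell2val (Sop x)) = ell2val x.
Proof.
move=> hx; apply: xget_unique.
  split=> //; split; first exact: ell2P.
  by move=> u hu hu0; apply: (hx (mk2 hu)); apply: val_inj.
move=> f [[hf hperp] hS]; have -> : f = ell2val (mk2 hf) by [].
congr ell2val; apply: Sop_inj => //; last exact: val_inj.
by move=> u hu; apply: hperp; [exact: ell2P|rewrite SopE hu].
Qed.

Lemma dotbE x y : kperp x -> kperp y ->
  dotb b (ell2val (Sop x)) (ell2val (Sop y)) = ip x y.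
Proof. by move=> hx hy; rewrite /dotb !defect_liftE. Qed.

Lemma normbE x : kperp x -> normb b (ell2val (Sop x)) = nrm x.
Proof. by move=> hx; rewrite /normb dotbE. Qed.

(** For w orthogonal to the kernel of S, the inner product of SSk and Sw in the space is <Sk, w> =
    <k, Sw>, which is the evaluation of Sw. *)
Lemma kerbE n (Z : 'I_d -> 'M[C]_n) (y v : 'cV[C]_n) (k : E) :
  (forall x, ip k x = cdot y (fps_eval (ell2val x) Z *m v)) ->
  kerb b Z y v = ell2val (Sop (Sop k)).
Proof.
move=> hk.
have hrep : forall h, Hb b h -> dotb b (ell2val (Sop (Sop k))) h = cdot y (fps_eval h Z *m v).
  move=> _ /HbP [w hw ->]; rewrite dotbE //; last exact: kperp_Sop.
  by rewrite Sop_sym hk.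
apply: xget_unique; first by split=> //; exact: Hb_Sop.
move=> f [/HbP [w hw ->] hrep']; congr ell2val; congr Sop.
have hS := kperp_Sop k; have hd := kperpB hw hS.
apply/eqP; rewrite -subr_eq0; apply/eqP/nsq_eq0; rewrite /nsq ipBl.
rewrite -(dotbE hw hd) -(dotbE hS hd) hrep' ?hrep ?subrr //; exact: Hb_Sop.
Qed.

(** By [kerbE] and the isometry of S, the kernels converge to Sx in the space as soon as S k(t)
    tends to x in the Hardy space, where x stays orthogonal to the kernel of S. Convergence of the
    values is then Cauchy-Schwarz. *)
Lemma kernel_limit n (A : 'I_d -> 'M[C]_n) (y v : 'cV[C]_n) (k : R -> E) :
  (forall t, 0 < t < 1 -> forall x,
     ip (k t) x = cdot y (fps_eval (ell2val x) (fun j => t%:C *: A j) *m v)) ->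
  (forall e : R, 0 < e -> exists2 r : R, r < 1 & forall s t, r < s < 1 -> r < t < 1 ->
     nrm (Sop (k s) - Sop (k t)) <= e) ->
  exists KA : fps R d,
    [/\ Hb b KA,
        normb b (kerb b (fun j => t%:C *: A j) y v - KA) @[t --> (1 : R)^'-] --> (0 : R)
      & forall h : fps R d, Hb b h ->
          cdot y (fps_eval h (fun j => t%:C *: A j) *m v)
            @[t --> (1 : R)^'-] --> dotb b KA h].
Proof.
move=> hk hC.
(* Completeness is available for sequences, so one tending to 1 is fixed; [n.+2] keeps it inside the
   open unit interval from n = 0 on. *)
pose tn n : R := 1 - n.+2%:R^-1.
have tn01 m : 0 < tn m < 1.
  by rewrite subr_gt0 invf_lt1 // ?ltr1n //= gtrBl invr_gt0.
have tn_near (r : R) : r < 1 -> \forall m \near \oo, r < tn m < 1.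
  move=> r1; have : (fun m => m.+1%:R^-1) @ \oo --> (0 : R) by exact: cvg_harmonic.
  move=> /cvgrPdist_lt /(_ (1 - r)); rewrite subr_gt0 => /(_ r1) [N _ hN].
  exists N => // m /= Nm; have /andP[_ ->] := tn01 m; rewrite andbT /tn.
  have := hN m.+1 (leqW Nm); rewrite /= sub0r normrN => /(le_lt_trans (ler_norm _)).
  by move: (m.+2%:R^-1) => a ha; lra.
have [x hx] : exists x, hlim (fun m => Sop (k (tn m))) x.
  apply: ell2_complete => e /hC [r r1 hr]; have [N _ hN] := tn_near r r1.
  by exists N => p q Np Nq; apply: hr; exact: hN.
have kx : kperp x by apply: kperp_hlim hx => m; exact: kperp_Sop.
have xlim : nrm (Sop (k t) - x) @[t --> (1 : R)^'-] --> (0 : R).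
  apply/cvgrPdist_le => e e0.
  have e2 : 0 < e / 2 by rewrite divr_gt0.
  have [r r1 hr] := hC _ e2.
  have [N1 _ h1] := tn_near r r1.
  have /cvgrPdist_le /(_ _ e2) [N2 _ h2] := hx.
  pose m := maxn N1 N2.
  near=> t.
  rewrite sub0r normrN ger0_norm ?nrm_ge0 //.
  apply: le_trans (nrm_tri _ (Sop (k (tn m))) _) _.
  rewrite [leRHS](splitr e); apply: lerD.
    apply: hr; last by apply: h1; exact: leq_maxl.
    apply/andP; split; near: t; first exact: nbhs_left_gt.
    exact: nbhs_left_lt.
  have := h2 m (leq_maxr _ _); by rewrite sub0r normrN ger0_norm ?nrm_ge0.
exists (ell2val (Sop x)); split; first exact: Hb_Sop.
- have h : \forall t \near (1 : R)^'-, nrm (Sop (k t) - x) =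
      normb b (kerb b (fun j => t%:C *: A j) y v - ell2val (Sop x)).
    near=> t; rewrite (@kerbE _ _ _ _ (k t)); last first.
      move=> z; apply: hk; apply/andP; split; near: t; first exact: nbhs_left_gt.
      exact: nbhs_left_lt.
    rewrite -[X in normb b X]/(ell2val (Sop (Sop (k t)) - Sop x)) -(linopB _ _ Sop_lin).
    by rewrite normbE //; apply: kperpB => //; exact: kperp_Sop.
  exact: cvg_trans (near_eq_cvg h) xlim.
- move=> _ /HbP [w hw ->]; rewrite dotbE //.
  apply/cvgC.
  apply: (squeeze_cvgr _ (cvg_cst (0 : R)) (h := fun t => nrm (Sop (k t) - x) * nrm w)).
    near=> t; rewrite nc_ge0 /=.
    have t01 : 0 < t < 1.
      apply/andP; split; near: t; first exact: nbhs_left_gt.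
      exact: nbhs_left_lt.
    rewrite -(hk t t01 (Sop w)).
    by rewrite -Sop_sym -ipBl cauchy_schwarz.
  by rewrite -[X in _ --> X](mul0r (nrm w)); apply: cvgM => //; exact: cvg_cst.
Unshelve. all: by end_near. Qed.

End Space.

(** * Szego kernels *)

Section Words.
Variables (R : realType) (d n : nat) (A : 'I_d -> 'M[Cplx R]_n).
Local Notation C := (Cplx R).

Lemma wordmx_cat u v : wordmx A (u ++ v) = wordmx A u *m wordmx A v.
Proof.
elim: u => [|k u IH]; first by rewrite /wordmx big_nil mul1mx.
by rewrite /wordmx cat_cons !big_cons -!/(wordmx A _) IH mulmxA.
Qed.

Lemma wordmx_scale (z : C) u : wordmx (fun k => z *: A k) u = z ^+ size u *: wordmx A u.
Proof.
elim: u => [|k u IH]; first by rewrite /wordmx !big_nil expr0 scale1r.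
rewrite /wordmx !big_cons -!/(wordmx _ _) IH -scalemxAl -scalemxAr scalerA.
by rewrite -exprS.
Qed.

Lemma wordmx1 k : wordmx A [:: k] = A k.
Proof. by rewrite /wordmx big_cons big_nil mulmx1. Qed.

End Words.

Lemma wordmx_tr (R : realType) (d n : nat) (A : 'I_d -> 'M[Cplx R]_n) u :
  wordmx (fun k => (A k)^T) (rev u) = (wordmx A u)^T.
Proof.
elim: u => [|k u IH]; first by rewrite /wordmx !big_nil trmx1.
by rewrite rev_cons -cats1 wordmx_cat IH wordmx1 -trmx_mul /wordmx big_cons.
Qed.

Section Geometric.
Variable R : realType.

Lemma geometric_le (x : R) N : 0 <= x < 1 -> \sum_(k < N) x ^+ k <= (1 - x)^-1.
Proof.
move=> /andP[x0 x1]; have h : 0 < 1 - x by rewrite subr_gt0.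
rewrite -(ler_pM2l h) mulfV ?gt_eqF //.
have -> : (1 - x) * \sum_(k < N) x ^+ k = 1 - x ^+ N.
  elim: N => [|N IH]; first by rewrite big_ord0 mulr0 expr0 subrr.
  by rewrite big_ord_recr /= mulrDr IH exprS; ring.
by rewrite gerBl exprn_ge0.
Qed.

Lemma psum_geometric (d : nat) (F : word d -> R) (c x : R) N :
  0 <= x < 1 -> 0 <= c -> (forall k, hsum k F <= c) ->
  psum N (fun w => x ^+ size w * F w) <= c * (1 - x)^-1.
Proof.
move=> x01 c0 hF; apply: le_trans (ler_wpM2l c0 (geometric_le N x01)).
rewrite mulr_sumr; apply: ler_sum => k _.
rewrite (eq_hsum (G := fun w => x ^+ k * F w)) => [|w ->//].
rewrite hsum_mull mulrC ler_wpM2r ?exprn_ge0 //; by case/andP: x01.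
Qed.

End Geometric.

Section Kernels.
Variables (R : realType) (d n : nat) (A : 'I_d -> 'M[Cplx R]_n).
Local Notation C := (Cplx R).
Local Notation nc := (@Normc.normc R).
Local Notation E := (ell2 R d).
Hypothesis Aiso : forall x : 'cV[C]_n,
  \sum_k cdot ((A k) ^t* *m x) ((A k) ^t* *m x) = cdot x x.

Definition sq2 (p : 'cV[C]_n) : R := \sum_i nc (p i 0) ^+ 2.
Definition norm1 (p : 'cV[C]_n) : R := \sum_i nc (p i 0).

Lemma sq2_ge0 p : 0 <= sq2 p.
Proof. by apply: sumr_ge0 => i _; exact: sqr_ge0. Qed.

Lemma norm1_ge0 p : 0 <= norm1 p.
Proof. by apply: sumr_ge0 => i _; exact: nc_ge0. Qed.

(** Cauchy-Schwarz with the larger l1 norm for p; only the factor [sq2 a] has to be sharp, since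
    [hsum_iso] sums it exactly. *)
Lemma cdot_bound (a p : 'cV[C]_n) : nc (cdot a p) ^+ 2 <= sq2 a * norm1 p ^+ 2.
Proof.
rewrite -[sq2 a]sqr_sqrtr ?sq2_ge0 // -exprMn.
rewrite ler_sqr ?nnegrE ?nc_ge0 ?mulr_ge0 ?sqrtr_ge0 ?norm1_ge0 //.
rewrite cdotE; apply: le_trans (nc_sum _ _ _) _; rewrite mulr_sumr; apply: ler_sum => i _.
rewrite Normc.normcM nc_conj ler_wpM2r ?nc_ge0 //.
rewrite -ler_sqr ?nnegrE ?nc_ge0 ?sqrtr_ge0 // sqr_sqrtr ?sq2_ge0 // /sq2 (bigD1 i) //= lerDl.
by apply: sumr_ge0 => j _; exact: sqr_ge0.
Qed.

Lemma cdotZ (a p : 'cV[C]_n) (c : C) : cdot a (c *: p) = c * cdot a p.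
Proof. by rewrite /cdot -scalemxAr mxE. Qed.

Definition rowf (y : 'cV[C]_n) (u : word d) (p : 'cV[C]_n) : C := cdot y (wordmx A u *m p).

(** The row of all A^u with u of length k is again co-isometric. The induction removes the last
    letter i, because the adjoint of A^{ui} is the adjoint of A_i times that of A^u. *)
Lemma hsum_iso y k : hsum k (fun u => sq2 ((wordmx A u) ^t* *m y)) = sq2 y.
Proof.
elim: k => [|k IH].
  by rewrite hsum0 /wordmx big_nil trmx1 map_mx1 mul1mx.
rewrite hsumSr -hsum_sum -[RHS]IH; apply: eq_hsum => u _.
have e i : (wordmx A (rcons u i)) ^t* *m y = (A i) ^t* *m ((wordmx A u) ^t* *m y).
  by rewrite -cats1 wordmx_cat wordmx1 trmx_mul map_mxM mulmxA.
under eq_bigr do rewrite e.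
apply: complexI; rewrite rmorph_sum -cdot_xx -Aiso; apply: eq_bigr => i _.
by rewrite cdot_xx.
Qed.

Lemma hsum_rowf y p k : hsum k (fun u => nc (rowf y u p) ^+ 2) <= sq2 y * norm1 p ^+ 2.
Proof.
apply: le_trans (_ : hsum k (fun u => sq2 ((wordmx A u) ^t* *m y) * norm1 p ^+ 2) <= _).
  by apply: le_hsum => u _; rewrite /rowf cdot_adj; exact: cdot_bound.
by rewrite hsum_mulr hsum_iso.
Qed.

(** Coefficients of the vector that represents h -> y^* h(zA) p, conjugated because the inner
    product is conjugate linear in its first variable. *)
Definition szego_fps (y : 'cV[C]_n) (z : C) (p : 'cV[C]_n) : fps R d :=
  fun u => (z ^+ size u * rowf y u p)^*.

Lemma ncsq01 (z : C) : nc z < 1 -> 0 <= nc z ^+ 2 < 1.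
Proof. by move=> h; rewrite sqr_ge0 /= exprn_ilt1 ?nc_ge0. Qed.

Lemma szego_fps_psum y z p N : nc z < 1 ->
  psum N (fun u => nc (szego_fps y z p u) ^+ 2) <= (sq2 y * norm1 p ^+ 2) * (1 - nc z ^+ 2)^-1.
Proof.
move=> hz.
have -> : psum N (fun u => nc (szego_fps y z p u) ^+ 2) =
    psum N (fun u => (nc z ^+ 2) ^+ size u * nc (rowf y u p) ^+ 2).
  by apply: eq_psum => u _; rewrite nc_conj Normc.normcM ncX exprMn -!exprM [(2 * _)%N]mulnC.
apply: psum_geometric;
  [exact: ncsq01 | by rewrite mulr_ge0 ?sq2_ge0 ?sqr_ge0 | exact: hsum_rowf].
Qed.

Lemma szego_fps_H2 y z p : nc z < 1 -> H2 (szego_fps y z p).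
Proof.
by move=> hz; apply/H2P; eexists => N; exact: szego_fps_psum.
Qed.

(** Makes [szego] total in z: where the family is not square-summable the vector is arbitrary. *)
Lemma szego_exists y z p : exists k : E, H2 (szego_fps y z p) -> ell2val k = szego_fps y z p.
Proof.
have [h|h] := pselect (H2 (szego_fps y z p)); last by exists 0.
by exists (mk2 h).
Qed.

Definition szego y z p : E := projT1 (cid (szego_exists y z p)).

Lemma szegoE y z p : nc z < 1 -> ell2val (szego y z p) = szego_fps y z p.
Proof. by move=> hz; exact: (projT2 (cid (szego_exists y z p)) (szego_fps_H2 _ _ hz)). Qed.

(** An entry of h(zA) is the pairing of h with the Szego family in two coordinate directions, hence
    an absolutely summable series. *)
Lemma fps_eval_cvg z (h : fps R d) i j : nc z < 1 -> H2 h ->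
  psum N (fun u => h u * wordmx (fun k => z *: A k) u i j) @[N --> \oo] -->
    fps_eval h (fun k => z *: A k) i j.
Proof.
move=> hz hh; rewrite mxE; apply: wsum_cvg.
have [c hc] := dot_summable (szego_fps_H2 (delta_mx i 0) (delta_mx j 0) hz) hh.
exists c => N; apply: le_trans (hc N); apply: le_psum => u _.
rewrite /szego_fps conjCK wordmx_scale mxE mulrC /rowf cdotE (bigD1 i) //= big1 ?addr0 => [|l hl].
  rewrite !mxE !eqxx (bigD1 j) //= big1 ?addr0 => [|l hl].
    by rewrite mxE !eqxx conjC1 mul1r mulr1.
  by rewrite mxE (negPf hl) mulr0.
by rewrite mxE (negPf hl) conjC0 mul0r.
Qed.

Lemma ip_szego y z p (x : E) : nc z < 1 ->
  ip (szego y z p) x = cdot y (fps_eval (ell2val x) (fun k => z *: A k) *m p).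
Proof.
move=> hz; apply: wsum_unique; rewrite szegoE //.
have h : \sum_i (y i 0)^* * \sum_j (psum N (fun u => ell2val x u * wordmx (fun k => z *: A k) u i j)
    * p j 0) @[N --> \oo] -->
    \sum_i (y i 0)^* * \sum_j (fps_eval (ell2val x) (fun k => z *: A k) i j * p j 0).
  apply: cvg_sum => i _; apply: cvgM; first exact: cvg_cst.
  apply: cvg_sum => j _; apply: cvgM; last exact: cvg_cst.
  by apply: fps_eval_cvg => //; exact: ell2P.
have -> : cdot y (fps_eval (ell2val x) (fun k => z *: A k) *m p) =
  \sum_i (y i 0)^* * \sum_j (fps_eval (ell2val x) (fun k => z *: A k) i j * p j 0).
  by rewrite cdotE; apply: eq_bigr => i _; rewrite mxE.
apply: (eq_cvgr (U := C) _ h) => N.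
under eq_bigr => i _.
  under eq_bigr => j _ do rewrite -psum_mulr.
  rewrite -psum_sum -psum_mull; over.
rewrite -psum_sum; apply: eq_psum => u _.
rewrite /szego_fps conjCK /rowf cdotE mulr_sumr mulr_suml; apply: eq_bigr => i _.
rewrite mxE !mulr_sumr !mulr_suml; apply: eq_bigr => j _.
rewrite wordmx_scale mxE; ring.
Qed.

Lemma wsum_prefix w (F : word d -> C) (l : C) :
  (forall u, (forall v, u != w ++ v) -> F u = 0) ->
  psum N (fun v => F (w ++ v)) @[N --> \oo] --> l -> wsum F = l.
Proof.
move=> h hl; apply: wsum_unique.
have shift N : psum (N + size w) F = psum N (fun v => F (w ++ v)).
  elim: w F h {hl} => [|k w IH] F h; first by rewrite addn0.
  rewrite addnS psumSl h ?add0r; last by [].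
  rewrite (bigD1 k) //= big1 ?addr0 => [|i /negPf hi].
    by apply: IH => u hu; apply: h => v; rewrite eqseq_cons eqxx hu.
  rewrite /psum big1 // => j _; rewrite /hsum big1 // => u _; apply: h => v.
  by rewrite eqseq_cons hi.
rewrite -(cvg_shiftn (size w)); apply: eq_cvgr hl => N.
by rewrite shift.
Qed.

(** Reversal turns left multiplication by b into right multiplication by b^t, so delta_w is sent to
    the word w followed by b^t. *)
Lemma multR_delta_cat (b : fps R d) w v : multR b (delta R w) (w ++ v) = b (rev v).
Proof.
rewrite /multR /= /Ut /multL /fps_mul rev_cat.
have h : (size (rev v) < (size (rev v ++ rev w)).+1)%N by rewrite ltnS size_cat leq_addr.
rewrite (bigD1 (Ordinal h)) //= take_size_cat // drop_size_cat // /delta revK eqxx mulr1.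
rewrite big1 ?addr0 // => k; have := ltn_ord k; rewrite -val_eqE /=.
move: (nat_of_ord k) => {}k; rewrite size_cat !size_rev ltnS => hk' hk.
case: eqP => [e|]; last by rewrite mulr0.
have := congr1 size e; rewrite size_rev size_drop size_cat !size_rev => e2.
case/negP: hk; apply/eqP/(@addIn (size w)); by rewrite -{1}e2 subnKC.
Qed.

Lemma multR_delta0 (b : fps R d) w u : (forall v, u != w ++ v) -> multR b (delta R w) u = 0.
Proof.
move=> h; rewrite /multR /= /Ut /multL /fps_mul big1 // => k _.
rewrite /delta; case: eqP => [e|]; last by rewrite mulr0.
have := h (rev (take k (rev u))).
by rewrite -e -rev_cat cat_take_drop revK eqxx.
Qed.

Lemma multR_delta_eval (b : fps R d) w (hb : Hinf_ball b) z : nc z < 1 ->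
  fps_eval (multR b (delta R w)) (fun k => z *: A k) =
  wordmx (fun k => z *: A k) w *m fps_eval (Ut b) (fun k => z *: A k).
Proof.
move=> hz; apply/matrixP => i j; rewrite !mxE.
apply: (@wsum_prefix w).
  by move=> u hu; rewrite multR_delta0 ?mul0r.
have h : \sum_l wordmx (fun k => z *: A k) w i l *
    psum N (fun v => Ut b v * wordmx (fun k => z *: A k) v l j) @[N --> \oo] -->
    \sum_l wordmx (fun k => z *: A k) w i l * fps_eval (Ut b) (fun k => z *: A k) l j.
  apply: cvg_sum => l _; apply: cvgM; first exact: cvg_cst.
  by apply: fps_eval_cvg => //; apply: H2_Ut; case: hb.
apply: (eq_cvgr (U := C) _ h) => N.
under eq_bigr do rewrite -psum_mull.
rewrite -psum_sum; apply: eq_psum => v _.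
rewrite multR_delta_cat wordmx_cat mxE mulr_sumr; apply: eq_bigr => l _.
by rewrite mulrCA.
Qed.

Definition bt (b : fps R d) z : 'M[C]_n := fps_eval (Ut b) (fun k => z *: A k).

(** The coefficient of B^* K at w is the conjugate of <K, B delta_w>, that is, of y^* (zA)^w b^t(zA)
    p: the Szego coefficient in the direction b^t(zA) p. *)
Lemma Badj_szego (b : fps R d) (hb : Hinf_ball b) y z p : nc z < 1 ->
  Badj hb (szego y z p) = szego y z (bt b z *m p).
Proof.
move=> hz; apply: val_inj; apply/funext => w.
have -> : \val (szego y z (bt b z *m p)) w = szego_fps y z (bt b z *m p) w by rewrite -szegoE.
rewrite -[LHS]ip_dl ipC BadjP ip_szego // /szego_fps; congr (_^*).
have -> : ell2val (Bop hb (dl R w)) = multR b (delta R w) by [].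
by rewrite multR_delta_eval // /rowf -mulmxA wordmx_scale -scalemxAl cdotZ.
Qed.

Lemma ip_Sop_szego (b : fps R d) (hb : Hinf_ball b) y z w p q : nc z < 1 -> nc w < 1 ->
  ip (Sop hb (szego y z p)) (Sop hb (szego y w q)) =
  ip (szego y z p) (szego y w q) - ip (szego y z (bt b z *m p)) (szego y w (bt b w *m q)).
Proof.
by move=> hz hw; rewrite -(Badj_szego hb y p hz) -(Badj_szego hb y q hw); exact: ip_Sop.
Qed.

End Kernels.

(** * Abel limits *)

(* The hypothesis says that [M] has no nontrivial Jordan block for the eigenvalue 1. *)
Lemma fixed_range_decomposition (F : fieldType) (N : nat) (M : 'M[F]_N) :
  (forall w v : 'rV[F]_N, v *m M = v -> w *m M = w - v -> v = 0) ->
  forall p : 'rV[F]_N, exists a b : 'rV[F]_N, p = a + (b - b *m M) /\ a *m M = a.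
Proof.
move=> h p; pose Q := 1%:M - M.
have hQ (u : 'rV[F]_N) : u *m Q = u - u *m M by rewrite mulmxBr mulmx1.
have disj : (kermx Q :&: Q)%MS = 0.
  apply/eqP/rowV0P => v; rewrite sub_capmx => /andP[/sub_kermxP hv /submxP [w hw]].
  apply: (h w).
    by apply/esym/eqP; rewrite -subr_eq0 -hQ hv.
  by rewrite hw hQ subKr.
(* By rank-nullity, a kernel that meets the range trivially is a complement of it. *)
have full : row_full (kermx Q + Q)%MS.
  by rewrite /row_full mxrank_disjoint_sum // mxrank_ker subnK // rank_leq_row.
have /sub_addsmxP [[w1 w2] /= hp] : (p <= kermx Q + Q)%MS by exact: submx_full.
exists (w1 *m kermx Q), w2; split; first by rewrite hp hQ.
apply/esym/eqP; rewrite -subr_eq0 -hQ; apply/eqP/sub_kermxP; exact: submxMl.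
Qed.

Section Abel.
Variable R : realType.
Local Notation C := (Cplx R).
Local Notation nc := (@Normc.normc R).

Lemma geometric_eq (x : C) N : (1 - x) * \sum_(k < N) x ^+ k = 1 - x ^+ N.
Proof.
elim: N => [|N IH]; first by rewrite big_ord0 mulr0 expr0 subrr.
by rewrite big_ord_recr /= mulrDr IH exprS; ring.
Qed.

(** Abel summation: the constant part e gives e (1 - x^N), and after summation by parts the
    differences of beta contribute a bounded amount, which the factor 1 - x makes small. *)
Lemma abel_telescope (beta : nat -> C) (e S : C) (c x : R) (f : nat -> C) :
  0 < x < 1 -> (forall k, nc (beta k) <= c) ->
  (forall k, f k = e + (beta k - beta k.+1)) ->
  \sum_(k < N) x%:C ^+ k * f k @[N --> \oo] --> S ->
  nc ((1 - x)%:C * S - e) <= (1 - x) * (3 * c / x).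
Proof.
move=> /andP[x0 x1] hbeta hf hS.
have y0 : 0 < 1 - x by rewrite subr_gt0.
have c0 : 0 <= c by apply: le_trans (hbeta 0); exact: nc_ge0.
have fin N : nc ((1 - x)%:C * (\sum_(k < N) x%:C ^+ k * f k) - e) <=
    x ^+ N * nc e + (1 - x) * (3 * c / x).
  pose D : C := \sum_(k < N) x%:C ^+ k * (beta k - beta k.+1).
  pose B : C := \sum_(k < N) x%:C ^+ k * beta k.
  (* Multiplication by x avoids negative powers. Each of the three terms is at most c in modulus,
     which gives the constant 3c/x. *)
  have xD : x%:C * D = - ((1 - x)%:C * B) + beta 0 - x%:C ^+ N * beta N.
    rewrite /D /B realCB; elim: N {D B} => [|N IH].
      by rewrite !big_ord0 !mulr0 expr0 mul1r oppr0 add0r subrr.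
    by rewrite !big_ord_recr /= !mulrDr IH exprS; ring.
  have hB : nc ((1 - x)%:C * B) <= c.
    rewrite Normc.normcM nc_real ger0_norm ?(ltW y0) //.
    apply: le_trans (_ : (1 - x) * (\sum_(k < N) x ^+ k * c) <= _).
      rewrite ler_wpM2l ?(ltW y0) //; apply: le_trans (nc_sum _ _ _) _; apply: ler_sum => k _.
      by rewrite Normc.normcM ncX nc_real ger0_norm ?(ltW x0) // ler_wpM2l ?exprn_ge0 ?(ltW x0).
    rewrite -mulr_suml mulrA ler_piMl // mulrC -ler_pdivlMr // div1r.
    by apply: geometric_le; rewrite (ltW x0) x1.
  have hD : nc D <= 3 * c / x.
    rewrite ler_pdivlMr // mulrC -[X in X * _](ger0_norm (ltW x0)) -nc_real -Normc.normcM xD.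
    apply: le_trans (le_normcD _ _) _.
    have h1 := le_normcD (- ((1 - x)%:C * B)) (beta 0); rewrite normcN in h1.
    have h2 : nc (- (x%:C ^+ N * beta N)) <= c.
      rewrite normcN Normc.normcM ncX nc_real ger0_norm ?(ltW x0) //.
      apply: le_trans (hbeta N); rewrite ler_piMl ?nc_ge0 // exprn_ile1 // ltW //.
    have h3 := hbeta 0; lra.
  have -> : (1 - x)%:C * (\sum_(k < N) x%:C ^+ k * f k) - e = - (x%:C ^+ N * e) + (1 - x)%:C * D.
    under eq_bigr do rewrite hf mulrDr.
    rewrite big_split /= -mulr_suml mulrDr mulrA realCB geometric_eq -/D; ring.
  apply: le_trans (le_normcD _ _) _; rewrite normcN !Normc.normcM ncX !nc_real.
  rewrite ger0_norm ?(ltW x0) // ger0_norm ?(ltW y0) // lerD2l ler_wpM2l // ltW //.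
have l1 : nc ((1 - x)%:C * (\sum_(k < N) x%:C ^+ k * f k) - e) @[N --> \oo] -->
    nc ((1 - x)%:C * S - e).
  apply: cvg_nc; apply: cvgB; last exact: cvg_cst.
  exact: (cvgM (cvg_cst ((1 - x)%:C : C)) hS).
have l2 : x ^+ N * nc e + (1 - x) * (3 * c / x) @[N --> \oo] --> 0 * nc e + (1 - x) * (3 * c / x).
  apply: cvgD; last exact: cvg_cst.
  apply: cvgM; last exact: cvg_cst.
  by apply: cvg_expr; rewrite ger0_norm // ltW.
rewrite mul0r add0r in l2.
by apply: (ler_cvg_to l1 l2); apply: nearW => N; exact: fin.
Qed.

End Abel.

Section Ergodic.
Variables (R : realType) (d n : nat) (A : 'I_d -> 'M[Cplx R]_n).
Local Notation C := (Cplx R).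
Local Notation nc := (@Normc.normc R).
Local Notation E := (ell2 R d).
Hypothesis Aiso : forall x : 'cV[C]_n,
  \sum_k cdot ((A k) ^t* *m x) ((A k) ^t* *m x) = cdot x x.

Lemma cdot_sumr I (s : seq I) (P : pred I) (a : 'cV[C]_n) (F : I -> 'cV[C]_n) :
  cdot a (\sum_(i <- s | P i) F i) = \sum_(i <- s | P i) cdot a (F i).
Proof. by rewrite /cdot mulmx_sumr summxE. Qed.

Lemma cdotDr (a p q : 'cV[C]_n) : cdot a (p + q) = cdot a p + cdot a q.
Proof. by rewrite /cdot mulmxDr mxE. Qed.

Lemma cdotNr (a p : 'cV[C]_n) : cdot a (- p) = - cdot a p.
Proof. by rewrite /cdot mulmxN mxE. Qed.

Lemma adjmxK (M : 'M[C]_n) : (M ^t*) ^t* = M.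
Proof. by apply/matrixP => i j; rewrite !mxE conjCK. Qed.

Lemma cdot_delta (x : 'cV[C]_n) i : cdot (delta_mx i 0) x = x i 0.
Proof.
rewrite cdotE (bigD1 i) //= big1 ?addr0 => [|l hl].
  by rewrite mxE !eqxx conjC1 mul1r.
by rewrite mxE (negPf hl) conjC0 mul0r.
Qed.

Definition dual_map (Y : 'M[C]_n) : 'M[C]_n := \sum_i (A i) ^t* *m Y *m A i.

(** The k-th iterate of [dual_map], as [dual_powS] shows; it is spelled out over words because its
    boundedness comes from summing over words. *)
Definition dual_pow k (Y : 'M[C]_n) : 'M[C]_n :=
  hsum k (fun u => (wordmx A u) ^t* *m Y *m wordmx A u).

Lemma dual_powS k Y : dual_pow k.+1 Y = dual_map (dual_pow k Y).
Proof.
rewrite /dual_pow hsumSr /dual_map; apply: eq_bigr => i _.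
rewrite {2}/hsum mulmx_sumr mulmx_suml; apply: eq_bigr => u _.
by rewrite -cats1 wordmx_cat wordmx1 trmx_mul map_mxM !mulmxA.
Qed.

Lemma dual_pow0 Y : dual_pow 0 Y = Y.
Proof. by rewrite /dual_pow hsum0 /wordmx big_nil trmx1 map_mx1 mul1mx mulmx1. Qed.

Lemma dual_mapD X Y : dual_map (X + Y) = dual_map X + dual_map Y.
Proof. by rewrite /dual_map -big_split; apply: eq_bigr => i _; rewrite mulmxDr mulmxDl. Qed.

Lemma dual_mapN X : dual_map (- X) = - dual_map X.
Proof. by rewrite /dual_map -sumrN; apply: eq_bigr => i _; rewrite mulmxN mulNmx. Qed.

Lemma dual_powD k X Y : dual_pow k (X + Y) = dual_pow k X + dual_pow k Y.
Proof. by elim: k => [|k IH]; rewrite ?dual_pow0 // !dual_powS IH dual_mapD. Qed.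

Lemma dual_powN k X : dual_pow k (- X) = - dual_pow k X.
Proof. by elim: k => [|k IH]; rewrite ?dual_pow0 // !dual_powS IH dual_mapN. Qed.

Lemma dual_powSr k Y : dual_pow k.+1 Y = dual_pow k (dual_map Y).
Proof.
elim: k => [|k IH]; first by rewrite dual_powS !dual_pow0.
by rewrite dual_powS IH -dual_powS.
Qed.

Lemma dual_pow_form k Y p q :
  cdot q (dual_pow k Y *m p) =
  hsum k (fun u => cdot (wordmx A u *m q) (Y *m (wordmx A u *m p))).
Proof.
rewrite /dual_pow /hsum mulmx_suml cdot_sumr; apply: eq_bigr => u _.
by rewrite -!mulmxA cdot_adj adjmxK.
Qed.

(** Each summand is dominated by terms |Y_ij| |(A^u q)_i| |(A^u p)_j|. The products are at most sums
    of squares, and [hsum_rowf] bounds these by the same constant in every degree. *)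
Lemma dual_pow_bounded Y p q : exists c : R, forall k, nc (cdot q (dual_pow k Y *m p)) <= c.
Proof.
pose c i : R := sq2 (delta_mx i 0 : 'cV[C]_n).
exists (\sum_i \sum_j nc (Y i j) * (c i * norm1 q ^+ 2 + c j * norm1 p ^+ 2)) => k.
have rowE u i (v : 'cV[C]_n) : (wordmx A u *m v) i 0 = rowf A (delta_mx i 0) u v.
  by rewrite /rowf cdot_delta.
rewrite dual_pow_form.
apply: le_trans (_ : hsum k (fun u => nc (cdot (wordmx A u *m q) (Y *m (wordmx A u *m p)))) <= _).
  exact: nc_sum.
apply: le_trans (_ : hsum k (fun u => \sum_i \sum_j nc (Y i j) *
    (nc (rowf A (delta_mx i 0) u q) ^+ 2 + nc (rowf A (delta_mx j 0) u p) ^+ 2)) <= _).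
  apply: le_hsum => u _; rewrite cdotE; apply: le_trans (nc_sum _ _ _) _.
  apply: ler_sum => i _; rewrite [(Y *m _) _ _]mxE mulr_sumr; apply: le_trans (nc_sum _ _ _) _.
  apply: ler_sum => j _; rewrite !rowE !Normc.normcM nc_conj mulrCA ler_wpM2l ?nc_ge0 //.
  have := nc_ge0 (rowf A (delta_mx i 0) u q); have := nc_ge0 (rowf A (delta_mx j 0) u p).
  move: (nc (rowf _ _ _ _)) (nc (rowf _ _ _ _)) => s t; nra.
rewrite hsum_sum; apply: ler_sum => i _; rewrite hsum_sum; apply: ler_sum => j _.
by rewrite hsum_mull ler_wpM2l ?nc_ge0 // hsumD; apply: lerD; exact: hsum_rowf.
Qed.

Lemma dual_entry (X : 'M[C]_n) i j : cdot (delta_mx i 0) (X *m delta_mx j 0) = X i j.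
Proof. by rewrite cdot_delta -colE mxE. Qed.

(** The k-th iterate sends W to W - kV, which stays bounded only if V = 0. *)
Lemma dual_no_jordan V W : dual_map V = V -> dual_map W = W - V -> V = 0.
Proof.
move=> hV hW.
have hk k : dual_pow k W = W - V *+ k.
  elim: k => [|k IH]; first by rewrite dual_pow0 mulr0n subr0.
  rewrite dual_powS IH dual_mapD dual_mapN hW mulrSr opprD addrA addrAC; congr (_ - _ - _).
  elim: k {IH} => [|k IH]; first by rewrite mulr0n /dual_map big1 // => i _;
    rewrite mulmx0 mul0mx.
  by rewrite !mulrSr dual_mapD IH hV.
apply/matrixP => i j; rewrite mxE; apply: Normc.eq0_normc.
have [c hc] := dual_pow_bounded W (delta_mx j 0) (delta_mx i 0).
apply/eqP; apply: contraT => hn.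
have vp : 0 < nc (V i j) by rewrite lt0r hn nc_ge0.
have h0 : 0 <= (c + nc (W i j)) / nc (V i j).
  rewrite divr_ge0 ?nc_ge0 // addr_ge0 ?nc_ge0 //.
  by apply: le_trans (hc 0); exact: nc_ge0.
have hb := archi_boundP h0; move: (Num.bound _) hb => k hb.
have := hc k; rewrite dual_entry hk.
have -> : (W - V *+ k) i j = W i j - V i j *+ k by rewrite mxE [X in _ + X]mxE mulmxnE.
move=> h; have h3 := le_normcD (- (W i j - V i j *+ k)) (W i j).
rewrite normcN opprB subrK in h3.
move: hb; rewrite ltr_pdivrMr // mulr_natl -normcMn; lra.
Qed.

(** [dual_map] becomes a square matrix M acting on vectorised matrices, so that
    [fixed_range_decomposition] applies. *)
Lemma dual_decomposition Y : exists P B : 'M[C]_n, Y = P + (B - dual_map B) /\ dual_map P = P.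
Proof.
pose M : 'M[R[i]]_(n * n) := \sum_i (lin_mulmx ((A i) ^t*) *m lin_mulmxr (A i)).
have hM (X : 'M[R[i]]_n) : mxvec X *m M = mxvec (dual_map X).
  rewrite /M mulmx_sumr /dual_map linear_sum; apply: eq_bigr => i _.
  by rewrite mulmxA mul_vec_lin mul_vec_lin.
have hM' (x : 'rV[R[i]]_(n * n)) : vec_mx (x *m M) = dual_map (vec_mx x).
  by rewrite -{1}[x]vec_mxK hM mxvecK.
have [] := fixed_range_decomposition (M := M) _ (mxvec Y).
  move=> w v hv hw; apply: (can_inj vec_mxK); rewrite linear0.
  apply: (dual_no_jordan (W := vec_mx w)); first by rewrite -hM' hv.
  by rewrite -hM' hw linearB.
move=> a [b [hY ha]]; exists (vec_mx a), (vec_mx b); split.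
  by have := congr1 vec_mx hY; rewrite mxvecK linearD linearB => ->; congr (_ + (_ - _));
    exact: hM'.
by rewrite -hM' ha.
Qed.

Lemma ip_szego_series (y p q : 'cV[C]_n) (z w : C) : nc z < 1 -> nc w < 1 ->
  \sum_(k < N) (z * w^*) ^+ k * hsum k (fun u => rowf A y u p * (rowf A y u q)^*)
    @[N --> \oo] --> ip (szego A y z p) (szego A y w q).
Proof.
move=> hz hw.
have h := dot_cvg (szego_fps_H2 Aiso y p hz) (szego_fps_H2 Aiso y q hw).
have -> : ip (szego A y z p) (szego A y w q) = dot (szego_fps A y z p) (szego_fps A y w q).
  exact: (congr2 (@dot R d) (szegoE Aiso y p hz) (szegoE Aiso y q hw)).
apply: (eq_cvgr (U := C) _ h) => N.
apply: eq_bigr => k _.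
rewrite -hsum_mull.
apply: eq_hsum => u hu.
rewrite /szego_fps conjCK hu conjCM conjCX exprMn.
ring.
Qed.

(** Write y y^* = P + (B - Psi B) with Psi P = P. The k-th coefficient is then q^* P p + beta_k -
    beta_{k+1} with beta_k = q^* Psi^k[B] p bounded, as [abel_telescope] requires; its factor 3
    reappears in the constant. *)
Lemma abel_limit (y p q : 'cV[C]_n) : exists (e : C) (c : R), 0 <= c /\
  forall z w (x : R), nc z < 1 -> nc w < 1 -> z * w^* = x%:C -> 0 < x < 1 ->
  nc ((1 - x)%:C * ip (szego A y z p) (szego A y w q) - e) <= (1 - x) * (c / x).
Proof.
have [P [B [hY hP]]] := dual_decomposition (y *m y ^t*).
have [c hc] := dual_pow_bounded B p q.
have c0 : 0 <= c by apply: le_trans (hc 0); exact: nc_ge0.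
exists (cdot q (P *m p)), (3 * c); split; first by rewrite mulr_ge0.
move=> z w x hz hw zw x01.
pose f k := hsum k (fun u => rowf A y u p * (rowf A y u q)^*).
apply: (abel_telescope (beta := fun k => cdot q (dual_pow k B *m p)) (f := f)) => //.
- move=> k.
  have -> : f k = cdot q (dual_pow k (y *m y ^t*) *m p).
    rewrite dual_pow_form; apply: eq_hsum => u _.
    have -> : y *m y^t* *m (wordmx A u *m p) = rowf A y u p *: y.
      by rewrite -mulmxA [y ^t* *m _]mx11_scalar mul_mx_scalar.
    rewrite cdotZ; congr (_ * _); rewrite /rowf !cdotE conjC_sum; apply: eq_bigr => i _.
    by rewrite conjCM conjCK mulrC.
  have hPk : dual_pow k P = P by elim: k => [|k IH]; rewrite ?dual_pow0 // dual_powS IH.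
  rewrite {1}hY !dual_powD dual_powN -dual_powSr hPk !mulmxDl mulNmx.
  by rewrite !cdotDr cdotNr.
- rewrite -zw; exact: ip_szego_series.
Qed.

End Ergodic.

(** * Rationality at the boundary *)

Section PowerSeries.
Variable R : realType.
Local Notation C := (Cplx R).
Local Notation nc := (@Normc.normc R).

(** Bounded coefficients are enough for the identity theorem below and are preserved by
    multiplication with a polynomial. *)
Definition bounded_series (g : C -> C) := exists (a : nat -> C) (c : R),
  (forall k, nc (a k) <= c) /\
  forall z, nc z < 1 -> \sum_(k < N) a k * z ^+ k @[N --> \oo] --> g z.

Lemma bounded_series_lin (s : C) g h : bounded_series g -> bounded_series h ->
  bounded_series (fun z => s * g z + h z).
Proof.
move=> [a [c [ha hg]]] [a' [c' [ha' hh]]].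
exists (fun k => s * a k + a' k), (nc s * c + c'); split=> [k|z hz].
  apply: le_trans (le_normcD _ _) _; rewrite Normc.normcM lerD // ler_wpM2l ?nc_ge0 //.
apply: (cvgC_eq (cvgCD (cvgCZ (c := s) (hg z hz)) (hh z hz))) => // N.
rewrite mulr_sumr -big_split; apply: eq_bigr => k _.
by rewrite mulrDl mulrA.
Qed.

Lemma bounded_series_mulX g : bounded_series g -> bounded_series (fun z => z * g z).
Proof.
move=> [a [c [ha hg]]].
exists (fun k => if k is j.+1 then a j else 0), c; split=> [[|k]|z hz] //.
  by rewrite Normc.normc0; apply: le_trans (ha 0); exact: nc_ge0.
rewrite -cvg_shiftS; apply: (cvgC_eq (cvgCZ (c := z) (hg z hz))) => // N.
rewrite big_ord_recl mul0r add0r mulr_sumr; apply: eq_bigr => k _.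
by rewrite /= exprS mulrCA.
Qed.

Lemma bounded_series_cst (s : C) : bounded_series (fun=> s).
Proof.
exists (fun k => if k is 0 then s else 0), (nc s); split=> [[|k]|z hz] //.
  by rewrite Normc.normc0 nc_ge0.
rewrite -cvg_shiftS; apply: (cvgC_eq (f := fun=> s) (cvg_cst _)) => // N.
rewrite big_ord_recl expr0 mulr1 big1 ?addr0 // => k _.
by rewrite mul0r.
Qed.

Lemma bounded_series_poly (p : {poly R[i]}) g : bounded_series g ->
  bounded_series (fun z => p.[z] * g z).
Proof.
move=> hg; elim/poly_ind: p => [|p s IH].
  have -> : (fun z : C => (0 : {poly R[i]}).[z] * g z) = fun=> 0.
    by apply/funext => z; rewrite horner0 mul0r.
  exact: bounded_series_cst.
have -> : (fun z : C => (p * 'X + s%:P).[z] * g z) = (fun z : C => s * g z + z * (p.[z] * g z)).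
  by apply/funext => z; rewrite hornerMXaddC; ring.
exact: (bounded_series_lin s hg (bounded_series_mulX IH)).
Qed.

(** For t < 1/2 the terms of positive degree add up to at most c t/(1 - t), hence to at most 2ct. So
    |a_0| is at most 2ct, and t tends to 0. *)
Lemma first_coef_eq0 (dl : R) (a : nat -> C) (c : R) : 0 < dl ->
  (forall k, nc (a k) <= c) ->
  (forall t : R, 0 < t < dl -> \sum_(k < N) a k * t%:C ^+ k @[N --> \oo] --> (0 : C)) ->
  a 0 = 0.
Proof.
move=> dl0 ha hg.
have c0 : 0 <= c by apply: le_trans (ha 0); exact: nc_ge0.
have key t : 0 < t < Num.min dl 2^-1 -> nc (a 0) <= (2 * c) * t.
  rewrite lt_min => /and3P[t0 td t2].
  have t1 : t < 1 by apply: lt_trans t2 _; rewrite invf_lt1 // ltr1n.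
  have hN N : nc (a 0) <= nc (\sum_(k < N.+1) a k * t%:C ^+ k) + (2 * c) * t.
    rewrite big_ord_recl expr0 mulr1.
    set T := \sum_(i < N) _.
    have hT : nc T <= 2 * c * t.
      apply: le_trans (nc_sum _ _ _) _.
      apply: le_trans (_ : \sum_(k < N) t * c * t ^+ k <= _).
        apply: ler_sum => k _; rewrite Normc.normcM ncX nc_real ger0_norm ?(ltW t0) //.
        rewrite /= exprS mulrA [t * c]mulrC ler_wpM2r ?exprn_ge0 ?(ltW t0) //.
        by rewrite ler_wpM2r ?(ltW t0).
      have geo : \sum_(k < N) t ^+ k <= 2.
        apply: le_trans (geometric_le N _) _; first by rewrite (ltW t0) t1.
        by rewrite -[leRHS]invrK lef_pV2 ?posrE ?invr_gt0 ?subr_gt0 //; lra.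
      rewrite -mulr_sumr; apply: le_trans (ler_wpM2l _ geo) _; last by lra.
      by rewrite mulr_ge0 // ltW.
    have h := le_normcD (a 0 + T) (- T); rewrite addrK normcN in h; lra.
  have h1 : nc (\sum_(k < N.+1) a k * t%:C ^+ k) + (2 * c) * t @[N --> \oo] --> 0 + (2 * c) * t.
    apply: cvgD; last exact: cvg_cst.
    have h2 : \sum_(k < N.+1) a k * t%:C ^+ k @[N --> \oo] --> (0 : C).
      by rewrite (cvg_shiftS (fun N => \sum_(k < N) a k * t%:C ^+ k : C)); apply: hg;
        rewrite t0.
    have e0 : nc (0 : C) = 0 by exact: Normc.normc0.
    by rewrite -[X in _ --> X]e0; exact: (cvg_nc h2).
  rewrite add0r in h1.
  by apply: (cvgr_to_ge h1); apply: nearW => N; exact: hN.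
apply: Normc.eq0_normc; apply/le_anti; rewrite nc_ge0 andbT.
have h2 : (2 * c) * t @[t --> (0 : R)^'+] --> (2 * c) * 0.
  apply: cvgM; first exact: cvg_cst.
  by apply: cvg_at_right_filter; exact: cvg_id.
rewrite mulr0 in h2; apply: (cvgr_to_ge h2).
near=> t; apply: key; apply/andP; split; near: t; first exact: nbhs_right_gt.
by apply: nbhs_right_lt; rewrite lt_min dl0 invr_gt0 /=.
Unshelve. all: by end_near. Qed.

(** Once a_0 = 0, the series can be divided by t > 0 and the shifted coefficients satisfy the same
    hypotheses. *)
Lemma power_series_eq0 (dl : R) (m : nat) (a : nat -> C) (c : R) : 0 < dl ->
  (forall k, nc (a k) <= c) ->
  (forall t : R, 0 < t < dl -> \sum_(k < N) a k * t%:C ^+ k @[N --> \oo] --> (0 : C)) ->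
  a m = 0.
Proof.
move=> dl0; elim: m a => [|m IH] a ha hg; first exact: (first_coef_eq0 dl0 ha hg).
have a0 := first_coef_eq0 dl0 ha hg.
apply: (IH (fun k => a k.+1)) => // t ht.
have t0 : t%:C != 0 :> C by rewrite (inj_eq (@complexI R)) gt_eqF //; case/andP: ht.
have h1 := hg t ht; rewrite -cvg_shiftS in h1.
apply: (cvgC_eq (cvgCZ (c := (t%:C)^-1) h1)); rewrite ?mulr0 // => N.
rewrite big_ord_recl a0 mul0r add0r mulr_sumr; apply: eq_bigr => k _.
by rewrite /= exprS mulrCA mulKf.
Qed.

Lemma bounded_series_eq0 (dl : R) g : 0 < dl -> bounded_series g ->
  (forall t : R, 0 < t < dl -> g t%:C = 0) -> forall z, nc z < 1 -> g z = 0.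
Proof.
move=> dl0 [a [c [ha hg]]] h0 z hz.
have d1 : 0 < Num.min dl 1 by rewrite lt_min dl0 ltr01.
have a0 m : a m = 0.
  apply: (power_series_eq0 m d1 ha) => t; rewrite lt_min => /and3P[t0 td t1].
  have ht : nc t%:C < 1 by rewrite nc_real ger0_norm // ltW.
  by have := hg _ ht; rewrite (h0 t) ?t0.
have h := hg z hz.
apply: (cvg_unique (@norm_hausdorff _ C) h).
apply: (cvgC_eq (f := fun=> 0) (cvg_cst _)) => // N.
by rewrite big1 // => k _; rewrite a0 mul0r.
Qed.

End PowerSeries.

Section Rational.
Variables (R : realType) (d n : nat).
Local Notation C := (Cplx R).
Local Notation nc := (@Normc.normc R).
Local Notation F := R[i].

(** On the line through Z, an expression is a polynomial matrix over one scalar polynomial q. The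
    denominator also controls the domain: q(z) nonzero guarantees that the expression is defined at
    zZ, and definedness at Z gives q(1) nonzero. *)
Lemma ncexpr_line (s : ncexpr R d) (Z : 'I_d -> 'M[C]_n) (M : 'M[C]_n) :
  ncexpr_eval Z s = Some M ->
  exists (P : 'M[{poly F}]_n) (q : {poly F}), q.[1] != 0 /\
    forall z : F, q.[z] != 0 -> exists2 N : 'M[F]_n,
      ncexpr_eval (fun k => (z : C) *: Z k) s = Some (N : 'M[C]_n) &
      q.[z] *: N = map_mx (horner_eval z) P.
Proof.
elim: s M => [k|c|s1 IH1 s2 IH2|s1 IH1 s2 IH2|s1 IH1] M /=.
- move=> _; exists (\matrix_(i, j) ((Z k i j : F)%:P * 'X)), 1; rewrite hornerC oner_neq0.
  split=> // z _; exists (z *: (Z k : 'M[F]_n)) => //.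
  by rewrite hornerC scale1r; apply/matrixP => i j;
    rewrite !mxE /horner_eval hornerMX hornerC mulrC.
- move=> _; exists (c%:P)%:M, 1; rewrite hornerC oner_neq0.
  split=> // z _; exists (c%:M) => //.
  rewrite hornerC scale1r; apply/matrixP => i j; rewrite !mxE /horner_eval hornerMn hornerC //.
- case e1 : (ncexpr_eval Z s1) => [M1|//]; case e2 : (ncexpr_eval Z s2) => [M2|//] _.
  have [P1 [q1 [q11 h1]]] := IH1 _ e1; have [P2 [q2 [q21 h2]]] := IH2 _ e2.
  exists (q2 *: P1 + q1 *: P2), (q1 * q2); rewrite hornerM mulf_neq0 //; split=> // z.
  rewrite hornerM mulf_eq0 negb_or => /andP[hz1 hz2].
  have [N1 -> g1] := h1 z hz1; have [N2 -> g2] := h2 z hz2; exists (N1 + N2) => //.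
  rewrite map_mxD !map_mxZ -g1 -g2 /horner_eval !scalerA scalerDr; congr (_ + _).
  by rewrite mulrC.
- case e1 : (ncexpr_eval Z s1) => [M1|//]; case e2 : (ncexpr_eval Z s2) => [M2|//] _.
  have [P1 [q1 [q11 h1]]] := IH1 _ e1; have [P2 [q2 [q21 h2]]] := IH2 _ e2.
  exists (P1 *m P2), (q1 * q2); rewrite hornerM mulf_neq0 //; split=> // z.
  rewrite hornerM mulf_eq0 negb_or => /andP[hz1 hz2].
  have [N1 -> g1] := h1 z hz1; have [N2 -> g2] := h2 z hz2; exists (N1 *m N2) => //.
  by rewrite map_mxM -g1 -g2 -scalemxAl -scalemxAr scalerA.
- case e1 : (ncexpr_eval Z s1) => [M1|//]; case: ifP => // M1u _.
  have [P1 [q1 [q11 h1]]] := IH1 _ e1.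
  have hdet z : (\det P1).[z] = \det (map_mx (horner_eval z) P1) by rewrite det_map_mx.
  have det1 : (\det P1).[1] != 0.
    have [N1] := h1 1 q11.
    have -> : (fun k => (1 : C) *: Z k) = Z by apply/funext => k; rewrite scale1r.
    rewrite e1 => -[<-] g1.
    have hM : \det (M1 : 'M[F]_n) != 0.
      rewrite -unitfE; exact: M1u.
    rewrite hdet -g1 detZ; apply: mulf_neq0 => //; exact: expf_neq0.
  (* The inverse of P1/q1 is q1 adj(P1)/det(P1). The additional factor q1 in numerator and
     denominator keeps q1(z) nonzero, so that the inverted expression is itself defined at z. *)
  exists (q1 ^+ 2 *: \adj P1), (q1 * \det P1); rewrite hornerM mulf_neq0 //; split=> // z.
  rewrite hornerM mulf_eq0 negb_or => /andP[hz1 hzd].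
  have [N1 -> g1] := h1 z hz1.
  have N1u : N1 \in unitmx.
    rewrite unitmxE unitfE; apply: contra hzd => /eqP hN.
    by rewrite hdet -g1 detZ hN mulr0.
  exists (invmx N1); first by rewrite N1u.
  have hA : N1 *m (q1.[z] *: map_mx (horner_eval z) (\adj P1)) = ((\det P1).[z])%:M.
    by rewrite -scalemxAr scalemxAl g1 map_mx_adj mul_mx_adj -hdet.
  have hB : q1.[z] *: map_mx (horner_eval z) (\adj P1) = (\det P1).[z] *: invmx N1.
    by rewrite -[LHS](mulKmx N1u) hA mul_mx_scalar.
  by rewrite map_mxZ [X in _ = X *: _]rmorphXn /= expr2 -scalerA hB scalerA.
Qed.

End Rational.

Section Boundary.
Variables (R : realType) (d n : nat) (A : 'I_d -> 'M[Cplx R]_n).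
Local Notation C := (Cplx R).
Local Notation nc := (@Normc.normc R).
Hypothesis Aiso : forall x : 'cV[C]_n,
  \sum_k cdot ((A k) ^t* *m x) ((A k) ^t* *m x) = cdot x x.

(** A product |b_u| |A^u_ij| is at most the sum of the squares; in each degree the first squares are
    bounded by the norm of b, the second by co-isometry. *)
Lemma bt_entry_series (b : fps R d) i j : H2 b ->
  exists g : C -> C, bounded_series g /\ forall z, nc z < 1 -> g z = bt A b z i j.
Proof.
move=> hb; have hu := H2_Ut hb.
exists (fun z => bt A b z i j); split=> //.
pose c := complex.Re (dot (Ut b) (Ut b)) +
  sq2 (delta_mx i 0 : 'cV[C]_n) * norm1 (delta_mx j 0 : 'cV[C]_n) ^+ 2.
exists (fun k => hsum k (fun u => Ut b u * wordmx A u i j)), c; split=> [k|z hz].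
  apply: le_trans (_ : hsum k (fun u => nc (Ut b u * wordmx A u i j)) <= _).
    exact: nc_sum.
  apply: le_trans (_ : hsum k (fun u => nc (Ut b u) ^+ 2 +
      nc (rowf A (delta_mx i 0) u (delta_mx j 0)) ^+ 2) <= _).
    apply: le_hsum => u _; rewrite Normc.normcM /rowf dual_entry.
    have := nc_ge0 (Ut b u); have := nc_ge0 (wordmx A u i j).
    move: (nc (Ut b u)) (nc (wordmx A u i j)) => s t; nra.
  rewrite hsumD; apply: lerD; last exact: hsum_rowf.
  apply: le_trans (psum_le_dot_sq k.+1 hu); rewrite psumS lerDr.
  by apply: psum_ge0 => w; exact: sqr_ge0.
apply: (cvgC_eq (fps_eval_cvg (i := i) (j := j) Aiso hz hu)) => // N.
apply: eq_bigr => k _; rewrite -hsum_mulr; apply: eq_hsum => u hk.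
by rewrite wordmx_scale mxE hk mulrCA [RHS]mulrC.
Qed.

(** Transposing a product reverses the word, as [Ut] does. This links b at the transposed tuple,
    where the eigenvector is given, with b^t at A, which acts on the kernels. *)
Lemma fps_eval_tr (b : fps R d) z :
  fps_eval b (fun k => z *: (A k)^T) = (bt A b z)^T.
Proof.
apply/matrixP => i j; rewrite !mxE !wsumE; congr (limn _); apply/funext => N.
rewrite -psum_rev; apply: eq_psum => w _; congr (_ * _).
have -> : (fun k => z *: (A k)^T) = (fun k => (z *: A k)^T).
  by apply/funext => k; apply/matrixP => p q; rewrite !mxE.
by rewrite wordmx_tr mxE.
Qed.

(** Co-isometry controls the row of the A_k but not that of their transposes, so only small
    multiples of the latter are sure to lie in the row ball, where b is known to equal its rational
    expression. *)
Lemma row_ball_small : exists2 dl : R, 0 < dl &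
  forall t : R, 0 < t < dl -> row_ball (fun k => t%:C *: (A k)^T).
Proof.
pose K : R := \sum_k \sum_i (\sum_j nc (A k i j)) ^+ 2.
have K0 : 0 <= K by apply: sumr_ge0 => k _; apply: sumr_ge0 => i _; exact: sqr_ge0.
exists (1 + K)^-1; first by rewrite invr_gt0 ltr_pwDl.
move=> t /andP[t0 td] x x0.
have tK : t * (1 + K) < 1 by rewrite -ltr_pdivlMr ?ltr_pwDl // div1r.
have t1 : t < 1 by apply: le_lt_trans tK; rewrite ler_peMr ?(ltW t0) // lerDl.
have xp : 0 < sq2 x.
  rewrite lt0r sq2_ge0 andbT; apply: contra x0 => /eqP h.
  apply/eqP/matrixP => i j; rewrite ord1 mxE; apply: Normc.eq0_normc; apply/eqP.
  rewrite -sqrf_eq0; apply/eqP/le_anti; rewrite sqr_ge0 andbT -h /sq2 (bigD1 i) //= lerDl.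
  by apply: sumr_ge0 => l _; exact: sqr_ge0.
pose Z k : 'M[C]_n := t%:C *: (A k)^T.
have hE : cdot x ((1%:M - \sum_k Z k *m (Z k) ^t*) *m x) =
    (sq2 x - \sum_k sq2 ((Z k) ^t* *m x))%:C.
  rewrite mulmxBl mul1mx cdotDr cdotNr mulmx_suml cdot_sumr realCB cdot_xx; congr (_ - _).
  rewrite rmorph_sum; apply: eq_bigr => k _.
  by rewrite -mulmxA cdot_adj cdot_xx.
rewrite hE ltcR subr_gt0.
have bound k : sq2 ((Z k) ^t* *m x) <= t ^+ 2 * (\sum_i (\sum_j nc (A k i j)) ^+ 2 * sq2 x).
  rewrite mulr_sumr; apply: ler_sum => i _.
  pose a : 'cV[C]_n := \col_j A k i j.
  have -> : ((Z k) ^t* *m x) i 0 = t%:C * (cdot x a)^*.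
    rewrite cdotE conjC_sum mulr_sumr mxE; apply: eq_bigr => j _.
    by rewrite !mxE !conjCM conjCK conjC_r; ring.
  rewrite Normc.normcM nc_real nc_conj exprMn (ger0_norm (ltW t0)) ler_wpM2l ?sqr_ge0 //.
  apply: le_trans (cdot_bound _ _) _; rewrite mulrC ler_wpM2r ?sq2_ge0 //.
  have -> // : norm1 a = \sum_j nc (A k i j).
  by apply: eq_bigr => j _; rewrite mxE.
apply: le_lt_trans (ler_sum _ (fun k _ => bound k)) _.
rewrite -mulr_sumr; under eq_bigr do rewrite -mulr_suml.
rewrite -mulr_suml -/K mulrA -[ltRHS]mul1r ltr_pM2r //.
have h1 : t * K <= t * (1 + K) by rewrite ler_wpM2l ?(ltW t0) // lerDr.
have h2 : t ^+ 2 * K <= t * K by rewrite ler_wpM2r // expr2 ler_piMr // ltW.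
lra.
Qed.

(** The identity of q(z) b(z) with a polynomial matrix spreads from a short real interval to the
    disc by uniqueness of power series. The numerator of b(z)v - zeta v is then a polynomial that
    vanishes at 1. *)
Lemma rational_boundary (b : fps R d) (r : ncexpr R d) (M : 'M[C]_n) (v : 'cV[C]_n) (zeta : C) :
  H2 b -> ncrat_represents r b -> ncrat_graph r (fun k => (A k)^T) M ->
  M^T *m v = zeta *: v ->
  exists (U : 'I_n -> {poly R[i]}) (q : {poly R[i]}), q.[1] != 0 /\
    forall z : C, nc z < 1 -> q.[z] != 0 ->
      forall i, q.[z] * ((bt A b z *m v) i 0 - zeta * v i 0) = (1 - z) * (U i).[z].
Proof.
move=> hb hr [s hrs hs] hv.
have [P [q [q1 hP]]] := ncexpr_line hs.
have [dl dl0 hdl] := row_ball_small.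
have key z i j : nc z < 1 -> q.[z] != 0 -> q.[z] * bt A b z j i = (P i j).[z].
  move=> hz hq; have [f [fs hf]] := bt_entry_series j i hb.
  (* The outer factor q makes g vanish also at zeros of q, where the expression may be undefined; g
     is thus 0 on a whole interval. *)
  pose g w := q.[w] * (q.[w] * f w + - 1 * (P i j).[w]).
  have gs : bounded_series g.
    apply: bounded_series_poly.
    have -> : (fun w : C => q.[w] * f w + - 1 * (P i j).[w]) =
      (fun w : C => - 1 * ((P i j).[w] * 1) + q.[w] * f w).
      by apply/funext => w; rewrite addrC mulr1.
    apply: (bounded_series_lin (- 1 : C)); last exact: bounded_series_poly.
    exact: (bounded_series_poly _ (bounded_series_cst (1 : C))).
  have d1 : 0 < Num.min dl 1 by rewrite lt_min dl0 ltr01.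
  have g0 := bounded_series_eq0 d1 gs.
  have : g z = 0.
    apply: g0 hz => t; rewrite lt_min => /and3P[t0 td t1].
    have [q0|qt] := eqVneq q.[t%:C] 0; first by rewrite /g q0 mul0r.
    have ht : nc t%:C < 1 by rewrite nc_real ger0_norm // ltW.
    have [N hN eN] := hP _ qt.
    have t0d : 0 < t < dl by rewrite t0.
    have [_ hgr] := hr _ _ (hdl t t0d).
    have e1 : N = fps_eval b (fun k => (t%:C : C) *: (A k)^T) by apply: hgr; exists s.
    rewrite /g hf //; have -> : q.[t%:C] * bt A b t%:C j i = (P i j).[t%:C].
      have := congr1 (fun X : 'M[R[i]]_n => X i j) eN; rewrite e1 fps_eval_tr mxE mxE => ->.
      by rewrite mxE.
    by rewrite mulN1r subrr mulr0.
  rewrite /g hf // mulN1r => /eqP; rewrite mulf_eq0 (negPf hq) /= subr_eq0 => /eqP.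
  exact.
pose Nq i : {poly R[i]} := \sum_j (v j 0)%:P * P j i - (zeta * v i 0)%:P * q.
have hNq i (z : R[i]) : (Nq i).[z] = \sum_j v j 0 * (P j i).[z] - zeta * v i 0 * q.[z].
  rewrite /Nq hornerD hornerN hornerM hornerC horner_sum; congr (_ - _).
  by apply: eq_bigr => j _; rewrite hornerM hornerC.
(* At z = 1 the expression takes the value M, and the eigenvector equation makes the numerator
   vanish. *)
have N1 i : root (Nq i) 1.
  have [N hN eN] := hP 1 q1.
  have e1 : (fun k => (1 : C) *: (A k)^T) = (fun k => (A k)^T) by apply/funext => k;
    rewrite scale1r.
  rewrite e1 hs in hN; case: hN => hN.
  apply/rootP; rewrite hNq.
  have hv' := congr1 (fun X : 'cV[C]_n => X i 0) hv.
  rewrite !mxE in hv'; rewrite -hv' mulr_suml -sumrB big1 // => j _.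
  have := congr1 (fun X : 'M[R[i]]_n => X j i) eN; rewrite /= !mxE -hN /horner_eval => <-.
  ring.
have hU i : exists U : {poly R[i]}, Nq i = U * (1 - 'X).
  have /factor_theorem [U hU] := N1 i; exists (- U).
  by rewrite hU -[in RHS](opprB 'X 1) mulrNN polyC1.
have [U hU'] := choice hU.
exists U, q; split=> // z hz hq i.
transitivity (Nq i).[z].
  rewrite hNq mulrBr; congr (_ - _); last by rewrite mulrC.
  rewrite mxE mulr_sumr; apply: eq_bigr => j _.
  by rewrite mulrA key // mulrC.
by rewrite hU' hornerM hornerD hornerN hornerC hornerX mulrC.
Qed.

End Boundary.

(** * Convergence of the kernels *)

Lemma cvg_horner (R : realType) (p : {poly R[i]}) (T : Type) (F : set_system T)
    {FF : Filter F} (f : T -> Cplx R) (l : Cplx R) :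
  f x @[x --> F] --> l -> (p.[f x] : Cplx R) @[x --> F] --> (p.[l] : Cplx R).
Proof.
move=> hf; elim/poly_ind: p => [|p c IH].
  apply: (cvgC_eq (f := fun=> 0) (cvg_cst _)); first by rewrite horner0.
  by move=> x; rewrite horner0.
apply: (cvgC_eq (cvgCD (cvgCM IH hf) (cvg_cst (c : Cplx R)))).
  by rewrite hornerMXaddC.
by move=> x; rewrite hornerMXaddC.
Qed.

(* [G z p w p'] stands for the inner product of the Szego kernels at [z A] and [w A]
   in the directions [p] and [p'], and [D z w] for that of the de Branges-Rovnyak
   kernels in the direction [v]. They are kept abstract because unification unfolds
   the concrete inner products down to series. *)
Section GramLimit.
Variables (R : realType) (n : nat).
Local Notation C := (Cplx R).
Local Notation nc := (@Normc.normc R).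
Variables (G : C -> 'cV[C]_n -> C -> 'cV[C]_n -> C) (D : C -> C -> C).
Variables (bv : C -> 'cV[C]_n) (v : 'cV[C]_n) (zeta : C).
Variables (U : 'I_n -> {poly R[i]}) (q : {poly R[i]}).
Hypothesis Gsym : forall z w p p', G w p' z p = (G z p w p')^*.
Hypothesis Gsum : forall z w p p', nc z < 1 ->
  G z p w p' = \sum_i p i 0 * G z (delta_mx i 0) w p'.
Hypothesis Gabel : forall p p', exists (e : C) (c : R), 0 <= c /\
  forall z w (x : R), nc z < 1 -> nc w < 1 -> z * w^* = x%:C -> 0 < x < 1 ->
  nc ((1 - x)%:C * G z p w p' - e) <= (1 - x) * (c / x).
Hypothesis Ddef : forall z w, nc z < 1 -> nc w < 1 ->
  D z w = G z v w v - G z (bv z) w (bv w).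
Hypothesis Dpos : forall z, nc z < 1 -> 0 <= D z z.
Hypothesis zeta1 : zeta * zeta^* = 1.
Hypothesis q1 : q.[1] != 0.
Hypothesis bv_eigen : forall z : C, nc z < 1 -> q.[z] != 0 ->
  forall i, q.[z] * (bv z i 0 - zeta * v i 0) = (1 - z) * (U i).[z].

Lemma gram_combl z w (c c' : C) p p' x : nc z < 1 ->
  G z (c *: p + c' *: p') w x = c * G z p w x + c' * G z p' w x.
Proof.
move=> hz; rewrite !(Gsum _ _ _ hz) !mulr_sumr -big_split; apply: eq_bigr => i _ /=.
have -> : (c *: p + c' *: p') i 0 = c * p i 0 + c' * p' i 0 by rewrite !mxE.
ring.
Qed.

Lemma gram_combr z w (c c' : C) p p' x : nc w < 1 ->
  G z x w (c *: p + c' *: p') = c^* * G z x w p + c'^* * G z x w p'.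
Proof.
by move=> hw; rewrite Gsym gram_combl // conjCD !conjCM -!Gsym.
Qed.

Lemma gram_sumr z w p p' : nc w < 1 ->
  G z p w p' = \sum_i (p' i 0)^* * G z p w (delta_mx i 0).
Proof.
move=> hw; rewrite Gsym Gsum // conjC_sum; apply: eq_bigr => i _.
by rewrite conjCM -Gsym.
Qed.

Definition uvec (z : C) : 'cV[C]_n := \col_i ((U i).[z] / q.[z]).

Lemma bv_uvec z : nc z < 1 -> q.[z] != 0 -> bv z = zeta *: v + (1 - z) *: uvec z.
Proof.
move=> hz hq; apply/matrixP => i j; rewrite ord1.
have h := bv_eigen hz hq i.
have -> : (zeta *: v + (1 - z) *: uvec z) i 0 =
  zeta * v i 0 + (1 - z) * ((U i).[z] / q.[z]) by rewrite !mxE.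
have -> : (1 - z) * ((U i).[z] / q.[z]) = bv z i 0 - zeta * v i 0.
  by rewrite mulrA -h mulrC mulKf.
by rewrite addrC subrK.
Qed.

Definition aterm z w : C := zeta^* * G z (uvec z) w v.
Definition cterm z w : C := G z (uvec z) w (uvec w).

Lemma gram_expand z w : nc z < 1 -> nc w < 1 -> q.[z] != 0 -> q.[w] != 0 ->
  D z w =
  - ((1 - z) * aterm z w + ((1 - w) * aterm w z)^* + (1 - z) * (1 - w)^* * cterm z w).
Proof.
move=> hz hw hqz hqw.
rewrite Ddef // !bv_uvec // gram_combl // !gram_combr // /aterm /cterm.
rewrite (Gsym z w v (uvec w)) !conjCM !conjCK.
have -> : zeta * (zeta^* * G z v w v + (1 - w)^* * G z v w (uvec w)) =
  (zeta * zeta^*) * G z v w v + zeta * ((1 - w)^* * G z v w (uvec w)) by ring.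
rewrite zeta1; ring.
Qed.

Definition approach (T : Type) (F : set_system T) (z w : T -> C) (x : T -> R) :=
  [/\ x t @[t --> F] --> (1 : R), z t @[t --> F] --> (1 : C), w t @[t --> F] --> (1 : C) &
   \forall t \near F, [/\ nc (z t) < 1, nc (w t) < 1,
     z t * (w t)^* = (x t)%:C & 0 < x t < 1]].

Lemma gram_limit p p' : exists e : C, forall (T : Type) (F : set_system T) (FF : Filter F)
    (z w : T -> C) (x : T -> R), approach F z w x ->
  (1 - x t)%:C * G (z t) p (w t) p' @[t --> F] --> e.
Proof.
have [e [c [c0 he]]] := Gabel p p'.
exists e => T F FF z w x [hx _ _ hzw]; apply/cvgC.
apply: (squeeze_cvgr _ (cvg_cst (0 : R)) (h := fun t => (1 - x t) * (c / x t))).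
  by apply: filterS hzw => t [hz hw zw x01]; rewrite nc_ge0 /=; exact: he.
have -> : (0 : R) = (1 - 1) * (c / 1) by rewrite subrr mul0r.
apply: cvgM; first by apply: cvgB => //; exact: cvg_cst.
apply: cvgM; first exact: cvg_cst.
by apply: cvgV => //; exact: oner_neq0.
Qed.

Lemma uvec_cvg (T : Type) (F : set_system T) (FF : Filter F) (z : T -> C) i :
  z t @[t --> F] --> (1 : C) -> uvec (z t) i 0 @[t --> F] --> uvec 1 i 0.
Proof.
move=> hz.
have h : ((U i).[z t] / q.[z t] : C) @[t --> F] --> ((U i).[1] / q.[1] : C).
  apply: cvgCM; first exact: cvg_horner.
  apply: (cvgV (K := R[i])); [exact: q1 | exact: cvg_horner].
by apply: (cvgC_eq h) => [|t]; rewrite mxE.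
Qed.

(** The direction [uvec z] moves with z. In coordinates it leaves finitely many Abel limits in fixed
    directions, with coefficients continuous at 1. *)
Lemma aterm_limit : exists e : C, forall (T : Type) (F : set_system T) (FF : Filter F)
    (z w : T -> C) (x : T -> R), approach F z w x ->
  (1 - x t)%:C * aterm (z t) (w t) @[t --> F] --> e.
Proof.
have [e he] := choice (fun i => gram_limit (delta_mx i 0) v).
exists (zeta^* * \sum_i uvec 1 i 0 * e i) => T F FF z w x hzw.
have [hx hz hw hn] := hzw.
have h : zeta^* * \sum_i uvec (z t) i 0 *
    ((1 - x t)%:C * G (z t) (delta_mx i 0) (w t) v) @[t --> F] -->
    zeta^* * \sum_i uvec 1 i 0 * e i.
  apply: cvgCZ; apply: cvg_sum => i _; apply: cvgCM; first exact: uvec_cvg.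
  exact: he.
apply: cvg_trans h; apply: near_eq_cvg; apply: filterS hn => t [hzt hwt zw x01].
rewrite /aterm (Gsum _ _ _ hzt) !mulr_sumr; apply: eq_bigr => i _; ring.
Qed.

Lemma cterm_limit : exists e : C, forall (T : Type) (F : set_system T) (FF : Filter F)
    (z w : T -> C) (x : T -> R), approach F z w x ->
  (1 - x t)%:C * cterm (z t) (w t) @[t --> F] --> e.
Proof.
have [e he] := choice (fun ij : 'I_n * 'I_n => gram_limit (delta_mx ij.1 0) (delta_mx ij.2 0)).
exists (\sum_i uvec 1 i 0 * \sum_j (uvec 1 j 0)^* * e (i, j)) => T F FF z w x hzw.
have [hx hz hw hn] := hzw.
have h : \sum_i uvec (z t) i 0 * \sum_j (uvec (w t) j 0)^* *
    ((1 - x t)%:C * G (z t) (delta_mx i 0) (w t) (delta_mx j 0)) @[t --> F] -->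
    \sum_i uvec 1 i 0 * \sum_j (uvec 1 j 0)^* * e (i, j).
  apply: cvg_sum => i _; apply: cvgCM; first exact: uvec_cvg.
  apply: cvg_sum => j _; apply: cvgCM; first by apply: cvg_conj; exact: uvec_cvg.
  exact: (he (i, j)).
apply: cvg_trans h; apply: near_eq_cvg; apply: filterS hn => t [hzt hwt zw x01].
rewrite /cterm (Gsum _ _ _ hzt) mulr_sumr; apply: eq_bigr => i _.
rewrite (gram_sumr _ _ _ hwt) mulrCA; congr (_ * _).
by rewrite mulr_sumr; apply: eq_bigr => j _; ring.
Qed.

Lemma q_near (T : Type) (F : set_system T) (FF : Filter F) (z : T -> C) :
  z t @[t --> F] --> (1 : C) -> \forall t \near F, q.[z t] != 0.
Proof.
move=> hz; have h : nc q.[z t] @[t --> F] --> nc q.[1].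
  by apply: (cvg_nc (f := fun t => q.[z t] : C) (l := q.[1] : C)); exact: cvg_horner.
have qp : 0 < nc q.[1] by rewrite lt0r nc_ge0 andbT;
  apply: contra q1 => /eqP /Normc.eq0_normc ->.
have h2 : \forall t \near F, 0 < nc q.[z t] by apply: (cvgr_gt _ h).
apply: filterS h2 => t ht.
by apply: contraTneq ht => ->; rewrite Normc.normc0 ltxx.
Qed.

(* Positivity of [D] along the rays [z = 1 - s (1 + i tau)], for all slopes [tau]. *)
Lemma aterm_limit_real (e : C) :
  (forall (T : Type) (F : set_system T) (FF : Filter F) (z w : T -> C) (x : T -> R),
    approach F z w x -> (1 - x t)%:C * aterm (z t) (w t) @[t --> F] --> e) ->
  complex.Im e = 0.
Proof.
move=> he.
have [e' he'] := cterm_limit.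
have ray (tau : R) : complex.Re e - tau * complex.Im e <= 0.
  (* m is |1 + i tau|^2, so that |1 - z|^2 = s^2 m and |z|^2 = [x s]. *)
  pose m : R := 1 + tau ^+ 2.
  have m0 : 0 < m by rewrite ltr_pwDl // sqr_ge0.
  pose z (s : R) : C := 1 - s%:C * (1 +i* tau).
  pose x (s : R) : R := 1 - 2 * s + s ^+ 2 * m.
  have zx s : z s * (z s)^* = (x s)%:C.
    by rewrite /z /x /m; apply/eqP; rewrite eq_complex /=; apply/andP; split; apply/eqP; ring.
  have zn s : nc (z s) ^+ 2 = x s.
    by apply: complexI; rewrite nc_sqr mulrC zx.
  have x1 : x s @[s --> (0 : R)^'+] --> (1 : R).
    have -> : (1 : R) = 1 - 2 * 0 + 0 ^+ 2 * m by ring.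
    have id0 : (s : R) @[s --> (0 : R)^'+] --> (0 : R) by apply: cvg_at_right_filter;
      exact: cvg_id.
    apply: cvgD; first by apply: cvgB; [exact: cvg_cst | apply: cvgM => //; exact: cvg_cst].
    by apply: cvgM; [rewrite expr2; exact: cvgM | exact: cvg_cst].
  have z1 : z s @[s --> (0 : R)^'+] --> (1 : C).
    have id0 : (s : R) @[s --> (0 : R)^'+] --> (0 : R) by apply: cvg_at_right_filter;
      exact: cvg_id.
    have h1 : 1 + - (1 +i* tau) * s%:C @[s --> (0 : R)^'+] --> (1 + - (1 +i* tau) * 0%:C : C).
      apply: (cvgCD (f := fun=> 1)); first exact: cvg_cst.
      by apply: cvgCZ; exact: cvg_realC.
    by apply: (cvgC_eq h1) => [|s]; rewrite ?mulr0 ?addr0 // /z mulNr mulrC.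
  have near1 : \forall s \near (0 : R)^'+, 0 < s /\ s * m < 1 /\ s < 2^-1.
    near=> s; split; [|split].
    - by near: s; exact: nbhs_right_gt.
    - rewrite -ltr_pdivlMr //; near: s; apply: nbhs_right_lt; rewrite divr_gt0 //.
    - by near: s; apply: nbhs_right_lt; rewrite invr_gt0.
  have x01 s : 0 < s /\ s * m < 1 /\ s < 2^-1 -> 0 < x s < 1.
    move=> [s0 [sm s2]]; rewrite /x; have h : s ^+ 2 * m < s.
      by rewrite expr2 -mulrA gtr_pMr.
    have h0 : 0 < s ^+ 2 * m by rewrite mulr_gt0 // exprn_gt0.
    apply/andP; split; lra.
  have zlt s : 0 < s /\ s * m < 1 /\ s < 2^-1 -> nc (z s) < 1.
    move=> /x01 /andP[_ h]; rewrite -zn in h.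
    by rewrite -(@expr_lt1 _ 2) ?nc_ge0.
  have happ : approach (0 : R)^'+ z z x.
    split=> //; apply: filterS near1 => s hs; split;
      [exact: zlt|exact: zlt|exact: zx|exact: x01].
  have ha : (1 - x s)%:C * aterm (z s) (z s) @[s --> (0 : R)^'+] --> e by exact: he.
  have hc : (1 - x s)%:C * cterm (z s) (z s) @[s --> (0 : R)^'+] --> e' by exact: he'.
  have hq : \forall s \near (0 : R)^'+, q.[z s] != 0 by exact: (@q_near _ _ _ z z1).
  (* This is D(z,z) >= 0 multiplied by (1 - x)/s. The two first-order terms are conjugate and give
     twice a real part, while the [cterm] part keeps the factor [s * m], which tends to 0. *)
  have ineq : \forall s \near (0 : R)^'+,
      2 * complex.Re ((1 +i* tau) * ((1 - x s)%:C * aterm (z s) (z s))) +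
      (s * m) * complex.Re ((1 - x s)%:C * cterm (z s) (z s)) <= 0.
    near=> s.
    have hs : 0 < s /\ s * m < 1 /\ s < 2^-1 by near: s.
    have qs : q.[z s] != 0 by near: s.
    have s0 : 0 < s by case: hs.
    have xs := x01 s hs.
    have hD := Dpos (zlt s hs); rewrite gram_expand ?zlt // in hD.
    move: hD; move: (aterm (z s) (z s)) (cterm (z s) (z s)) => [a1 a2] [c1 c2].
    rewrite /z lecE /= => /andP[_ hD].
    have y0 : 0 < 1 - x s by case/andP: xs => _; rewrite subr_gt0.
    have : 0 <= (1 - x s) * s^-1 * - ((2 * s) * (a1 - tau * a2) + s ^+ 2 * m * c1).
      apply: mulr_ge0; first by rewrite mulr_ge0 ?invr_ge0 // ltW.
      apply: le_trans hD _; rewrite /m le_eqVlt; apply/orP; left; apply/eqP; ring.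
    have -> : (1 - x s) * s^-1 * - ((2 * s) * (a1 - tau * a2) + s ^+ 2 * m * c1) =
      - ((1 - x s) * (2 * (a1 - tau * a2) + s * m * c1)) by field; rewrite gt_eqF.
    rewrite oppr_ge0 => h; apply: le_trans h; rewrite le_eqVlt; apply/orP; left; apply/eqP.
    simpl; ring.
  have lim : 2 * complex.Re ((1 +i* tau) * ((1 - x s)%:C * aterm (z s) (z s))) +
      (s * m) * complex.Re ((1 - x s)%:C * cterm (z s) (z s)) @[s --> (0 : R)^'+] -->
      2 * complex.Re ((1 +i* tau) * e) + (0 * m) * complex.Re e'.
    apply: cvgD.
      apply: cvgM; first exact: cvg_cst.
      exact: (cvgC_Re (cvgCZ (c := 1 +i* tau) ha)).
    apply: cvgM; last exact: (cvgC_Re hc).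
    apply: cvgM; last exact: cvg_cst.
    by apply: cvg_at_right_filter; exact: cvg_id.
  have h : 2 * complex.Re ((1 +i* tau) * e) + (0 * m) * complex.Re e' <= 0.
    exact: (cvgr_to_le lim ineq).
  by move: h; case: (e) => e1 e2 /= h; lra.
apply/eqP; apply: contraT => him.
(* For this slope the left side of [ray] equals 1. *)
have := ray (- (1 - complex.Re e) / complex.Im e).
rewrite mulNr mulNr opprK divfK // => h; lra.
Unshelve. all: by end_near. Qed.

(** Letting s and t tend to 1 independently, along the product filter, gives one r that serves
    D(s,s), D(t,t) and D(s,t) at once, as the norm of a difference requires. *)
Lemma gram_cauchy : exists l : C, forall eps : R, 0 < eps -> exists2 r : R, r < 1 &
  forall s t : R, r < s < 1 -> r < t < 1 -> nc (D s%:C t%:C - l) <= eps.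
Proof.
have [e he] := aterm_limit.
have eim := aterm_limit_real he.
have ereal : e^* = e.
  have -> : e = (complex.Re e)%:C by apply/eqP; rewrite eq_complex /= eim !eqxx.
  exact: conjC_r.
have [e' he'] := cterm_limit.
exists (- e) => eps eps0.
pose F := filter_prod (1 : R)^'- (1 : R)^'-.
pose z (p : R * R) : C := p.1%:C; pose w (p : R * R) : C := p.2%:C.
pose x (p : R * R) : R := p.1 * p.2.
have F1 : p.1 @[p --> F] --> (1 : R).
  by apply: cvg_trans (cvg_fst (F := (1 : R)^'-) (G := (1 : R)^'-)) _;
    exact: cvg_at_left_filter (cvg_id).
have F2 : p.2 @[p --> F] --> (1 : R).
  by apply: cvg_trans (cvg_snd (F := (1 : R)^'-) (G := (1 : R)^'-)) _;
    exact: cvg_at_left_filter (cvg_id).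
have nr : \forall t \near (1 : R)^'-, 0 < t < 1.
  near=> t; apply/andP; split; near: t; first exact: nbhs_left_gt.
  exact: nbhs_left_lt.
have hn : \forall p \near F, (0 < p.1 < 1) /\ (0 < p.2 < 1).
  by exists ([set t | 0 < t < 1], [set t | 0 < t < 1]).
have app : approach F z w x.
  split.
  - by rewrite -[X in _ --> X]mulr1; exact: cvgM.
  - exact: cvg_realC.
  - exact: cvg_realC.
  - apply: filterS hn => p [/andP[s0 s1] /andP[t0 t1]].
    rewrite /z /w /x; split; rewrite ?nc_real ?ger0_norm ?(ltW s0) ?(ltW t0) //.
      by rewrite conjC_r realCM.
    by rewrite mulr_gt0 //= mulr_ilt1 // ltW.
have app' : approach F w z x.
  case: app => hx hz hw happ; split=> //; apply: filterS happ => p [? ? h ?]; split=> //.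
  transitivity ((z p * (w p)^*)^*); first by rewrite conjCM conjCK mulrC.
  by rewrite h conjC_r.
have l1 : (1 - x p)%:C * aterm (z p) (w p) @[p --> F] --> e by exact: he.
have l2 : (1 - x p)%:C * aterm (w p) (z p) @[p --> F] --> e by exact: he.
have l3 : (1 - x p)%:C * cterm (z p) (w p) @[p --> F] --> e' by exact: he'.
(* This sum bounds |D + e| once 1 - st is divided out; its last term tends to 0 through the factor 1
   - s. *)
have lim : nc ((1 - x p)%:C * aterm (z p) (w p) - e) + nc ((1 - x p)%:C * aterm (w p) (z p) - e) +
    (1 - p.1) * nc (e + (1 - x p)%:C * cterm (z p) (w p)) @[p --> F] -->
    0 + 0 + (1 - 1) * nc (e + e').
  apply: cvgD; first by apply: cvgD; apply/cvgC; [exact: l1 | exact: l2].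
  apply: cvgM; first by apply: cvgB => //; exact: cvg_cst.
  apply: (cvg_nc (f := fun p => e + (1 - x p)%:C * cterm (z p) (w p)) (l := e + e')).
  by apply: (cvgCD (f := fun=> e)); [exact: cvg_cst | exact: l3].
rewrite subrr mul0r !addr0 in lim.
have [_ z1 w1 _] := app.
have hqz : \forall p \near F, q.[z p] != 0 by exact: (@q_near _ _ _ z z1).
have hqw : \forall p \near F, q.[w p] != 0 by exact: (@q_near _ _ _ w w1).
have bound : \forall p \near F, nc (D (z p) (w p) - (- e)) <= eps.
  have /cvgrPdist_le /(_ _ eps0) hl := lim.
  near=> p.
  apply: le_trans (_ : nc ((1 - x p)%:C * aterm (z p) (w p) - e) +
     nc ((1 - x p)%:C * aterm (w p) (z p) - e) +
     (1 - p.1) * nc (e + (1 - x p)%:C * cterm (z p) (w p)) <= _); last first.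
    apply: le_trans (ler_norm _) _; rewrite -normrN -[X in `|X|]add0r.
    by near: p.
  have [/andP[s0 s1] /andP[t0 t1]] : (0 < p.1 < 1) /\ (0 < p.2 < 1) by near: p.
  have hz : nc (z p) < 1 by rewrite nc_real ger0_norm // ltW.
  have hw : nc (w p) < 1 by rewrite nc_real ger0_norm // ltW.
  have qz : q.[z p] != 0 by near: p.
  have qw : q.[w p] != 0 by near: p.
  have x1 : 0 < 1 - x p by rewrite subr_gt0 /x mulr_ilt1 // ltW.
  rewrite gram_expand // opprK.
  move: (aterm (z p) (w p)) (aterm (w p) (z p)) (cterm (z p) (w p)) => a a' c.
  set y := 1 - x p; set u1 := 1 - p.1; set u2 := 1 - p.2.
  have u10 : 0 < u1 by rewrite subr_gt0.
  have u20 : 0 < u2 by rewrite subr_gt0.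
  have ezw : 1 - z p = u1%:C by rewrite /z /u1 realCB.
  have eww : 1 - w p = u2%:C by rewrite /w /u2 realCB.
  have yE : y = u1 + u2 - u1 * u2 by rewrite /y /x /u1 /u2; ring.
  (* Writing y = u1 + u2 - u1 u2 distributes e over the three terms; since e is real, it may be
     moved under the conjugation. *)
  have key : y%:C * (- ((1 - z p) * a + ((1 - w p) * a')^* + (1 - z p) * (1 - w p)^* * c) + e) =
    - (u1%:C * (y%:C * a - e) + u2%:C * (y%:C * a' - e)^* + (u1 * u2)%:C * (e + y%:C * c)).
    rewrite ezw eww !conjCM conjC_r conjCD conjCM conjCN ereal conjC_r.
    have -> : y%:C = u1%:C + u2%:C - u1%:C * u2%:C :> C by rewrite yE realCB realCD realCM.
    rewrite realCM; ring.
  have u1y : u1 <= y.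
    have -> : y = u1 + u2 * p.1 by rewrite /y /x /u1 /u2; ring.
    by rewrite lerDl mulr_ge0 // ltW.
  have u2y : u2 <= y.
    have -> : y = u2 + u1 * p.2 by rewrite /y /x /u1 /u2; ring.
    by rewrite lerDl mulr_ge0 // ltW.
  rewrite -(ler_pM2l x1) -/y.
  have -> : y * nc (- ((1 - z p) * a + ((1 - w p) * a')^* + (1 - z p) * (1 - w p)^* * c) + e) =
     nc (y%:C * (- ((1 - z p) * a + ((1 - w p) * a')^* + (1 - z p) * (1 - w p)^* * c) + e)).
    by rewrite Normc.normcM nc_real ger0_norm // ltW.
  rewrite key normcN.
  apply: le_trans (le_normcD _ _) _; rewrite [leRHS]mulrDr; apply: lerD.
    apply: le_trans (le_normcD _ _) _; rewrite [leRHS]mulrDr; apply: lerD.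
      by rewrite Normc.normcM nc_real ger0_norm ?(ltW u10) // ler_wpM2r ?nc_ge0.
    by rewrite Normc.normcM nc_conj nc_real ger0_norm ?(ltW u20) // ler_wpM2r ?nc_ge0.
  rewrite Normc.normcM nc_real ger0_norm ?mulr_ge0 ?(ltW u10) ?(ltW u20) //.
  by rewrite mulrA ler_wpM2r ?nc_ge0 // mulrC ler_wpM2r ?(ltW u10).
have [[P Q] [/= hP hQ] hPQ] := bound.
have hPQ' : \forall t \near (1 : R)^'-, P t /\ Q t by apply: filterI.
have [r /= r0 hr] := hPQ'.
exists (1 - r); first by rewrite gtrBl.
have hr' (t : R) : 1 - r < t < 1 -> P t /\ Q t.
  move=> /andP[rt t1]; apply: hr => //=.
  by rewrite ger0_norm ?subr_ge0 ?(ltW t1) //; lra.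
by move=> s t hs ht; apply: (hPQ (s, t)); split; [case: (hr' _ hs)|case: (hr' _ ht)].
Unshelve. all: by end_near. Qed.

End GramLimit.

(** In <x,x> + <y,y> - 2 Re <x,y> the number l cancels, and four errors of e^2/4 remain. *)
Lemma nrm_le_gram (R : realType) (d : nat) (x y : ell2 R d) (l : Cplx R) (e : R) : 0 <= e ->
  Normc.normc (ip x x - l) <= e ^+ 2 / 4 -> Normc.normc (ip y y - l) <= e ^+ 2 / 4 ->
  Normc.normc (ip x y - l) <= e ^+ 2 / 4 -> nrm (x - y) <= e.
Proof.
move=> e0 hx hy hxy; rewrite -ler_sqr ?nnegrE ?nrm_ge0 // nrm_sqr nsqB.
have h1 := le_trans (Re_le_nc _) hx; have h2 := le_trans (Re_le_nc _) hy.
have h3 := le_trans (Re_le_nc _) hxy; rewrite /nsq.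
move: h1 h2 h3 {hx hy hxy}; move: (ip x x) (ip y y) (ip x y) => [a1 a2] [b1 b2] [c1 c2].
case: l => l1 l2 /=; rewrite !ler_norml => /andP[? ?] /andP[? ?] /andP[? ?]; lra.
Qed.

Section KernelCauchy.
Variables (R : realType) (d n : nat) (A : 'I_d -> 'M[Cplx R]_n).
Local Notation C := (Cplx R).
Local Notation nc := (@Normc.normc R).
Local Notation E := (ell2 R d).
Hypothesis Aiso : forall x : 'cV[C]_n,
  \sum_k cdot ((A k) ^t* *m x) ((A k) ^t* *m x) = cdot x x.

Lemma ip_szego_sum y z p (x : E) : nc z < 1 ->
  ip (szego A y z p) x = \sum_i p i 0 * ip (szego A y z (delta_mx i 0)) x.
Proof.
move=> hz; apply: etrans (ip_szego Aiso y p x hz) _.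
rewrite {1}[p]matrix_sum_delta; under eq_bigr do rewrite big_ord1.
rewrite mulmx_sumr cdot_sumr; apply: eq_bigr => i _.
by rewrite -scalemxAr cdotZ; congr (_ * _); apply/esym; exact: ip_szego.
Qed.

Lemma Sop_szego_cauchy (b : fps R d) (hb : Hinf_ball b) (r : ncexpr R d)
    (M : 'M[C]_n) (y v : 'cV[C]_n) (zeta : C) :
  ncrat_represents r b -> ncrat_graph r (fun k => (A k)^T) M ->
  zeta * zeta^* = 1 -> M^T *m v = zeta *: v ->
  forall e : R, 0 < e -> exists2 r : R, r < 1 & forall s t, r < s < 1 -> r < t < 1 ->
    nrm (Sop hb (szego A y s%:C v) - Sop hb (szego A y t%:C v)) <= e.
Proof.
move=> hr hM zeta1 hv e e0.
have [U [q [q1 hU]]] := rational_boundary Aiso (proj1 hb) hr hM hv.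
pose G z p w p' : C := ip (szego A y z p) (szego A y w p').
pose X (z : C) : E := Sop hb (szego A y z v).
have Gsym z w p p' : G w p' z p = (G z p w p')^* by exact: ipC.
have Gsum (z w : C) p p' : nc z < 1 -> G z p w p' = \sum_i p i 0 * G z (delta_mx i 0) w p'.
  exact: ip_szego_sum.
have Ddef (z w : C) : nc z < 1 -> nc w < 1 ->
    ip (X z) (X w) = G z v w v - G z (bt A b z *m v) w (bt A b w *m v).
  exact: (ip_Sop_szego Aiso).
have Dpos (z : C) : nc z < 1 -> 0 <= ip (X z) (X z).
  by move=> _; rewrite ipxx ler0c nsq_ge0.
have [l hl] := gram_cauchy (G := G) (D := fun z w => ip (X z) (X w)) Gsym Gsum
  (abel_limit Aiso y) Ddef Dpos zeta1 q1 hU.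
have e4 : 0 < e ^+ 2 / 4 by rewrite divr_gt0 ?exprn_gt0.
have [rho rho1 hrho] := hl _ e4.
exists rho => // s t hs ht.
exact: (nrm_le_gram (ltW e0) (hrho s s hs hs) (hrho t t ht ht) (hrho s t hs ht)).
Qed.

End KernelCauchy.

(** * From column isometry on the invariant subspace to co-isometric rows of matrices *)

Section Coisometry.
Variables (R : realType) (d : nat) (b : fps R d).
Hypothesis hb : Hinf_ball b.
Local Notation C := (Cplx R).
Local Notation nc := (@Normc.normc R).
Local Notation E := (ell2 R d).

Lemma H2_defect_lift (h : fps R d) : H2 (defect_lift b h).
Proof.
rewrite /defect_lift; case: xgetP => [x _ [[hx _] _]|_] //; exact: H20.
Qed.

Lemma dotb_lin f (c : C) (g h : E) : kperp hb g -> kperp hb h ->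
  dotb b f (ell2val (Sop hb (c *: g + h))) =
  c * dotb b f (ell2val (Sop hb g)) + dotb b f (ell2val (Sop hb h)).
Proof.
move=> hg hh; rewrite /dotb !defect_liftE //; last exact: kperp_lin.
have hf := H2_defect_lift f.
exact: (dot_lin c hf (ell2P g) (ell2P h)).
Qed.

Lemma Tstar_lin zeta k (c : C) (g h : E) : kperp hb g -> kperp hb h ->
  Tstar b zeta k (ell2val (Sop hb (c *: g + h))) =
  c *: Tstar b zeta k (ell2val (Sop hb g)) + Tstar b zeta k (ell2val (Sop hb h)).
Proof.
move=> hg hh; rewrite /Tstar dotb_lin //.
have -> : ell2val (Sop hb (c *: g + h)) = c *: ell2val (Sop hb g) + ell2val (Sop hb h).
  by rewrite Sop_lin.
rewrite (adjoint_lin c (@H2_L R d k) (ell2P _) (ell2P _)).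
by rewrite mulrDr scalerDl scalerDr addrACA scalerA mulrCA.
Qed.

(** The adjoint of [Amx] is the matrix of the restricted operator, and in orthonormal coordinates
    [normb] is the Euclidean norm, so the column isometry on K says that the sum of the A_k A_k^* is
    the identity. *)
Lemma Amx_coisometry (zeta : C) (K : set (fps R d)) n (e : 'I_n -> fps R d) :
  (forall k h, K h -> K (Tstar b zeta k h)) ->
  column_isometric_on b K (Tstar b zeta) -> orthonormal_basis b K e ->
  forall x : 'cV[C]_n,
    \sum_k cdot ((Amx b zeta e k) ^t* *m x) ((Amx b zeta e k) ^t* *m x) = cdot x x.
Proof.
move=> hinv hiso [eH eO KE] x.
(* The minimal preimages of the basis under S are orthonormal in [ell2], where all coordinates are
   computed. *)
have [f hf] := choice (fun i => let: ex_intro2 x p q := HbP hb (eH i) in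
  ex_intro (fun x => kperp hb x /\ e i = ell2val (Sop hb x)) x (conj p q)).
have fperp i : kperp hb (f i) by case: (hf i).
have fE i : e i = ell2val (Sop hb (f i)) by case: (hf i).
have fO i j : ip (f i) (f j) = (i == j)%:R by rewrite -(dotbE (fperp i) (fperp j)) -!fE eO.
have lin_perp (c : 'I_n -> C) (s : seq 'I_n) : kperp hb (\sum_(i <- s) c i *: f i).
  elim: s => [|i s IH]; first by rewrite big_nil => u _; rewrite ip0r.
  by rewrite big_cons; apply: kperp_lin.
have sum_perp (c : 'I_n -> C) : kperp hb (\sum_i c i *: f i) by exact: lin_perp.
have Sop_sum (c : 'I_n -> C) :
    ell2val (Sop hb (\sum_i c i *: f i)) = \sum_i c i *: e i.
  rewrite (linop_sum _ _ _ (Sop_lin hb)).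
  have vs (s : seq 'I_n) (F : 'I_n -> E) :
      ell2val (\sum_(i <- s) F i) = \sum_(i <- s) ell2val (F i).
    by apply: (big_morph (@ell2val R d)).
  rewrite vs; apply: eq_bigr => i _.
  by rewrite (linopZ _ _ (Sop_lin hb)) val_scale -fE.
have K_sum (c : 'I_n -> C) : K (ell2val (Sop hb (\sum_i c i *: f i))).
  rewrite Sop_sum KE; exists n, c, e; split=> // i; exact: imageT.
have K_repr h : K h -> exists c : 'I_n -> C, h = ell2val (Sop hb (\sum_i c i *: f i)).
  rewrite KE => -[m [c [s [hs ->]]]].
  have hs' i : exists j, e j = s i by have [j _ hj] := hs i; exists j.
  have [g hg] := choice hs'.
  (* A combination from the span may use a basis vector several times; its coefficients are
     collected. *)
  exists (fun i => \sum_(j | g j == i) c j).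
  rewrite Sop_sum; under [RHS]eq_bigr do rewrite scaler_suml.
  rewrite (exchange_big_dep xpredT) //=; apply: eq_bigr => j _.
  rewrite (big_pred1 (g j)); last by move=> i; rewrite eq_sym.
  by rewrite hg.
have nsq_sum (c : 'I_n -> C) : nsq (\sum_i c i *: f i) = \sum_i nc (c i) ^+ 2.
  apply: complexI; rewrite -ipxx ip_sum rmorph_sum; apply: eq_bigr => i _.
  rewrite ipZr ipC ip_sum (bigD1 i) //= big1 ?addr0 => [|j hj].
    by rewrite ipZr fO eqxx mulr1 mulrC -nc_sqr.
  by rewrite ipZr fO eq_sym (negPf hj) mulr0.
have [g hg] := choice (fun kj : 'I_d * 'I_n =>
  K_repr _ (hinv kj.1 _ (K_sum (fun i => (i == kj.2)%:R)))).
have f1 j : \sum_i ((i == j)%:R : C) *: f i = f j.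
  rewrite (bigD1 j) //= eqxx scale1r big1 ?addr0 // => i /negPf ->; exact: scale0r.
have Te k j : Tstar b zeta k (e j) = ell2val (Sop hb (\sum_i g (k, j) i *: f i)).
  rewrite fE -{1}(f1 j); exact: (hg (k, j)).
have aE k i j : dotb b (e i) (Tstar b zeta k (e j)) = g (k, j) i.
  rewrite Te fE (dotbE (fperp i) (sum_perp _)) ip_sum (bigD1 i) //= big1 ?addr0 => [|l hl].
    by rewrite ipZr fO eqxx mulr1.
  by rewrite ipZr fO eq_sym (negPf hl) mulr0.
have AE k i : ((Amx b zeta e k) ^t* *m x) i 0 = \sum_j g (k, j) i * x j 0.
  rewrite mxE; apply: eq_bigr => j _; congr (_ * _).
  by rewrite /Amx !mxE conjCK aE.
have Tsum k (s : seq 'I_n) : Tstar b zeta k (ell2val (Sop hb (\sum_(j <- s) x j 0 *: f j))) =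
    ell2val (Sop hb (\sum_(j <- s) x j 0 *: \sum_i g (k, j) i *: f i)).
  elim: s => [|j s IH].
    (* For the empty sum, the value at 0 is found from additivity: T(0) = T(0) + T(0). *)
    have p0 : kperp hb 0 by move=> u _; rewrite ip0r.
    have S0 : Sop hb 0 = 0 by exact: linop0 (Sop_lin hb).
    have h := Tstar_lin zeta k 1 p0 p0; rewrite scaler0 addr0 scale1r in h.
    rewrite !big_nil [in RHS]S0.
    by apply: (@addrI _ (Tstar b zeta k (ell2val (Sop hb 0)))); rewrite -h addr0.
  rewrite !big_cons Tstar_lin // IH -fE Te.
  by rewrite Sop_lin.
have Tx k : normb b (Tstar b zeta k (ell2val (Sop hb (\sum_j x j 0 *: f j)))) ^+ 2 =
    \sum_i nc (((Amx b zeta e k) ^t* *m x) i 0) ^+ 2.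
  rewrite Tsum.
  have -> : \sum_j x j 0 *: (\sum_i g (k, j) i *: f i) =
      \sum_i ((Amx b zeta e k) ^t* *m x) i 0 *: f i.
    under eq_bigr do rewrite scaler_sumr.
    rewrite exchange_big; apply: eq_bigr => i _.
    rewrite AE scaler_suml; apply: eq_bigr => j _.
    by rewrite scalerA mulrC.
  by rewrite normbE // nrm_sqr nsq_sum.
have := hiso _ (K_sum (fun j => x j 0)).
under eq_bigr do rewrite Tx.
rewrite normbE // nrm_sqr nsq_sum => h.
rewrite [RHS]cdot_xx -h rmorph_sum; apply: eq_bigr => k _.
exact: cdot_xx.
Qed.

End Coisometry.

Theorem theorem5 (R : realType) (d : nat) (b : fps R d) (r : ncexpr R d)
    (hb : Hinf_ball b) (hr : ncrat_represents r b)
    (hb0 : fps_eval b (fun _ : 'I_d => 0 : 'M[Cplx R]_1) = 0)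
    (zeta : Cplx R) (hzeta : `|zeta| = 1)
    (K : set (fps R d))
    (hKM : K `<=` Mb b)
    (hKinv : forall (k : 'I_d) (h : fps R d), K h -> K (Tstar b zeta k h))
    (hKiso : column_isometric_on b K (Tstar b zeta))
    (n : nat) (e : 'I_n -> fps R d) (he : orthonormal_basis b K e)
    (v : 'cV[Cplx R]_n) (hv1 : cdot v v = 1)
    (hv : (ncrat_eval r (fun k => (Amx b zeta e k)^T))^T *m v = zeta *: v)
    (y : 'cV[Cplx R]_n) :
  exists KA : fps R d,
    [/\ Hb b KA,
        normb b (kerb b (fun k => t%:C *: Amx b zeta e k) y v - KA)
          @[t --> (1 : R)^'-] --> (0 : R)
      & forall h : fps R d, Hb b h ->
          cdot y (fps_eval h (fun k => t%:C *: Amx b zeta e k) *m v)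
            @[t --> (1 : R)^'-] --> dotb b KA h].
Proof.
have Aiso := Amx_coisometry hb hKinv hKiso he.
have zeta1 : zeta * zeta^* = 1.
  by have := normCK zeta; rewrite hzeta expr1n => <-.
(* Off the domain [ncrat_eval] is 0, and the eigenvector equation would give zeta v = 0, against
   |zeta| = 1 and |v| = 1. So the eigenvector equation itself places the transposed tuple in the
   domain. *)
have graph : ncrat_graph r (fun k => (Amx b zeta e k)^T)
    (ncrat_eval r (fun k => (Amx b zeta e k)^T)).
  rewrite /ncrat_eval; case: xgetP => [M -> //|hno].
  move: hv; rewrite /ncrat_eval xgetPN // trmx0 mul0mx => /esym h.
  have v0 : v = 0.
    by rewrite -[v]scale1r -zeta1 mulrC -scalerA h scaler0.
  by move: hv1; rewrite v0 /cdot mulmx0 mxE => /esym/eqP; rewrite oner_eq0.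
apply: (kernel_limit (hb := hb) (k := fun t => szego (Amx b zeta e) y t%:C v)).
  move=> t /andP[t0 t1] x; apply: (ip_szego Aiso).
  by rewrite nc_real ger0_norm // ltW.
exact: (Sop_szego_cauchy Aiso hb y hr graph zeta1 hv).
Qed.
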